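(* Let $\mathcal{H}_A,\mathcal{H}_B$ be separable Hilbert spaces, $\{|k\rangle\}$ a fixed orthonormal basis in $\mathcal{H}_B$, and $\mathfrak{S}_{\rm qc}$ the set of quantum-classical states of the form $\rho=\sum_kp_k\rho_k\otimes|k\rangle\langle k|$. Put $$L^{\rm qc}_{S(A|B)}(\rho|\varepsilon)=\inf\left\{S(A|B)_\sigma\,:\,\sigma\in\mathfrak{S}_{\rm qc},\ \tfrac12\|\rho-\sigma\|_1\le\varepsilon\right\}.$$ Let $\rho=\sum_kp_k\rho_k\otimes|k\rangle\langle k|$ be an arbitrary state in $\mathfrak{S}_{\rm qc}$. Then $$L^{\rm qc}_{S(A|B)}(\rho|\varepsilon)\ge S(A|B)_{\rho\ominus\varepsilon}-g(\varepsilon)\qquad\forall\varepsilon\in(0,1],\qquad\text{(i)}$$ where $\rho\ominus\varepsilon=\sum_k[p_k\rho_k-\varepsilon I_A]_+\otimes|k\rangle\langle k|$. If $S(A|B)_\rho<+\infty$ then $$L^{\rm qc}_{S(A|B)}(\rho|\varepsilon)\ge S(A|B)_\rho-S(A|B)_{\rho\wedge\varepsilon}-g(\varepsilon)\qquad\forall\varepsilon\in(0,1],\qquad\text{(ii)}$$ where $\rho\wedge\varepsilon=\sum_k\left((p_k\rho_k)\wedge\varepsilon I_A\right)\otimes|k\rangle\langle k|$. The lower bounds (i) and (ii) are faithful: their right hand sides tend to $S(A|B)_\rho\le+\infty$ as $\varepsilon\to0$.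
   Context: A quantum-classical (q-c) state is a state on $\mathcal{H}_A\otimes\mathcal{H}_B$ of the form $\rho=\sum_kp_k\rho_k\otimes|k\rangle\langle k|$, where $\{p_k,\rho_k\}$ is an ensemble of states on $\mathcal{H}_A$ ($\{p_k\}$ a probability distribution, $\rho_k$ positive trace-class operators with unit trace). $\|\cdot\|_1$ is the trace norm and $I_A$ the identity on $\mathcal{H}_A$. The quantum conditional entropy of a q-c state is defined by $S(A|B)_\rho=\sum_kp_kS(\rho_k)\in[0,+\infty]$, where $S(\rho)=\operatorname{Tr}\eta(\rho)$, $\eta(x)=-x\ln x$ ($\eta(0)=0$), is the von Neumann entropy. $S(A|B)$ is extended homogeneously to the cone generated by $\mathfrak{S}_{\rm qc}$: $S(A|B)_\varrho=(\operatorname{Tr}\varrho)\,S(A|B)_{\varrho/\operatorname{Tr}\varrho}$ for $\varrho\neq0$, and $S(A|B)_0=0$. For a positive trace-class operator $\varrho=\sum_i\lambda_i|\varphi_i\rangle\langle\varphi_i|$ (spectral representation) and $\varepsilon>0$: $\varrho\wedge\varepsilon I=\sum_i\min\{\lambda_i,\varepsilon\}|\varphi_i\rangle\langle\varphi_i|$ and $[\varrho-\varepsilon I]_+=\sum_i\max\{\lambda_i-\varepsilon,0\}|\varphi_i\rangle\langle\varphi_i|$. $g(x)=(x+1)\ln(x+1)-x\ln x$ for $x>0$, $g(0)=0$. *)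

(* Defs.v *)
(* Operators on a Hilbert space H are plain functions
   H -> H, so that sums, differences and scalings are the pointwise ones. *)
From HB Require Import structures.
From mathcomp Require Import all_boot all_order all_algebra.
From mathcomp Require Export finmap complex.
From mathcomp Require Export all_classical all_reals all_analysis.
From mathcomp Require showcase.summability.

Set Implicit Arguments.
Unset Strict Implicit.
Unset Printing Implicit Defensive.

Import Order.TTheory GRing.Theory Num.Theory.
Import numFieldNormedType.Exports.

Local Open Scope classical_set_scope.
Local Open Scope complex_scope.
Local Open Scope ring_scope.

(* The inner product is linear in its second argument (Dirac's convention). *)
HB.mixin Record isHilbert (R : realType) H of CompleteNormedModule R[i] H := {
  inner : H -> H -> R[i] ;
  inner_linearr : forall x (a : R[i]) (y z : H),
    inner x (a *: y + z) = a * inner x y + inner x z ;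
  inner_conj : forall x y, inner y x = (inner x y)^* ;
  inner_norm : forall x, inner x x = `|x| ^+ 2
}.

#[short(type="hilbertType")]
HB.structure Definition Hilbert (R : realType) :=
  {H of isHilbert R H & CompleteNormedModule R[i] H}.

Notation "''[' x , y ]" := (inner x y) : ring_scope.

Section Hilbert_spaces.
Context {R : realType}.
Implicit Types H : hilbertType R.

Definition separable H := exists A : set H, countable A /\ dense A.

Definition lin_span {H} (A : set H) : set H :=
  [set x | exists n (c : 'I_n -> R[i]) (v : 'I_n -> H),
     (forall i, A (v i)) /\ x = \sum_(i < n) c i *: v i].

Definition orthonormal {H} {I : choiceType} (D : set I) (e : I -> H) :=
  forall i j, D i -> D j -> '[e i, e j] = (i == j)%:R.

Definition orthonormal_basis {H} {I : choiceType} (D : set I) (e : I -> H) :=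
  orthonormal D e /\ dense (lin_span (e @` D)).

(* Finite partial sums of f over D; their limit along the filter totally of
   finite subsets, ordered by inclusion, is the unordered sum. *)
Definition psums {H} {I : choiceType} (D : set I) (f : I -> H) :
  {fset I} -> H := fun F => \sum_(i <- F | i \in D) f i.

Definition sums_to {H} {I : choiceType} (D : set I) (f : I -> H) (s : H) :=
  psums D f @ summability.totally --> s.

Definition hsum {H} {I : choiceType} (D : set I) (f : I -> H) : H :=
  lim (psums D f @ summability.totally).

Definition bounded_op {H} (T : H -> H) :=
  linear T /\ exists M : R, forall x, `|T x| <= M%:C * `|x|.

(* In the order of R[i], 0 <= z says that z is real and nonnegative. *)
Definition positive_op {H} (T : H -> H) :=
  bounded_op T /\ forall x, 0 <= '[x, T x].

(* |v><v| *)
Definition ketbra {H} (v : H) : H -> H := fun x => '[v, x] *: v.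

(* The trace of a positive operator, in some orthonormal basis of the separable
   space H; D ranges over subsets of nat so as to cover every dimension. *)
Definition trace {H} (T : H -> H) : \bar R :=
  let De := xget (set0, fun=> 0)
    [set De : set nat * (nat -> H) | orthonormal_basis De.1 De.2] in
  \esum_(i in De.1) (complex.Re '[De.2 i, T (De.2 i)])%:E.

(* |T|: the positive P with P^2 = T^* T, as <x, T^* T y> = <T x, T y>. *)
Definition abs_op {H} (T : H -> H) : H -> H :=
  xget (fun=> 0) [set P | positive_op P /\
                          forall x y, '[x, P (P y)] = '[T x, T y]].

Definition trace_norm {H} (T : H -> H) : \bar R := trace (abs_op T).

Definition trace_class {H} (T : H -> H) :=
  bounded_op T /\ (trace_norm T < +oo)%E.

Definition state {H} (rho : H -> H) :=
  [/\ trace_class rho, positive_op rho & trace rho = 1%E].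

Definition spectral_rep {H} (T : H -> H)
    (s : set nat * (nat -> R) * (nat -> H)) :=
  let: (D, lam, phi) := s in
  orthonormal D phi /\
  forall x, sums_to D (fun i => (lam i)%:C *: ketbra (phi i) x) (T x).

(* The eigenvectors phi need not span H: fcalc f is only used for functions f
   with f 0 = 0, for which the kernel does not contribute. *)
Definition fcalc {H} (f : R -> R) (T : H -> H) : H -> H :=
  let: (D, lam, phi) := xget (set0, fun=> 0, fun=> 0) (spectral_rep T) in
  fun x => hsum D (fun i => (f (lam i))%:C *: ketbra (phi i) x).

Definition op_min {H} (T : H -> H) (eps : R) : H -> H :=
  fcalc (fun t => Num.min t eps) T.

Definition op_posB {H} (T : H -> H) (eps : R) : H -> H :=
  fcalc (fun t => Num.max (t - eps) 0) T.

(* eta 0 = 0, because of the factor x. *)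
Definition eta (x : R) : R := - x * ln x.

Definition vN_entropy {H} (rho : H -> H) : \bar R := trace (fcalc eta rho).

Definition g (x : R) : R :=
  if x == 0 then 0 else (x + 1) * ln (x + 1) - x * ln x.

(* t exhibits HAB as the Hilbert tensor product of HA and HB (which is unique up
   to a unitary). *)
Definition hilbert_tensor {HA HB HAB : hilbertType R}
    (t : HA -> HB -> HAB) :=
  [/\ forall b, linear (t^~ b), forall a, linear (t a),
      forall a b a' b', '[t a b, t a' b'] = '[a, a'] * '[b, b']
    & dense (lin_span [set t a b | a in [set: HA] & b in [set: HB]])].

Section quantum_classical.
Context {HA HB HAB : hilbertType R} {K : countType}.
Variables (t : HA -> HB -> HAB) (ket : K -> HB).

(* The bounded operator A (x) B on HAB. *)
Definition tensor_op (A : HA -> HA) (B : HB -> HB) : HAB -> HAB :=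
  xget (fun=> 0) [set T | bounded_op T /\
                          forall a b, T (t a b) = t (A a) (B b)].

(* \sum_k X_k (x) |k><k| *)
Definition qc_op (X : K -> HA -> HA) : HAB -> HAB :=
  fun z => hsum [set: K] (fun k => tensor_op (X k) (ketbra (ket k)) z).

Definition ensemble (p : K -> R) (r : K -> HA -> HA) :=
  [/\ forall k, 0 <= p k, \esum_(k in [set: K]) (p k)%:E = 1%E
    & forall k, state (r k)].

Definition weighted (p : K -> R) (r : K -> HA -> HA) : K -> HA -> HA :=
  fun k => (p k)%:C *: r k.

Definition qc_rep (s : HAB -> HAB) (pr : (K -> R) * (K -> HA -> HA)) :=
  ensemble pr.1 pr.2 /\ s = qc_op (weighted pr.1 pr.2).

Definition qc_state (s : HAB -> HAB) := exists pr, qc_rep s pr.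

(* S(A|B) on q-c states; it does not depend on the representation chosen (note
   that 0 * +oo = 0 in \bar R). *)
Definition cond_entropy (s : HAB -> HAB) : \bar R :=
  let: (p, r) := xget (fun=> 0, fun=> fun=> 0) (qc_rep s) in
  (\esum_(k in [set: K]) ((p k)%:E * vN_entropy (r k)))%E.

(* The homogeneous extension of S(A|B) to the cone generated by the q-c
   states. *)
Definition cond_entropy_cone (s : HAB -> HAB) : \bar R :=
  if `[< s = 0 >] then 0%E
  else (trace s * cond_entropy ((fine (trace s))^-1%:C *: s))%E.

Definition Lqc (rho : HAB -> HAB) (eps : R) : \bar R :=
  ereal_inf [set cond_entropy s | s in
    [set s | qc_state s /\ ((2^-1)%:E * trace_norm (rho - s)%R <= eps%:E)%E]].

End quantum_classical.
End Hilbert_spaces.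

(* Main.v *)
(* For a q-c state with unnormalized blocks [A_k = p_k rho_k] of eigenvalues
   [x_ki], the conditional entropy is the sum of the nonnegative terms
   [x_ki ln (p_k / x_ki)], and its homogeneous extension is given by the same
   formula with [p_k] replaced by [sum_i x_ki]; this function [S] of nonnegative
   arrays is superadditive by Gibbs' inequality.  If [sigma] is [eps]-close to
   [rho] and has sorted eigenvalues [y_ki], then Mirsky's inequality gives
   [sum_ki (x_ki - y_ki)_+ <= eps].  Hence [(x - eps)_+ <= y] termwise, and (i)
   follows as [g >= 0].  For (ii), [d = (x - y)_+] satisfies
   [d <= min (x, eps)] and [x <= y + d], so that
   [S x <= S (y + d) <= S y + S d + g eps <= S y + S (min (x, eps)) + g eps].
   Faithfulness follows from the lower semicontinuity of [S] and from
   [S ((x - eps)_+) + S (min (x, eps)) <= S x]. *)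

(* [trace], [abs_op], [fcalc], [tensor_op] and [cond_entropy] rest on choices made by [xget], so
   each needs an existence proof and properties that do not depend on the choice. For the first
   three this comes down to a spectral theorem for positive operators of finite trace.

   The blocks of rho and sigma need not commute, which is why only their sorted eigenvalues are
   compared; what remains concerns arrays of nonnegative reals. The tool there is [ln u <= u - 1].
   Applied against the normalized sum of two rows, it gives superadditivity, and with it
   monotonicity of [S], although a single term [x ln (P / x)] is not monotone in [x]. Applied
   against the fixed weights [1 : eps], it bounds the entropy of mixing [y] and [d] by an expression
   linear in the row totals; summed over the rows this is at most
   [ln (1 + eps) + eps ln ((1 + eps) / eps)], which is [g eps].

   Sums may be [+oo], so finite remainders are added to both sides of an inequality instead of being
   subtracted. *)
Require Import Defs.
From HB Require Import structures.
From mathcomp Require Import all_boot all_order all_algebra finmap.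
From mathcomp Require Import all_classical all_reals all_analysis complex.
From mathcomp Require Import ring lra.
From mathcomp Require showcase.summability.

Set Implicit Arguments.
Unset Strict Implicit.
Unset Printing Implicit Defensive.

Import Order.TTheory GRing.Theory Num.Theory.
Import numFieldNormedType.Exports.

Local Open Scope classical_set_scope.
Local Open Scope complex_scope.
Local Open Scope ring_scope.

(** * Norms and forms with real values *)

Section real_norm.
Context {R : realType}.

(** Norms over [R[i]] take values in [R[i]], whose order is only partial; the real version gives
    access to the order of [R] and to [lra]. *)
Definition nrm {V : normedZmodType R[i]} (x : V) : R := complex.Re `|x|.

Context {V : normedZmodType R[i]}.
Implicit Types x y : V.

Lemma nrmE x : `|x| = (nrm x)%:C.
Proof.
rewrite /nrm; have := normr_ge0 x; case: (`|x|) => a b.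
by rewrite lecE /= => /andP[/eqP -> _].
Qed.

Lemma nrm_ge0 x : 0 <= nrm x.
Proof. by have := normr_ge0 x; rewrite nrmE ler0c. Qed.

Lemma nrm0 : nrm (0 : V) = 0.
Proof. by rewrite /nrm normr0. Qed.

Lemma nrm0_eq0 x : nrm x = 0 -> x = 0.
Proof. by move=> x0; apply/eqP; rewrite -normr_eq0 nrmE x0. Qed.

Lemma nrmN x : nrm (- x) = nrm x.
Proof. by rewrite /nrm normrN. Qed.

Lemma nrmC x y : nrm (x - y) = nrm (y - x).
Proof. by rewrite /nrm distrC. Qed.

Lemma nrmD x y : nrm (x + y) <= nrm x + nrm y.
Proof. by have := ler_normD x y; rewrite !nrmE -rmorphD lecR. Qed.

Lemma nrmB x y : nrm (x - y) <= nrm x + nrm y.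
Proof. by rewrite (le_trans (nrmD _ _))// nrmN. Qed.

Lemma nrm_lt x (e : R) : (`|x| < e%:C) = (nrm x < e).
Proof. by rewrite nrmE ltcR. Qed.

End real_norm.

Section complex_norm.
Context {R : realType}.
Implicit Types z w : R[i].

Lemma nrm_sqr z : nrm z ^+ 2 = complex.Re z ^+ 2 + complex.Im z ^+ 2.
Proof.
apply: complexI; rewrite add_Re2_Im2 nrmE.
by rewrite -[X in X = _]/((real_complex R) _) rmorphXn.
Qed.

Lemma nrmM z w : nrm (z * w) = nrm z * nrm w.
Proof. by apply: complexI; rewrite -nrmE normrM !nrmE -rmorphM. Qed.

Lemma nrm_conj z : nrm z^* = nrm z.
Proof. by rewrite /nrm; case: z => a b; rewrite !normc_def /= sqrrN. Qed.

Lemma nrm_real (a : R) : nrm a%:C = `|a|.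
Proof. by rewrite /nrm normc_def /= expr0n addr0 sqrtr_sqr. Qed.

Lemma Re_le_nrm z : `|complex.Re z| <= nrm z.
Proof. by have := normc_ge_Re z; rewrite nrmE lecR. Qed.

Lemma conjCD z w : (z + w)^* = z^* + w^*.
Proof. by rewrite rmorphD. Qed.

Lemma conjCM z w : (z * w)^* = z^* * w^*.
Proof. by rewrite rmorphM. Qed.

Lemma conjCN z : (- z)^* = - z^*.
Proof. by rewrite rmorphN. Qed.

Lemma conjCC z : z^*^* = z.
Proof. by rewrite conjCK. Qed.

Lemma ReJ z : complex.Re z^* = complex.Re z.
Proof. by case: z. Qed.

Lemma ReD z w : complex.Re (z + w) = complex.Re z + complex.Re w.
Proof. exact: raddfD. Qed.

Lemma ReN z : complex.Re (- z) = - complex.Re z.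
Proof. exact: raddfN. Qed.

Lemma ReB z w : complex.Re (z - w) = complex.Re z - complex.Re w.
Proof. exact: raddfB. Qed.

Lemma Re_sum I (r : seq I) (P : pred I) (F : I -> R[i]) :
  complex.Re (\sum_(i <- r | P i) F i) = \sum_(i <- r | P i) complex.Re (F i).
Proof. exact: raddf_sum. Qed.

Lemma ReZ (a : R) z : complex.Re (a%:C * z) = a * complex.Re z.
Proof. by case: z => x y /=; rewrite mul0r subr0. Qed.

Lemma mul_conj z : z^* * z = (nrm z ^+ 2)%:C.
Proof.
rewrite nrm_sqr; case: z => x y /=; apply/eqP; rewrite eq_complex /=.
by apply/andP; split; apply/eqP; ring.
Qed.

Lemma conjC_real (a : R) : (a%:C)^* = a%:C.
Proof. by apply/eqP; rewrite eq_complex /= eqxx oppr0 eqxx. Qed.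

Lemma ge0_Re z : 0 <= z -> z = (complex.Re z)%:C.
Proof. by case: z => a b; rewrite lecE /= => /andP[/eqP -> _]. Qed.

End complex_norm.

Section inner_product.
Context {R : realType} {H : hilbertType R}.
Implicit Types x y z : H.

Lemma innerDr x y z : '[x, y + z] = '[x, y] + '[x, z].
Proof. by have := inner_linearr x 1 y z; rewrite scale1r mul1r. Qed.

Lemma inner0r x : '[x, 0] = 0.
Proof. by apply: (addrI '[x, 0]); rewrite -innerDr !addr0. Qed.

Lemma innerZr x (a : R[i]) y : '[x, a *: y] = a * '[x, y].
Proof. by rewrite -[a *: y]addr0 inner_linearr inner0r addr0. Qed.

Lemma innerNr x y : '[x, - y] = - '[x, y].
Proof. by rewrite -scaleN1r innerZr mulN1r. Qed.

Lemma innerBr x y z : '[x, y - z] = '[x, y] - '[x, z].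
Proof. by rewrite innerDr innerNr. Qed.

Lemma inner_sumr I (r : seq I) (P : pred I) (F : I -> H) x :
  '[x, \sum_(i <- r | P i) F i] = \sum_(i <- r | P i) '[x, F i].
Proof.
elim/big_rec2 : _ => [|i y z _ <-]; first exact: inner0r.
by rewrite innerDr.
Qed.

Lemma innerDl x y z : '[y + z, x] = '[y, x] + '[z, x].
Proof. by rewrite inner_conj innerDr conjCD -!inner_conj. Qed.

Lemma inner0l x : '[0, x] = 0.
Proof. by rewrite inner_conj inner0r rmorph0. Qed.

Lemma innerZl x (a : R[i]) y : '[a *: y, x] = a^* * '[y, x].
Proof. by rewrite inner_conj innerZr conjCM -inner_conj. Qed.

Lemma innerNl x y : '[- y, x] = - '[y, x].
Proof. by rewrite inner_conj innerNr conjCN -inner_conj. Qed.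

Lemma innerBl x y z : '[y - z, x] = '[y, x] - '[z, x].
Proof. by rewrite innerDl innerNl. Qed.

Lemma inner_suml I (r : seq I) (P : pred I) (F : I -> H) x :
  '[\sum_(i <- r | P i) F i, x] = \sum_(i <- r | P i) '[F i, x].
Proof.
elim/big_rec2 : _ => [|i y z _ <-]; first exact: inner0l.
by rewrite innerDl.
Qed.

Lemma inner_nrm x : '[x, x] = (nrm x ^+ 2)%:C.
Proof. by rewrite inner_norm nrmE rmorphXn. Qed.

Lemma nrm_inner_sym x y : nrm '[x, y] = nrm '[y, x].
Proof. by rewrite inner_conj nrm_conj. Qed.

Lemma nrmZ (a : R[i]) x : nrm (a *: x) = nrm a * nrm x.
Proof. by apply: complexI; rewrite -nrmE normrZ !nrmE -rmorphM. Qed.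

Lemma nrm_sqrD x y :
  nrm (x + y) ^+ 2 = nrm x ^+ 2 + 2 * complex.Re '[x, y] + nrm y ^+ 2.
Proof.
apply: complexI; rewrite -inner_nrm innerDr !innerDl !inner_nrm.
rewrite (inner_conj x y); case: '[x, y] => a b.
by apply/eqP; rewrite eq_complex /=; apply/andP; split; apply/eqP; ring.
Qed.

Lemma nrm_sqrB x y :
  nrm (x - y) ^+ 2 = nrm x ^+ 2 - 2 * complex.Re '[x, y] + nrm y ^+ 2.
Proof. by rewrite nrm_sqrD innerNr nrmN raddfN /= mulrN. Qed.

Lemma inner_eq0 x : '[x, x] = 0 -> x = 0.
Proof.
by rewrite inner_nrm => /complexI /eqP; rewrite sqrf_eq0 => /eqP /nrm0_eq0.
Qed.

Lemma inner_ext x y : (forall z, '[z, x] = '[z, y]) -> x = y.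
Proof.
move=> xy; apply/eqP; rewrite -subr_eq0; apply/eqP/inner_eq0.
by rewrite innerBr xy subrr.
Qed.

End inner_product.

Section linear_maps.
Context {R : realType} {H H' : hilbertType R}.
Implicit Types T : H -> H'.

Lemma lin0 T : linear T -> T 0 = 0.
Proof.
move=> lT; have := lT (-1) 0 0; rewrite scaler0 addr0 scaleN1r addNr.
by [].
Qed.

Lemma linZ T a x : linear T -> T (a *: x) = a *: T x.
Proof. by move=> lT; rewrite -[a *: x]addr0 lT lin0 // addr0. Qed.

Lemma linD T x y : linear T -> T (x + y) = T x + T y.
Proof. by move=> lT; rewrite -[x]scale1r lT !scale1r. Qed.

Lemma linN T x : linear T -> T (- x) = - T x.
Proof. by move=> lT; rewrite -scaleN1r linZ// scaleN1r. Qed.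

Lemma linB T x y : linear T -> T (x - y) = T x - T y.
Proof. by move=> lT; rewrite linD// linN. Qed.

Lemma lin_sum T I (r : seq I) (P : pred I) (F : I -> H) : linear T ->
  T (\sum_(i <- r | P i) F i) = \sum_(i <- r | P i) T (F i).
Proof.
move=> lT; elim/big_rec2 : _ => [|i y z _ <-]; first exact: lin0.
by rewrite linD.
Qed.

(* bounded_op only covers endomorphisms. *)
Definition bounded_lin T := linear T /\ exists M : R, forall x, nrm (T x) <= M * nrm x.

End linear_maps.

Section forms.
Context {R : realType} {H : hilbertType R}.
Implicit Types (x y z : H) (T : H -> H).

Definition qform T x : R := complex.Re '[x, T x].

Lemma bounded_opE T : bounded_op T <-> bounded_lin T.
Proof.
split=> -[lT [M TM]]; split=> //; exists M => x.
  by have := TM x; rewrite !nrmE -rmorphM lecR.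
by rewrite !nrmE -rmorphM lecR.
Qed.

Lemma bounded_pos T : bounded_op T ->
  exists2 M : R, 0 < M & forall x, nrm (T x) <= M * nrm x.
Proof.
move=> /bounded_opE[_ [M TM]]; exists (Num.max M 1); first by rewrite lt_max ltr01 orbT.
by move=> x; rewrite (le_trans (TM x))// ler_wpM2r ?nrm_ge0// le_max lexx.
Qed.

Lemma positive_lin T : positive_op T -> linear T.
Proof. by case=> -[]. Qed.

Lemma qformE T x : positive_op T -> '[x, T x] = (qform T x)%:C.
Proof. by move=> [_ T0]; apply: ge0_Re. Qed.

Lemma qform_ge0 T x : positive_op T -> 0 <= qform T x.
Proof. by move=> T0; rewrite -ler0c -qformE//; case: T0. Qed.

Definition selfadjoint T := forall x y, '[x, T y] = '[T x, y].

(* Polarization: the form of T is real on x + y and on x + i y. *)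
Lemma positive_selfadjoint T : positive_op T -> selfadjoint T.
Proof.
move=> Tp x y; have lT := positive_lin Tp.
have h a : a * '[x, T y] + a^* * '[y, T x] = (a * '[x, T y] + a^* * '[y, T x])^*.
  have := qformE (x + a *: y) Tp.
  rewrite (linD _ _ lT) (linZ _ _ lT) innerDr innerZr !innerDl innerZl.
  rewrite (qformE x Tp) => E0; move: E0.
  have := qformE y Tp => yTy.
  rewrite innerZl yTy.
  set u := '[x, T y]; set v := '[y, T x].
  move=> E.
  have -> : a * u + a^* * v =
      (qform T (x + a *: y))%:C - (qform T x)%:C - a * a^* * (qform T y)%:C.
    by rewrite -E; ring.
  rewrite !conjCD !conjCN !conjCM conjCC !conjC_real.
  by congr (_ - _ * _); rewrite mulrC.
rewrite (inner_conj y (T x)); move: (h 1) (h ('i)%C) => {h}.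
case: '[x, T y] => a b; case: '[y, T x] => c d.
move=> /eqP; rewrite eq_complex /= => /andP[_ /eqP h1].
move=> /eqP; rewrite eq_complex /= => /andP[_ /eqP h2].
by apply/eqP; rewrite eq_complex /=; apply/andP; split; apply/eqP; lra.
Qed.

Lemma positive_id : positive_op (id : H -> H).
Proof.
split; last by move=> x; rewrite inner_norm exprn_ge0.
by apply/bounded_opE; split => //; exists 1 => x; rewrite mul1r.
Qed.

Lemma qformD T x y : positive_op T ->
  qform T (x + y) = qform T x + 2 * complex.Re '[x, T y] + qform T y.
Proof.
move=> Tp; have lT := positive_lin Tp.
rewrite /qform (linD _ _ lT) innerDr !innerDl !raddfD /=.
rewrite (positive_selfadjoint Tp y x) (inner_conj x (T y)) ReJ; ring.
Qed.

Lemma qformZ T a x : positive_op T -> qform T (a *: x) = nrm a ^+ 2 * qform T x.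
Proof.
move=> Tp; have lT := positive_lin Tp.
by rewrite /qform (linZ _ _ lT) innerZr innerZl mulrA [a * _]mulrC mul_conj ReZ.
Qed.

(** Cauchy-Schwarz for the possibly degenerate semi-inner product defined by [T]. *)
Lemma qform_CS T x y : positive_op T ->
  nrm '[x, T y] ^+ 2 <= qform T x * qform T y.
Proof.
move=> Tp; have lT := positive_lin Tp.
have [y0|y0] := eqVneq (qform T y) 0.
  rewrite y0 mulr0.
  set z := '[x, T y].
  (* When the form vanishes at [y], it is affine along multiples of [y]; being nonnegative
     everywhere, it must have slope zero. *)
  have h (s : R) : 0 <= qform T x + 2 * s * nrm z ^+ 2.
    have := qform_ge0 (x + (s%:C * z^*) *: y) Tp.
    rewrite qformD// qformZ// y0 mulr0 addr0 (linZ _ _ lT) innerZr -/z.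
    by rewrite -mulrA mul_conj ReZ /= mulrA.
  have [//|z0] := leP (nrm z ^+ 2) 0.
  (* This value of [s] makes the affine expression equal to [-1]. *)
  have := h (- (qform T x + 1) / (2 * nrm z ^+ 2)).
  rewrite (_ : 2 * _ * _ = - (qform T x + 1)); last first.
    have z1 : nrm z != 0 by apply: contraTneq z0 => ->; rewrite expr0n ltxx.
    by field; rewrite ?z1.
  by lra.
have y1 : 0 < qform T y by rewrite lt_def y0 qform_ge0.
set z := '[x, T y].
(* The multiple of [y] that minimizes the form. *)
have := qform_ge0 (x - ((qform T y)^-1%:C * z^*) *: y) Tp.
rewrite -scaleNr qformD// qformZ// (linZ _ _ lT) innerZr -/z nrmN nrmM nrm_conj.
rewrite mulNr raddfN /= -mulrA mul_conj ReZ /= nrm_real ger0_norm ?invr_ge0 ?(ltW y1)//.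
move=> /(mulr_ge0 (ltW y1)) h; rewrite -subr_ge0; apply: le_trans h _.
by rewrite le_eqVlt; apply/orP; left; apply/eqP; field.
Qed.

Lemma inner_CS x y : nrm '[x, y] <= nrm x * nrm y.
Proof.
rewrite -(@ler_pXn2r _ 2) ?nnegrE ?mulr_ge0 ?nrm_ge0// exprMn.
have := qform_CS x y positive_id.
by rewrite /qform !inner_nrm.
Qed.

Lemma qform_le T M x : (forall x, nrm (T x) <= M * nrm x) ->
  qform T x <= M * nrm x ^+ 2.
Proof.
move=> TM; rewrite /qform (le_trans (ler_norm _))// (le_trans (Re_le_nrm _))//.
rewrite (le_trans (inner_CS _ _))// expr2 mulrA [M * _]mulrC -mulrA.
by rewrite ler_wpM2l ?nrm_ge0.
Qed.

(** Cauchy-Schwarz for the form of [T] at [T x] and [x] bounds the fourth power of [nrm (T x)] by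
    [M * nrm (T x) ^+ 2 * qform T x]; one square cancels. *)
Lemma positive_sqr_le T M : positive_op T ->
  (forall x, qform T x <= M * nrm x ^+ 2) ->
  forall x, nrm (T x) ^+ 2 <= M * qform T x.
Proof.
move=> Tp TM x; have := qform_CS (T x) x Tp.
rewrite inner_nrm nrm_real ger0_norm ?exprn_ge0 ?nrm_ge0// => h.
have [->|n0] := eqVneq (nrm (T x)) 0.
  rewrite expr0n /=; have [->|x0] := eqVneq x 0.
    by rewrite /qform inner0l mulr0.
  rewrite mulr_ge0 ?qform_ge0//.
  have /(le_trans (qform_ge0 x Tp)) := TM x; rewrite pmulr_lge0//.
  by rewrite exprn_gt0// lt_def nrm_ge0 andbT; apply: contra_neq x0 => /nrm0_eq0.
have n1 : 0 < nrm (T x) ^+ 2 by rewrite exprn_gt0// lt_def n0 nrm_ge0.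
rewrite -(@ler_pM2r _ (nrm (T x) ^+ 2))// -expr2 (le_trans h)//.
rewrite mulrC [leRHS]mulrAC [M * _ * _]mulrC.
by rewrite ler_wpM2l ?qform_ge0.
Qed.

Lemma positive_nrm_le T M : 0 <= M -> positive_op T ->
  (forall x, qform T x <= M * nrm x ^+ 2) ->
  forall x, nrm (T x) <= M * nrm x.
Proof.
move=> M0 Tp TM x; rewrite -(@ler_pXn2r _ 2) ?nnegrE ?mulr_ge0 ?nrm_ge0//.
rewrite (le_trans (positive_sqr_le Tp TM x))// exprMn (expr2 M) -mulrA.
by rewrite ler_wpM2l.
Qed.

Lemma nrm_sum_orth (I : choiceType) (r : seq I) (P : pred I) (v : I -> H) :
  uniq r -> (forall i j, P i -> P j -> i != j -> '[v i, v j] = 0) ->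
  nrm (\sum_(i <- r | P i) v i) ^+ 2 = \sum_(i <- r | P i) nrm (v i) ^+ 2.
Proof.
move=> + vo; elim: r => [_|i r IH /= /andP[ir ur]].
  by rewrite !big_nil nrm0 expr0n.
rewrite !big_cons; case: ifPn => Pi; last exact: IH.
rewrite nrm_sqrD IH// inner_sumr big_seq_cond big1 ?mulr0 ?addr0//.
move=> j /andP[jr Pj]; apply: vo => //.
by apply: contraNneq ir => ->.
Qed.

End forms.

(** * Unordered sums *)

Section finite_sums.
Context {I : choiceType}.

Lemma big_fset_split {V : nmodType} (F0 F : {fset I}) (P : pred I) (v : I -> V) :
  (F0 `<=` F)%fset ->
  \sum_(i <- F | P i) v i =
  \sum_(i <- F0 | P i) v i + \sum_(i <- (F `\` F0)%fset | P i) v i.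
Proof.
move=> F0F; rewrite (big_fsetIDcond _ (mem F0)); congr (_ + _); apply: eq_fbigl_cond => i;
  rewrite !inE /=.
  by apply: andb_id2r => _; apply/andP/idP => [[]//|iF0]; split => //; exact: (fsubsetP F0F).
by rewrite [(i \notin F0) && _]andbC.
Qed.

Lemma psum_le {R : realType} (F0 F : {fset I}) (P : pred I) (a : I -> R) :
  (forall i, P i -> 0 <= a i) -> (F0 `<=` F)%fset ->
  \sum_(i <- F0 | P i) a i <= \sum_(i <- F | P i) a i.
Proof. by move=> a0 FF; rewrite (big_fset_split _ _ FF) lerDl sumr_ge0. Qed.

End finite_sums.

Section esum_partial.
Context {R : realType} {I : choiceType}.
Implicit Types (D : set I) (a : I -> R).

Lemma psum_le_esum D (a : I -> \bar R) (F : {fset I}) :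
  (\sum_(i <- F | i \in D) a i <= \esum_(i in D) a i)%E.
Proof.
apply: esum_ge; exists ([set` F] `&` D).
  by split; [exact: finite_setIl | move=> ? []].
rewrite fsbig_finite /=; last exact: finite_setIl.
rewrite big_fset_condE le_eqVlt; apply/orP; left; apply/eqP.
apply: eq_fbigl => i; rewrite in_fset_set; last exact: finite_setIl.
rewrite !inE /= in_setI; congr (_ && _).
by apply/idP/idP => [|/set_mem]//; exact: mem_set.
Qed.

Lemma esum_le_psum D (a : I -> \bar R) (M : \bar R) :
  (forall F : {fset I}, \sum_(i <- F | i \in D) a i <= M)%E ->
  (\esum_(i in D) a i <= M)%E.
Proof.
move=> FM; apply: ge_ereal_sup => _ [X [Xf XD] <-].
rewrite fsbig_finite//= (le_trans _ (FM (fset_set X)))//.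
rewrite le_eqVlt; apply/orP; left; apply/eqP.
rewrite big_seq_cond [RHS]big_seq_cond; apply: eq_bigl => i.
rewrite andbT in_fset_set//; have [/set_mem /XD Di|//] := boolP (i \in X).
by rewrite mem_set.
Qed.

Lemma esum_limP D a s : (forall i, D i -> 0 <= a i) ->
  (forall e : R, 0 < e -> exists F0 : {fset I}, forall F : {fset I},
    (F0 `<=` F)%fset -> `|s - \sum_(i <- F | i \in D) a i| < e) ->
  (\esum_(i in D) (a i)%:E = s%:E)%E.
Proof.
move=> a0 lim; have a0' i : i \in D -> 0 <= a i by rewrite inE; exact: a0.
apply/eqP; rewrite eq_le; apply/andP; split.
  apply: esum_le_psum => F; rewrite sumEFin lee_fin; apply/ler_addgt0Pr => e e0.
  have [F0 hF] := lim _ e0; have := hF (F0 `|` F)%fset (fsubsetUl _ _).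
  have := psum_le a0' (fsubsetUr F0 F).
  by rewrite ltr_norml => h1 /andP[h2 h3]; lra.
apply/lee_addgt0Pr => e e0; have [F0 hF] := lim _ e0.
have := hF F0 (fsubset_refl _); rewrite ltr_norml => /andP[h1 h2].
apply: (@le_trans _ _ ((\sum_(i <- F0 | i \in D) a i) + e)%:E).
  by rewrite lee_fin; lra.
by rewrite EFinD leeD2r// -sumEFin psum_le_esum.
Qed.

End esum_partial.

Section sums.
Context {R : realType} {H : hilbertType R} {I : choiceType}.
Implicit Types (D : set I) (f g : I -> H) (s : H).

Lemma sums_toP D f s : sums_to D f s <->
  forall e : R, 0 < e -> exists F0 : {fset I}, forall F, (F0 `<=` F)%fset ->
    nrm (s - psums D f F) < e.
Proof.
have FF := @summability.totally_filter I.
rewrite /sums_to; split.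
  move=> /cvgrPdist_lt h e e0; have := h e%:C.
  rewrite ltcR => /(_ e0)[F0 _ hF]; exists F0 => F /hF /=.
  by rewrite nrm_lt.
move=> h; apply/cvgrPdist_lt => e; rewrite ltcE /= => /andP[/eqP ime ree].
have ee : e = (complex.Re e)%:C by case: e ime ree => a b /= ->.
have [F0 hF] := h _ ree; exists F0 => // F /hF.
by rewrite /= ee nrm_lt.
Qed.

Lemma hsumE D f s : sums_to D f s -> hsum D f = s.
Proof.
move=> h; apply: (@cvg_lim _ _ _ _ summability.totally_filter); last exact: h.
exact: norm_hausdorff.
Qed.

Lemma sums_to_uniq D f s s' : sums_to D f s -> sums_to D f s' -> s = s'.
Proof. by move=> /hsumE <- /hsumE. Qed.

Lemma eq_psums D f g F : (forall i, D i -> f i = g i) -> psums D f F = psums D g F.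
Proof. by move=> fg; apply: eq_bigr => i; rewrite inE => /fg. Qed.

Lemma eq_sums_to D f g s : (forall i, D i -> f i = g i) -> sums_to D f s -> sums_to D g s.
Proof.
move=> fg /sums_toP h; apply/sums_toP => e /h[F0 hF]; exists F0 => F /hF.
by rewrite (eq_psums _ fg).
Qed.

Lemma sums_to0 D f : (forall i, D i -> f i = 0) -> sums_to D f 0.
Proof.
move=> f0; apply/sums_toP => e e0; exists fset0 => F _.
by rewrite (eq_psums _ (f0 : forall i, D i -> f i = (fun=> 0) i)) /psums big1// subr0 nrm0.
Qed.

Lemma sums_to_inner D f s x : sums_to D f s ->
  forall e : R, 0 < e -> exists F0 : {fset I}, forall F : {fset I}, (F0 `<=` F)%fset ->
    nrm ('[x, s] - \sum_(i <- F | i \in D) '[x, f i]) < e.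
Proof.
move=> /sums_toP h e e0; have x0 : 0 < nrm x + 1 by rewrite ltr_wpDl ?nrm_ge0.
have [F0 hF] := h (e / (nrm x + 1)) (divr_gt0 e0 x0).
exists F0 => F /hF; rewrite -inner_sumr -innerBr => h1.
rewrite (le_lt_trans (inner_CS _ _))//.
rewrite (@le_lt_trans _ _ ((nrm x + 1) * nrm (s - psums D f F)))//.
  by rewrite ler_wpM2r ?nrm_ge0// lerDl.
by rewrite mulrC -ltr_pdivlMr.
Qed.

Lemma sums_to_inner_esum D f s x a : sums_to D f s ->
  (forall i, D i -> complex.Re '[x, f i] = a i /\ 0 <= a i) ->
  (\esum_(i in D) (a i)%:E = (complex.Re '[x, s])%:E)%E.
Proof.
move=> /sums_to_inner h ha; apply: esum_limP => [i /ha[]//|e e0].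
have [F0 hF] := h x _ e0; exists F0 => F /hF; apply: le_lt_trans.
apply: le_trans (Re_le_nrm _).
rewrite (_ : _ - _ = complex.Re ('[x, s] - \sum_(i <- F | i \in D) '[x, f i]))//.
rewrite ReB Re_sum; congr (_ - _).
by apply: eq_bigr => i; rewrite inE => /ha[].
Qed.

Lemma sums_to_inner_ge0 D f s x : sums_to D f s ->
  (forall i, D i -> 0 <= '[x, f i]) -> 0 <= '[x, s].
Proof.
move=> h f0; rewrite lecE /=; apply/andP; split; last first.
  rewrite -lee_fin -(sums_to_inner_esum h (a := fun i => complex.Re '[x, f i])).
    by apply: esum_ge0 => i /f0; rewrite lecE lee_fin => /andP[].
  by move=> i /f0; rewrite lecE => /andP[].
(* In the order of [R[i]] the imaginary part has to vanish: it is at most the distance from the sum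
   to its partial sums, which are real. *)
rewrite -normr_le0; apply/ler_addgt0Pr => e e0; rewrite add0r.
have [F0 hF] := sums_to_inner x h e0; have := hF F0 (fsubset_refl _).
rewrite (_ : \sum_(i <- F0 | _) _ =
    (\sum_(i <- F0 | i \in D) complex.Re '[x, f i])%:C); last first.
  by rewrite rmorph_sum; apply: eq_bigr => i; rewrite inE => /f0/ge0_Re.
move=> /ltW; apply: le_trans.
rewrite -(@ler_pXn2r _ 2) ?nnegrE ?nrm_ge0// nrm_sqr real_normK ?num_real//.
by case: '[x, s] => u v /=; rewrite subr0 lerDr sqr_ge0.
Qed.

Lemma sums_to_inner1 D f s x j : sums_to D f s -> D j ->
  (forall i, D i -> i <> j -> '[x, f i] = 0) -> '[x, s] = '[x, f j].
Proof.
move=> /sums_to_inner h Dj f0; apply/eqP; rewrite -subr_eq0; apply/eqP/nrm0_eq0.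
apply/eqP; rewrite eq_le nrm_ge0 andbT; apply/ler_addgt0Pr => e e0; rewrite add0r.
have [F0 hF] := h x _ e0.
have := hF (j |` F0)%fset (fsubsetU1 _ _).
rewrite (big_rem j) /=; last by rewrite !inE eqxx.
rewrite mem_set// big_seq_cond big1 ?addr0; first exact: ltW.
move=> i /andP[iF]; rewrite inE => Di; apply: f0 => // ij.
by move: iF; rewrite ij mem_rem_uniq ?fset_uniq// inE eqxx.
Qed.

Lemma sums_to_inner0 D f s x : sums_to D f s ->
  (forall i, D i -> '[x, f i] = 0) -> '[x, s] = 0.
Proof.
move=> /sums_to_inner h f0; apply/nrm0_eq0.
apply/eqP; rewrite eq_le nrm_ge0 andbT; apply/ler_addgt0Pr => e e0; rewrite add0r.
have [F0 hF] := h x _ e0; have := hF F0 (fsubset_refl _).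
by rewrite big1 ?subr0 => [/ltW//|i]; rewrite inE => /f0.
Qed.

(** Once the squared norms over [F0] come within [e ^+ 2] of their supremum, any larger partial sum
    differs from that over [F0] by an orthogonal sum of norm less than [e]; the partial sums are
    thus Cauchy. *)
Lemma sums_to_ex D f : (forall i j, D i -> D j -> i != j -> '[f i, f j] = 0) ->
  (exists M : R, forall F : {fset I}, \sum_(i <- F | i \in D) nrm (f i) ^+ 2 <= M) ->
  exists s, sums_to D f s.
Proof.
move=> fo [M hM].
pose S := [set \sum_(i <- F | i \in D) nrm (f i) ^+ 2 | F in [set: {fset I}]].
have Ssup : has_sup S.
  by split; [exists (\sum_(i <- fset0 | i \in D) nrm (f i) ^+ 2); exists fset0
            | exists M => _ [F _ <-]].
have fo' i j : i \in D -> j \in D -> i != j -> '[f i, f j] = 0 by rewrite !inE; exact: fo.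
have cau : cauchy_ex (psums D f @ summability.totally).
  move=> e; rewrite ltcE /= => /andP[/eqP ime ree].
  have ee : e = (complex.Re e)%:C by case: e ime ree => a b /= ->.
  have e2 : 0 < (complex.Re e) ^+ 2 by rewrite exprn_gt0.
  have [_ [F0 _ <-] hF0] := sup_adherent e2 Ssup.
  exists (psums D f F0); exists F0 => // F /= F0F.
  rewrite -ball_normE /= ee nrm_lt nrmC /psums (big_fset_split _ _ F0F) addrC addKr.
  rewrite -(@ltr_pXn2r _ 2) ?nnegrE ?nrm_ge0 ?(ltW ree)//.
  rewrite nrm_sum_orth//.
  have : \sum_(i <- F | i \in D) nrm (f i) ^+ 2 <= sup S.
    by apply: ub_le_sup; [case: Ssup | exists F].
  by rewrite (big_fset_split _ _ F0F) /=; lra.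
have FF : ProperFilter (psums D f @ summability.totally).
  exact: fmap_proper_filter summability.totally_filter.
have /cauchy_cvg : cauchy (psums D f @ summability.totally) by exact: cauchy_exP.
by move=> h; exists (lim (psums D f @ summability.totally)); exact: h.
Qed.

End sums.

Section bounded_sums.
Context {R : realType} {H H' : hilbertType R} {I : choiceType}.

Lemma bounded_lin_pos (T : H -> H') : bounded_lin T ->
  exists2 M : R, 0 < M & forall x, nrm (T x) <= M * nrm x.
Proof.
move=> [_ [M TM]]; exists (Num.max M 1); first by rewrite lt_max ltr01 orbT.
by move=> x; rewrite (le_trans (TM x))// ler_wpM2r ?nrm_ge0// le_max lexx.
Qed.

Lemma eq_sums_to_inner (D : set I) (f : I -> H) (g : I -> H') s s' x y :
  sums_to D f s -> sums_to D g s' ->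
  (forall i, D i -> '[x, f i] = '[y, g i]) -> '[x, s] = '[y, s'].
Proof.
move=> /sums_to_inner h /sums_to_inner h' fg; apply/eqP; rewrite -subr_eq0.
apply/eqP/nrm0_eq0/eqP; rewrite eq_le nrm_ge0 andbT.
apply/ler_addgt0Pr => e e0; rewrite add0r; have e2 : 0 < e / 2 by rewrite divr_gt0.
have [F0 hF0] := h x _ e2; have [F1 hF1] := h' y _ e2.
have := hF0 _ (fsubsetUl F0 F1); have := hF1 _ (fsubsetUr F0 F1).
rewrite (eq_bigr (fun i => '[x, f i])); last by move=> i; rewrite inE => /fg.
move: (\sum_(i <- _ | _) _) => S h1 h2.
by rewrite -(subrKA S) (le_trans (nrmD _ _))// [e]splitr lerD// ltW// nrmC.
Qed.

Lemma bounded_lin_sums_to (T : H -> H') (D : set I) f s : bounded_lin T ->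
  sums_to D f s -> sums_to D (fun i => T (f i)) (T s).
Proof.
move=> bT /sums_toP h; apply/sums_toP => e e0; have lT := bT.1.
have [M M0 TM] := bounded_lin_pos bT; have [F0 hF] := h _ (divr_gt0 e0 M0).
exists F0 => F /hF h1; rewrite /psums -(lin_sum _ _ _ lT) -(linB _ _ lT).
by rewrite (le_lt_trans (TM _))// mulrC -ltr_pdivlMr.
Qed.

End bounded_sums.

(** * Orthonormal bases *)

Definition has_basis {R : realType} (H : hilbertType R) :=
  exists De : set nat * (nat -> H), orthonormal_basis De.1 De.2.

Section dense_sets.
Context {R : realType} {H : hilbertType R}.

Lemma dense_approx (A : set H) x (e : R) : dense A -> 0 < e ->
  exists2 a, A a & nrm (x - a) < e.
Proof.
move=> dA e0; have eC : 0 < e%:C by rewrite ltcR.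
have [] := dA (ball x e%:C) _ (ball_open x e%:C).
  by exists x; apply: ballxx.
by move=> a [/=]; rewrite -ball_normE /= nrm_lt => xa Aa; exists a.
Qed.

Lemma approx_dense (A : set H) :
  (forall x (e : R), 0 < e -> exists2 a, A a & nrm (x - a) < e) -> dense A.
Proof.
move=> h O [x Ox] oO.
have /nbhs_ballP[/= e e0 eO] : nbhs x O by exact: open_nbhs_nbhs.
move: e0; rewrite ltcE /= => /andP[/eqP ime ree].
have ee : e = (complex.Re e)%:C by case: e ime ree {eO} => a b /= ->.
have [a Aa xa] := h x _ ree; exists a; split => //; apply: eO.
by rewrite -ball_normE /= ee nrm_lt.
Qed.

(** A vector [y] of the span with [nrm (x - y) < nrm x] contradicts Pythagoras, since [y] is
    orthogonal to [x]. *)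
Lemma dense_span_total (A : set H) x : dense (lin_span A) ->
  (forall a, A a -> '[a, x] = 0) -> x = 0.
Proof.
move=> dA Ax; have [//|x0] := eqVneq x 0.
have n0 : 0 < nrm x by rewrite lt_def nrm_ge0 andbT; apply: contra_neq x0 => /nrm0_eq0.
have [y [n [c [v [Av ->]]]]] := dense_approx x dA n0.
set y' := \sum_(i < n) _.
have y0 : '[y', x] = 0.
  by rewrite inner_suml big1// => i _; rewrite innerZl Ax ?mulr0.
rewrite -(@ltr_pXn2r _ 2) ?nnegrE ?nrm_ge0// nrm_sqrB inner_conj y0 conjC0 /=.
by rewrite mulr0 subr0 ltNge lerDl sqr_ge0.
Qed.

Lemma lin_span_sum (A : set H) I (r : seq I) (P : pred I) (c : I -> R[i]) (v : I -> H) :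
  (forall i, P i -> A (v i)) -> lin_span A (\sum_(i <- r | P i) c i *: v i).
Proof.
move=> PA; elim: r => [|i r [n [c' [v' [Av E]]]]].
  by exists 0%N, (fun=> 0), (fun=> 0); split=> [[]//|]; rewrite big_nil big_ord0.
rewrite big_cons; case: ifPn => Pi; last by exists n, c', v'.
exists n.+1, (fun j => if unlift ord0 j is Some k then c' k else c i),
  (fun j => if unlift ord0 j is Some k then v' k else v i); split.
  by move=> j; case: unliftP => [k|] _ //; exact: PA.
rewrite big_ord_recl unlift_none E; congr (_ + _).
by apply: eq_bigr => k _; rewrite liftK.
Qed.

End dense_sets.

Section orthonormal_families.
Context {R : realType} {H : hilbertType R} {I : choiceType}.
Context (D : set I) (e : I -> H).
Implicit Types (x y s : H) (c : I -> R[i]).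

(** Completeness in a form checked by inner products alone; for orthonormal families it is
    equivalent to density of the span ([total_basis], [basis_total]). *)
Definition total_family := forall x, (forall i, D i -> '[e i, x] = 0) -> x = 0.

Hypothesis oe : Defs.orthonormal D e.

Lemma onb_nrm1 i : D i -> nrm (e i) = 1.
Proof.
move=> Di; have := oe Di Di; rewrite eqxx inner_nrm => /complexI h.
by apply/eqP; rewrite -(@eqrXn2 _ 2) ?nrm_ge0// h expr1n.
Qed.

Lemma orthonormal_neq i j : D i -> D j -> i <> j -> '[e i, e j] = 0.
Proof. by move=> Di Dj /eqP ij; rewrite oe// (negbTE ij). Qed.

Lemma orthonormal_scaled c i j : D i -> D j -> i != j ->
  '[c i *: e i, c j *: e j] = 0.
Proof.
move=> Di Dj ij; rewrite innerZr innerZl orthonormal_neq ?mulr0//; exact/eqP.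
Qed.

Lemma nrm_psums c (F : {fset I}) (P : pred I) : (forall i, P i -> D i) ->
  nrm (\sum_(i <- F | P i) c i *: e i) ^+ 2 =
  \sum_(i <- F | P i) nrm (c i) ^+ 2.
Proof.
move=> PD; rewrite nrm_sum_orth ?fset_uniq//; last first.
  by move=> i j /PD Di /PD Dj; exact: orthonormal_scaled.
by apply: eq_bigr => i /PD Di; rewrite nrmZ onb_nrm1// mulr1.
Qed.

Lemma Bessel_fset x (F : {fset I}) :
  \sum_(i <- F | i \in D) nrm '[e i, x] ^+ 2 <= nrm x ^+ 2.
Proof.
pose y := \sum_(i <- F | i \in D) '[e i, x] *: e i.
have DD i : i \in D -> D i by rewrite inE.
have := sqr_ge0 (nrm (x - y)); rewrite nrm_sqrB (nrm_psums _ _ DD).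
rewrite /y inner_sumr Re_sum (eq_bigr (fun i => nrm '[e i, x] ^+ 2)); last first.
  by move=> i _; rewrite innerZr (inner_conj (e i) x) mulrC mul_conj.
by lra.
Qed.

Lemma Bessel x : (\esum_(i in D) (nrm '[e i, x] ^+ 2)%:E <= (nrm x ^+ 2)%:E)%E.
Proof. by apply: esum_le_psum => F; rewrite sumEFin lee_fin Bessel_fset. Qed.

Lemma orth_sums_to c M :
  (forall F : {fset I}, \sum_(i <- F | i \in D) nrm (c i) ^+ 2 <= M) ->
  exists s, sums_to D (fun i => c i *: e i) s.
Proof.
move=> cM; apply: sums_to_ex; first by move=> i j; exact: orthonormal_scaled.
exists M => F; rewrite -nrm_sum_orth ?fset_uniq//; last first.
  by move=> i j; rewrite !inE; exact: orthonormal_scaled.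
by rewrite nrm_psums// => i; rewrite inE.
Qed.

Lemma sums_to_coord c s j : sums_to D (fun i => c i *: e i) s -> D j ->
  '[e j, s] = c j.
Proof.
move=> h Dj; rewrite (sums_to_inner1 h Dj).
  by rewrite innerZr oe// eqxx mulr1.
by move=> i Di ij; rewrite innerZr orthonormal_neq ?mulr0//; exact: nesym.
Qed.

Lemma sums_to_nrm c s : sums_to D (fun i => c i *: e i) s ->
  (\esum_(i in D) (nrm (c i) ^+ 2)%:E = (nrm s ^+ 2)%:E)%E.
Proof.
move=> h; have -> : nrm s ^+ 2 = complex.Re '[s, s] by rewrite inner_nrm.
apply: (sums_to_inner_esum h) => i Di; rewrite exprn_ge0 ?nrm_ge0//; split => //.
by rewrite innerZr (inner_conj (e i)) (sums_to_coord h Di) mulrC mul_conj.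
Qed.

Lemma proj_sums_to x : exists s, sums_to D (fun i => ketbra (e i) x) s.
Proof. exact: orth_sums_to (Bessel_fset x). Qed.

Lemma proj_coord x s j : sums_to D (fun i => ketbra (e i) x) s -> D j ->
  '[e j, s] = '[e j, x].
Proof. exact: sums_to_coord. Qed.

Lemma total_sums_to x : total_family -> sums_to D (fun i => ketbra (e i) x) x.
Proof.
move=> te; have [s h] := proj_sums_to x.
rewrite [X in sums_to _ _ X](_ : x = s)//.
apply/eqP; rewrite -subr_eq0; apply/eqP/te => i Di.
by rewrite innerBr (proj_coord h Di) subrr.
Qed.

Lemma Parseval x : total_family -> (\esum_(i in D) (nrm '[e i, x] ^+ 2)%:E = (nrm x ^+ 2)%:E)%E.
Proof. by move=> te; apply: (sums_to_nrm (total_sums_to te)). Qed.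

Lemma total_basis : total_family -> orthonormal_basis D e.
Proof.
move=> te; split=> //; apply: approx_dense => x d d0.
have /sums_toP/(_ _ d0)[F hF] := total_sums_to (x := x) te.
exists (psums D (fun i => ketbra (e i) x) F); last exact: hF.
by apply: lin_span_sum => i; rewrite inE => Di; exists i.
Qed.

End orthonormal_families.

Lemma basis_total {R : realType} {H : hilbertType R} {I : choiceType} (D : set I) (e : I -> H) :
  orthonormal_basis D e -> total_family D e.
Proof. by move=> [_ de] x ex; apply: (dense_span_total de) => _ [i Di <-]; exact: ex. Qed.

(** * Gram-Schmidt orthonormalization and bases of separable spaces *)

Section Gram_Schmidt.
Context {R : realType} {H : hilbertType R} (a : nat -> H).

(** As [0^-1 = 0], the zero vector is sent to itself; a vector that depends on its predecessors
    therefore yields a zero entry of [gs]. *)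
Definition normalize (x : H) : H := (nrm x)^-1%:C *: x.

(** The recursion builds the projection off all earlier vectors, rather than the vectors themselves,
    so that it is structural in [n]. *)
Fixpoint gs_proj n : H -> H := if n is m.+1 then
    fun x => gs_proj m x - ketbra (normalize (gs_proj m (a m))) x
  else id.

Definition gs n := normalize (gs_proj n (a n)).

Lemma gs_projE n x : gs_proj n x = x - \sum_(i < n) ketbra (gs i) x.
Proof.
elim: n => [|n IH]; first by rewrite big_ord0 subr0.
by rewrite big_ord_recr /= opprD addrA -IH.
Qed.

Lemma gs_unit n : gs n <> 0 -> '[gs n, gs n] = 1.
Proof.
rewrite /gs /normalize; set x := gs_proj _ _ => x0.
have n0 : nrm x != 0.
  by apply/eqP => h; apply: x0; rewrite h invr0 scale0r.
rewrite inner_nrm nrmZ nrm_real ger0_norm ?invr_ge0 ?nrm_ge0// mulVf//.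
by rewrite expr1n.
Qed.

Lemma gs_orth n m : (m < n)%N -> '[gs m, gs n] = 0.
Proof.
elim/ltn_ind: n m => n IH m mn.
have -> : gs n = (nrm (gs_proj n (a n)))^-1%:C *: gs_proj n (a n) by [].
rewrite innerZr; move: (_%:C) => c.
rewrite gs_projE innerBr inner_sumr (bigD1 (Ordinal mn)) //= big1 ?addr0; last first.
  move=> i; rewrite -val_eqE /= => im. rewrite /ketbra innerZr.
  suff -> : '[gs m, gs i] = 0 by rewrite mulr0.
  have [im'|mi|/eqP] := ltngtP i m; last by rewrite (negbTE im).
    by rewrite inner_conj IH ?conjC0.
  by rewrite IH.
rewrite /ketbra innerZr; have [g0|/eqP g0] := eqVneq (gs m) 0.
  by rewrite g0 !inner0l !mulr0 subr0 mulr0.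
by rewrite gs_unit// mulr1 subrr mulr0.
Qed.

Lemma gs_total x : (forall n, gs n <> 0 -> '[gs n, x] = 0) -> forall n, '[a n, x] = 0.
Proof.
move=> h n.
have h' m : '[gs m, x] = 0.
  by have [->|/eqP] := eqVneq (gs m) 0; [rewrite inner0l | exact: h].
have -> : a n = (nrm (gs_proj n (a n)))%:C *: gs n + \sum_(i < n) ketbra (gs i) (a n).
  rewrite /gs /normalize scalerA -rmorphM.
  have [n0|n0] := eqVneq (nrm (gs_proj n (a n))) 0.
    rewrite n0 mul0r scale0r add0r; apply/eqP; rewrite -subr_eq0 -gs_projE.
    by rewrite (nrm0_eq0 n0).
  by rewrite mulfV// scale1r gs_projE subrK.
rewrite innerDl innerZl h' mulr0 add0r inner_suml big1// => i _.
by rewrite /ketbra innerZl h' mulr0.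
Qed.

End Gram_Schmidt.

Lemma separable_basis {R : realType} (H : hilbertType R) : separable H ->
  has_basis H.
Proof.
move=> [A [cA dA]].
have [f fA] : exists f : nat -> H, A `<=` range f.
  have [->|] := eqVneq A set0; first by exists (fun=> 0).
  move=> /set0P A0; have /pfcard_geP[A0'|[f]] := cA.
    by move: A0; rewrite A0' => -[].
  by exists f; exact: surj.
(* Vanishing entries are dropped from the index set, which also covers finite dimension. *)
exists ([set n | gs f n <> 0], gs f).
apply: total_basis => /=.
  move=> i j /= gi gj; have [<-|ij] := eqVneq i j; first exact: gs_unit.
  have [/gs_orth//|ji|/eqP] := ltngtP i j; last by rewrite (negbTE ij).
  by rewrite inner_conj gs_orth ?conjC0.
move=> x xg; have h := gs_total xg.
have [//|x0] := eqVneq x 0.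
have n0 : 0 < nrm x by rewrite lt_def nrm_ge0 andbT; apply: contra_neq x0 => /nrm0_eq0.
have [y Ay] := dense_approx x dA n0.
have [n _ <-] := fA _ Ay.
rewrite -(@ltr_pXn2r _ 2) ?nnegrE ?nrm_ge0// nrm_sqrB inner_conj h conjC0 /=.
by rewrite mulr0 subr0 ltNge lerDl sqr_ge0.
Qed.

Section bases.
Context {R : realType} {H : hilbertType R} {I : choiceType} (D : set I) (e : I -> H).
Hypothesis be : orthonormal_basis D e.

Lemma basis_sums_to x : sums_to D (fun i => ketbra (e i) x) x.
Proof. by apply: total_sums_to; [exact: be.1 | exact: basis_total]. Qed.

Lemma basis_Parseval x :
  (\esum_(i in D) (nrm '[e i, x] ^+ 2)%:E = (nrm x ^+ 2)%:E)%E.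
Proof. by rewrite (Parseval be.1)//; exact: basis_total. Qed.

End bases.

Arguments basis_sums_to {R H I D e} be x.

Section esum_extra.
Context {R : realType}.

Lemma esum_exchange {I J : choiceType} (A : set I) (B : set J) (a : I -> J -> \bar R) :
  (forall i j, A i -> B j -> (0 <= a i j)%E) ->
  (\esum_(i in A) \esum_(j in B) a i j = \esum_(j in B) \esum_(i in A) a i j)%E.
Proof.
move=> a0; rewrite !esum_esum//; last by move=> *; exact: a0.
rewrite (@reindex_esum _ _ _ (B `*`` (fun=> A)) _ (fun x => (x.2, x.1)))//=.
split=> [[j i]/= []//|[j i] [j' i'] _ _ /= [-> ->]//|[i j] /= [Ai Bj]].
by exists (j, i).
Qed.

Lemma esumZ_le {I : choiceType} (A : set I) (a : I -> \bar R) (c : R) :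
  0 <= c -> (forall i, A i -> (0 <= a i)%E) ->
  (\esum_(i in A) (c%:E * a i) <= c%:E * \esum_(i in A) a i)%E.
Proof.
move=> c0 a0; apply: esum_le_psum => F.
rewrite -ge0_sume_distrr; last by move=> i; rewrite inE; exact: a0.
by rewrite lee_wpmul2l ?lee_fin// psum_le_esum.
Qed.

(** The inequality [esumZ_le] is used twice, with [c] and with [c^-1]. *)
Lemma esumZ {I : choiceType} (A : set I) (a : I -> \bar R) (c : R) :
  0 <= c -> (forall i, A i -> (0 <= a i)%E) ->
  (\esum_(i in A) (c%:E * a i) = c%:E * \esum_(i in A) a i)%E.
Proof.
move=> c0 a0; apply/eqP; rewrite eq_le esumZ_le//=.
have /orP[/eqP <-|{}c0] : (0 == c) || (0 < c) by rewrite -le_eqVlt.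
  by rewrite mul0e esum_ge0// => i Ai; rewrite mul0e.
rewrite -(@lee_pdivlMl _ c)//.
have := @esumZ_le _ A (fun i => c%:E * a i)%E c^-1.
under eq_esum do rewrite muleA -EFinM mulVf ?gt_eqF// mul1e.
apply; first by rewrite invr_ge0 ltW.
by move=> i Ai; rewrite mule_ge0 ?a0// lee_fin ltW.
Qed.

Lemma esum_setT_support {I : choiceType} (A : set I) (a : I -> \bar R) :
  (forall i, ~ A i -> a i = 0%E) ->
  (\esum_(i in A) a i = \esum_(i in [set: I]) a i)%E.
Proof.
move=> a0; rewrite esum_mkcond; apply: eq_esum => i _.
by case: ifPn => //; rewrite notin_setE => /a0.
Qed.

End esum_extra.

Section sums_lin.
Context {R : realType} {H : hilbertType R} {I : choiceType}.

Lemma sums_to_lin (D : set I) (f g : I -> H) s s' (a : R[i]) :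
  sums_to D f s -> sums_to D g s' -> sums_to D (fun i => a *: f i + g i) (a *: s + s').
Proof.
move=> /sums_toP h /sums_toP h'; apply/sums_toP => e e0.
have a0 : 0 < nrm a + 1 by rewrite ltr_wpDl ?nrm_ge0.
have e2 : 0 < e / 2 by rewrite divr_gt0.
have [F0 hF] := h _ (divr_gt0 e2 a0); have [F1 hF1] := h' _ e2.
exists (F0 `|` F1)%fset => F; rewrite fsubUset => /andP[/hF h1 /hF1 h2].
rewrite /psums big_split /= -scaler_sumr opprD addrACA -scalerBr.
rewrite (le_lt_trans (nrmD _ _))// nrmZ (splitr e) ler_ltD//.
rewrite (le_trans _ (_ : (nrm a + 1) * nrm (s - psums D f F) <= _))//.
  by rewrite ler_wpM2r ?nrm_ge0// lerDl.
by rewrite mulrC -ler_pdivlMr// ltW.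
Qed.

Lemma sums_to_single (D : set I) (f : I -> H) s j : D j ->
  (forall i, D i -> i <> j -> f i = 0) -> sums_to D f s -> s = f j.
Proof.
move=> Dj f0 h; apply: inner_ext => z; apply: (sums_to_inner1 h Dj) => i Di ij.
by rewrite f0// inner0r.
Qed.

End sums_lin.

(** * Operators given by a spectral representation *)

Section spectral_representations.
Context {R : realType} {H : hilbertType R}.
Implicit Types (T : H -> H) (D : set nat) (a : nat -> R) (phi : nat -> H).

Lemma spectral_rep_linear T D a phi : spectral_rep T (D, a, phi) -> linear T.
Proof.
move=> [op h] c x y; apply: (sums_to_uniq (h _)) => /=.
apply: (eq_sums_to _ (sums_to_lin (h x) (h y))) => i _.
by rewrite /ketbra innerDr innerZr !scalerDl !scalerDr !scalerA mulrCA mulrA.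
Qed.

Lemma spectral_rep_eigen T D a phi j : spectral_rep T (D, a, phi) -> D j ->
  T (phi j) = (a j)%:C *: phi j.
Proof.
move=> [op h] Dj; rewrite (sums_to_single Dj _ (h (phi j))).
  by rewrite /ketbra op// eqxx scale1r.
by move=> i Di ij; rewrite /ketbra (orthonormal_neq op)// scale0r scaler0.
Qed.

Lemma spectral_rep_coord T D a phi j x : spectral_rep T (D, a, phi) -> D j ->
  '[phi j, T x] = (a j)%:C * '[phi j, x].
Proof.
move=> [op h] Dj.
have h' : sums_to D (fun i => ((a i)%:C * '[phi i, x]) *: phi i) (T x).
  by apply: (eq_sums_to _ (h x)) => i _; rewrite scalerA.
exact: (sums_to_coord op h' Dj).
Qed.

Lemma spectral_rep_nrm T D a phi x : spectral_rep T (D, a, phi) ->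
  (\esum_(i in D) (a i ^+ 2 * nrm '[phi i, x] ^+ 2)%:E = (nrm (T x) ^+ 2)%:E)%E.
Proof.
move=> [op h].
have h' : sums_to D (fun i => ((a i)%:C * '[phi i, x]) *: phi i) (T x).
  by apply: (eq_sums_to _ (h x)) => i _; rewrite scalerA.
rewrite -(sums_to_nrm op h'); apply: eq_esum => i Di.
by rewrite nrmM exprMn nrm_real real_normK ?num_real.
Qed.

Lemma spectral_rep_nrm_le T D a phi M x : spectral_rep T (D, a, phi) ->
  0 <= M -> (forall i, D i -> `|a i| <= M) -> nrm (T x) <= M * nrm x.
Proof.
move=> h M0 aM; rewrite -(@ler_pXn2r _ 2) ?nnegrE ?mulr_ge0 ?nrm_ge0//.
rewrite -lee_fin -(spectral_rep_nrm _ h) exprMn EFinM.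
apply: (@le_trans _ _ (\esum_(i in D) ((M ^+ 2)%:E * (nrm '[phi i, x] ^+ 2)%:E))%E).
  apply: le_esum => i Di; rewrite -EFinM lee_fin ler_wpM2r ?exprn_ge0 ?nrm_ge0//.
  by rewrite -real_normK ?num_real// lerXn2r ?nnegrE// aM.
rewrite esumZ ?exprn_ge0//; last by move=> i _; rewrite lee_fin exprn_ge0// nrm_ge0.
by rewrite lee_wpmul2l ?lee_fin ?exprn_ge0// Bessel//; case: h.
Qed.

Lemma spectral_rep_bounded T D a phi M : spectral_rep T (D, a, phi) ->
  0 <= M -> (forall i, D i -> `|a i| <= M) -> bounded_op T.
Proof.
move=> h M0 aM; apply/bounded_opE; split; first exact: spectral_rep_linear h.
by exists M => x; exact: spectral_rep_nrm_le h M0 aM.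
Qed.

Lemma spectral_rep_qform T D a phi x : spectral_rep T (D, a, phi) ->
  (forall i, D i -> 0 <= a i) ->
  (\esum_(i in D) (a i * nrm '[phi i, x] ^+ 2)%:E = (qform T x)%:E)%E.
Proof.
move=> [op h] a0; apply: (sums_to_inner_esum (h x)) => i Di.
rewrite mulr_ge0 ?a0 ?exprn_ge0 ?nrm_ge0//; split => //.
by rewrite /ketbra !innerZr (inner_conj (phi i) x) ['[phi i, x] * _]mulrC mul_conj ReZ.
Qed.

Lemma spectral_rep_positive T D a phi M : spectral_rep T (D, a, phi) ->
  (forall i, D i -> 0 <= a i <= M) -> positive_op T.
Proof.
move=> h aM; split.
  apply: (@spectral_rep_bounded _ _ _ _ (Num.max M 0) h); first by rewrite le_max lexx orbT.
  by move=> i /aM/andP[a0 aM']; rewrite ger0_norm// le_max aM'.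
move=> x; have [op hs] := h.
apply: (sums_to_inner_ge0 (hs x)) => i /aM/andP[a0 _].
rewrite /ketbra !innerZr (inner_conj (phi i) x) ['[phi i, x] * _]mulrC mul_conj.
by rewrite -rmorphM ler0c mulr_ge0// sqr_ge0.
Qed.

Lemma spectral_rep_ex D a phi M : Defs.orthonormal D phi ->
  (forall i, D i -> `|a i| <= M) ->
  exists T, spectral_rep T (D, a, phi).
Proof.
move=> op aM.
have ex x : exists s, sums_to D (fun i => (a i)%:C *: ketbra (phi i) x) s.
  have [s hs] : exists s, sums_to D (fun i => ((a i)%:C * '[phi i, x]) *: phi i) s.
    apply: (@orth_sums_to _ _ _ _ _ op _ (M ^+ 2 * nrm x ^+ 2)) => F.
    apply: (@le_trans _ _ (\sum_(i <- F | i \in D) M ^+ 2 * nrm '[phi i, x] ^+ 2)).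
      apply: ler_sum => i; rewrite inE => Di.
      rewrite nrmM exprMn nrm_real ler_wpM2r ?exprn_ge0 ?nrm_ge0//.
      by rewrite lerXn2r ?nnegrE ?aM// (le_trans _ (aM _ Di)).
    by rewrite -mulr_sumr ler_wpM2l ?sqr_ge0// Bessel_fset.
  by exists s; apply: (eq_sums_to _ hs) => i _; rewrite scalerA.
have [T hT] := choice ex.
by exists T; split.
Qed.

(** The two nonnegative sums are exchanged and Parseval is applied to each [phi i]. The right-hand
    side does not mention [e]: this is the source of basis independence of the trace. *)
Lemma spectral_rep_trace (J : choiceType) (E : set J) (e : J -> H) T D a phi :
  orthonormal_basis E e -> spectral_rep T (D, a, phi) ->
  (forall i, D i -> 0 <= a i) ->
  (\esum_(j in E) (qform T (e j))%:E = \esum_(i in D) (a i)%:E)%E.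
Proof.
move=> be h a0.
under eq_esum do rewrite -(spectral_rep_qform _ h a0).
rewrite esum_exchange; last first.
  by move=> i j _ /a0 aj; rewrite lee_fin mulr_ge0// exprn_ge0// nrm_ge0.
apply: eq_esum => i Di.
under eq_esum do rewrite EFinM nrm_inner_sym.
rewrite esumZ ?a0//; last by move=> j _; rewrite lee_fin exprn_ge0// nrm_ge0.
have [oe _] := be; rewrite (Parseval oe); last exact: basis_total.
by rewrite (onb_nrm1 (proj1 h))// expr1n mule1.
Qed.

End spectral_representations.

(** * The spectral theorem for positive operators of finite trace *)

Section ultrafilter_limits.
Context {R : realType} (W : set_system nat) {UW : UltraFilter W}.

(** Ultrafilters replace the extraction of subsequences: compactness of a segment gives a cluster
    point, and along an ultrafilter a cluster point is a limit. *)
Lemma ultra_bounded_cvg (u : nat -> R) M : (forall n, `|u n| <= M) ->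
  exists l, forall e : R, 0 < e -> W [set n | `|u n - l| < e].
Proof.
move=> uM.
have WP : ProperFilter W by exact: ultra_proper.
have uW : ProperFilter (u @ W) by exact: fmap_proper_filter.
have [l [_ cl]] : exists l, (`[- M, M]%classic `&` cluster (u @ W)) l.
  apply: (@segment_compact R (- M) M); rewrite /nbhs /=.
  apply: (@filterS _ W _ setT); last exact: filterT.
  by move=> n _ /=; rewrite in_itv /= -ler_norml.
exists l => e e0; have [//|Wc] := in_ultra_setVsetC [set n | `|u n - l| < e] UW.
have [|x [/= h1 h2]] := cl (~` [set x | `|x - l| < e]) (ball l e) Wc.
  exact: nbhsx_ballx.
by case: h1; move: h2; rewrite -ball_normE /= distrC.
Qed.

Lemma ultra_bounded_cvgC (z : nat -> R[i]) M : (forall n, nrm (z n) <= M) ->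
  exists l, forall e : R, 0 < e -> W [set n | nrm (z n - l) ^+ 2 < e].
Proof.
move=> zM; have WP : ProperFilter W by exact: ultra_proper.
have sM n : complex.Re (z n) ^+ 2 + complex.Im (z n) ^+ 2 <= M ^+ 2.
  by rewrite -nrm_sqr lerXn2r ?nnegrE ?nrm_ge0// (le_trans _ (zM n))// nrm_ge0.
have M0 : 0 <= M by rewrite (le_trans _ (zM 0%N))// nrm_ge0.
have [lr hr] : exists l, forall e : R, 0 < e -> W [set n | `|complex.Re (z n) - l| < e].
  by apply: (@ultra_bounded_cvg _ M) => n; rewrite (le_trans (Re_le_nrm _)).
have [li hi] : exists l, forall e : R, 0 < e -> W [set n | `|complex.Im (z n) - l| < e].
  apply: (@ultra_bounded_cvg _ M) => n.
  rewrite -(@ler_pXn2r _ 2) ?nnegrE// real_normK ?num_real// (le_trans _ (sM n))//.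
  by rewrite lerDr sqr_ge0.
exists (Complex lr li) => e e0.
have d0 : 0 < Num.sqrt (e / 2) by rewrite sqrtr_gt0 divr_gt0.
apply: filterS (filterI (hr _ d0) (hi _ d0)) => n [/= h1 h2].
rewrite nrm_sqr; case: (z n) h1 h2 => a b /= h1 h2.
have sq x : `|x| < Num.sqrt (e / 2) -> x ^+ 2 < e / 2.
  move=> h; rewrite -[ltRHS]sqr_sqrtr ?divr_ge0 ?ltW//.
  by rewrite -real_normK ?num_real// ltrXn2r// nnegrE sqrtr_ge0.
by rewrite [ltRHS]splitr ltrD// sq.
Qed.

Lemma filter_seq (I : eqType) (s : seq I) (A : I -> set nat) :
  (forall i, i \in s -> W (A i)) -> W [set n | forall i, i \in s -> A i n].
Proof.
have WP : ProperFilter W by exact: ultra_proper.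
elim: s => [|i s IH] h; first by apply: filterS filterT => n _ i.
apply: filterS (filterI (h i (mem_head _ _)) (IH _)).
  by move=> n [An As] j; rewrite inE => /orP[/eqP ->//|]; exact: As.
by move=> j js; apply: h; rewrite inE js orbT.
Qed.

Lemma ultra_cauchy_cvg (H : hilbertType R) (y : nat -> H) :
  (forall e : R, 0 < e -> exists2 A, W A &
     forall n m, A n -> A m -> nrm (y n - y m) ^+ 2 < e) ->
  exists w, forall e : R, 0 < e -> W [set n | nrm (w - y n) < e].
Proof.
move=> h; have WP : ProperFilter W by exact: ultra_proper.
have yW : ProperFilter (y @ W) by exact: fmap_proper_filter.
have /cauchy_cvg yc : cauchy (y @ W).
  apply: cauchy_exP => e; rewrite ltcE /= => /andP[/eqP ime ree].
  have ee : e = (complex.Re e)%:C by case: e ime ree => a b /= ->.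
  have [A WA hA] := h (complex.Re e ^+ 2) (exprn_gt0 2 ree).
  have [n An] := filter_ex WA; exists (y n).
  rewrite /nbhs /=; apply: filterS WA => m Am /=.
  rewrite -ball_normE /= ee nrm_lt -(@ltr_pXn2r _ 2) ?nnegrE ?nrm_ge0 ?ltW//.
  exact: hA.
exists (lim (y @ W)) => e e0.
have eC : 0 < e%:C by rewrite ltcR.
have /cvgrPdist_lt/(_ _ eC) := yc.
by rewrite /nbhs /=; apply: filterS => n /=; rewrite nrm_lt.
Qed.

End ultrafilter_limits.

Lemma small_tail {R : realType} {I : choiceType} (P : pred I) (a : I -> R) B :
  (forall F : {fset I}, \sum_(i <- F | P i) a i <= B) ->
  forall e : R, 0 < e -> exists F0 : {fset I}, forall F, (F0 `<=` F)%fset ->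
    \sum_(i <- (F `\` F0)%fset | P i) a i < e.
Proof.
move=> hB e e0.
pose S := [set \sum_(i <- F | P i) a i | F in [set: {fset I}]].
have Ssup : has_sup S.
  by split; [exists (\sum_(i <- fset0 | P i) a i); exists fset0
            | exists B => _ [F _ <-]].
have [_ [F0 _ <-] hF0] := sup_adherent e0 Ssup; exists F0 => F F0F.
have : \sum_(i <- F | P i) a i <= sup S by apply: ub_le_sup; [case: Ssup | exists F].
by rewrite (big_fset_split _ _ F0F) /=; lra.
Qed.

Section max_eigenvector.
Context {R : realType} {H : hilbertType R} {J : choiceType}.
Context (E : set J) (e : J -> H) (be : orthonormal_basis E e).
Variable T : H -> H.
Hypothesis (Tp : positive_op T).

Lemma positive_bound : exists2 M : R, 0 < M & forall x, qform T x <= M * nrm x ^+ 2.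
Proof.
by have [M M0 TM] := bounded_pos Tp.1; exists M => // x; exact: qform_le.
Qed.

(** A positive operator of finite trace is Hilbert-Schmidt, because its square is at most [M] times
    itself. *)
Lemma HS_bound : (\esum_(j in E) (qform T (e j))%:E < +oo)%E ->
  exists B : R, forall F : {fset J}, \sum_(j <- F | j \in E) nrm (T (e j)) ^+ 2 <= B.
Proof.
move=> trT; have [M M0 TM] := positive_bound.
exists (M * fine (\esum_(j in E) (qform T (e j))%:E)%E) => F.
apply: (@le_trans _ _ (\sum_(j <- F | j \in E) M * qform T (e j))).
  by apply: ler_sum => j _; exact: positive_sqr_le.
rewrite -mulr_sumr ler_pM2l// -lee_fin fineK; last first.
  by rewrite ge0_fin_numE// esum_ge0// => j _; rewrite lee_fin qform_ge0.
by rewrite -sumEFin psum_le_esum.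
Qed.

(** Compactness of Hilbert-Schmidt operators: finitely many coordinates of [T (x n)] converge along
    [W], and the others are small uniformly in [n], being bounded by [nrm (T (e j))]. *)
Lemma HS_compact (B : R) (x : nat -> H) (W : set_system nat) {UW : UltraFilter W} :
  (forall F : {fset J}, \sum_(j <- F | j \in E) nrm (T (e j)) ^+ 2 <= B) ->
  (forall n, nrm (x n) = 1) ->
  exists w, forall d : R, 0 < d -> W [set n | nrm (w - T (x n)) < d].
Proof.
move=> TB x1; apply: ultra_cauchy_cvg => d d0.
(* The coordinates in [F0] and those outside it will contribute at most [4 * (d / 12)] each. *)
have [F0 hF0] := small_tail TB (divr_gt0 d0 (ltr0n R 12)).
have lT := positive_lin Tp.
have sT := positive_selfadjoint Tp.
pose N : R := (size F0)%:R + 1.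
have N0 : 0 < N by rewrite ltr_wpDl.
have /choice[l hl] : forall j, exists l, forall d' : R, 0 < d' ->
    W [set n | nrm ('[T (e j), x n] - l) ^+ 2 < d'].
  move=> j; apply: (@ultra_bounded_cvgC _ _ _ _ (nrm (T (e j)))) => n.
  by rewrite (le_trans (inner_CS _ _))// x1 mulr1.
exists [set n | forall j, j \in enum_fset F0 -> nrm ('[T (e j), x n] - l j) ^+ 2 < d / 12 / N].
  by apply: filter_seq => j _; apply: hl; rewrite !divr_gt0.
move=> n m hn hm; rewrite -lte_fin.
(* An infinite sum inherits only non-strict bounds from its partial sums, so strictness is secured
   here. *)
apply: (@le_lt_trans _ _ (11 * (d / 12))%:E); last by rewrite lte_fin; lra.
rewrite -(linB _ _ lT) -(basis_Parseval be).
apply: esum_le_psum => F; rewrite sumEFin lee_fin.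
under eq_bigr do rewrite sT.
set c := fun j => nrm '[T (e j), x n - x m] ^+ 2.
have c0 j : j \in E -> 0 <= c j by rewrite exprn_ge0// nrm_ge0.
apply: (le_trans (psum_le c0 (fsubsetUr F0 F))).
have FF := fsubsetUl F0 F.
rewrite (big_fset_split _ _ FF).
have h1 : \sum_(j <- F0 | j \in E) c j <= 4 * (d / 12).
  apply: (@le_trans _ _ (\sum_(j <- F0) 4 * (d / 12 / N))).
    rewrite big_mkcond big_seq [leRHS]big_seq; apply: ler_sum => j jF.
    have d1 := hn _ jF; have d2 := hm _ jF.
    case: ifPn => _; last by have := le_lt_trans (sqr_ge0 _) d1; lra.
    rewrite /c innerBr; pose u := '[T (e j), x n] - l j; pose v := '[T (e j), x m] - l j.
    rewrite (_ : _ - _ = u - v); last by rewrite /u /v; ring.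
    have : nrm (u - v) ^+ 2 <= 2 * nrm u ^+ 2 + 2 * nrm v ^+ 2.
      apply: (@le_trans _ _ ((nrm u + nrm v) ^+ 2)).
        by rewrite lerXn2r ?nnegrE ?addr_ge0 ?nrm_ge0 ?nrmB.
      by have := sqr_ge0 (nrm u - nrm v); rewrite sqrrB sqrrD; lra.
    by move: d1 d2; rewrite -/u -/v; lra.
  rewrite big_const_seq count_predT iter_addr_0 -[leLHS]mulr_natr.
  rewrite (_ : _ * _ = 4 * (d / 12) * ((size F0)%:R / N)); last first.
    by field; rewrite gt_eqF.
  rewrite ler_piMr//; first by rewrite mulr_ge0// ltW// divr_gt0.
  by rewrite ler_pdivrMr// mul1r lerDl.
have h2 : \sum_(j <- ((F0 `|` F) `\` F0)%fset | j \in E) c j <= 4 * (d / 12).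
  apply: (@le_trans _ _ (\sum_(j <- ((F0 `|` F) `\` F0)%fset | j \in E) 4 * nrm (T (e j)) ^+ 2)).
    apply: ler_sum => j _; rewrite /c.
    rewrite (_ : 4 * _ = (2 * nrm (T (e j))) ^+ 2); last by ring.
    rewrite lerXn2r ?nnegrE ?mulr_ge0 ?nrm_ge0// (le_trans (inner_CS _ _))//.
    rewrite mulrC ler_wpM2r ?nrm_ge0// (le_trans (nrmB _ _))// !x1; lra.
  by rewrite -mulr_sumr ler_pM2l// ltW// hF0.
by move: h1 h2; lra.
Qed.

(* The form of [T] has a maximizing sequence of unit vectors [x n], and
   [T (x n) - lam *: x n] tends to [0].  Since [T] is Hilbert-Schmidt, [T (x n)]
   converges along an ultrafilter, necessarily to an eigenvector. *)
Lemma max_eigenvector : (\esum_(j in E) (qform T (e j))%:E < +oo)%E ->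
  (exists x, T x <> 0) ->
  exists lam phi, [/\ 0 < lam, nrm phi = 1, T phi = lam%:C *: phi &
    forall x, qform T x <= lam * nrm x ^+ 2].
Proof.
move=> /HS_bound[B TB] [x0 Tx0]; have [M M0 TM] := positive_bound.
have lT := positive_lin Tp.
pose S := [set qform T x | x in [set x | nrm x = 1]].
have nz x : x <> 0 -> 0 < nrm x.
  by move=> h; rewrite lt_def nrm_ge0 andbT; apply/eqP => /nrm0_eq0.
have nz1 x : x <> 0 -> nrm (normalize x) = 1.
  move=> h; rewrite nrmZ nrm_real ger0_norm ?invr_ge0 ?nrm_ge0// mulVf//.
  by rewrite gt_eqF// nz.
have x00 : x0 <> 0 by move=> h; apply: Tx0; rewrite h (lin0 lT).
have Ssup : has_sup S.
  split; first by exists (qform T (normalize x0)); exists (normalize x0) => //=; exact: nz1.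
  by exists M => _ [x /= x1 <-]; have := TM x; rewrite x1 expr1n mulr1.
pose lam := sup S.
have Tlam x : qform T x <= lam * nrm x ^+ 2.
  have [->|/eqP xn0] := eqVneq x 0; first by rewrite /qform inner0l nrm0 expr0n mulr0.
  have : qform T (normalize x) <= lam.
    by apply: ub_le_sup; [case: Ssup | exists (normalize x) => //=; exact: nz1].
  rewrite /normalize qformZ// nrm_real ger0_norm ?invr_ge0 ?nrm_ge0// exprVn.
  by rewrite mulrC ler_pdivrMr// exprn_gt0// nz.
have lam0 : 0 < lam.
  rewrite ltNge; apply/negP => l0; apply: Tx0; apply: nrm0_eq0; apply/eqP.
  rewrite -sqrf_eq0 eq_le sqr_ge0 andbT (le_trans (positive_sqr_le Tp Tlam x0))//.
  by rewrite mulr_le0_ge0// qform_ge0.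
have /choice[x hx] : forall n : nat, exists x, nrm x = 1 /\ lam - n.+1%:R^-1 < qform T x.
  move=> n; have n0 : 0 < n.+1%:R^-1 :> R by rewrite invr_gt0.
  by have [_ [x x1 <-] hx] := sup_adherent n0 Ssup; exists x.
have [W [UW oW]] := ultraFilterLemma (eventually_filter : ProperFilter \oo).
have WP : ProperFilter W by exact: ultra_proper.
have [w hw] := @HS_compact B x W UW TB (fun n => (hx n).1).
(* The square of this norm is [nrm (T x) ^+ 2 - 2 * lam * qform T x + lam ^+ 2], which
   [positive_sqr_le] bounds by [lam * (lam - qform T x)]; the latter tends to [0] for the maximizing
   sequence. *)
have hd (d : R) : 0 < d -> W [set n | nrm (T (x n) - lam%:C *: x n) < d].
  move=> d0; have dl : 0 < d ^+ 2 / lam by rewrite divr_gt0// exprn_gt0.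
  have : W [set n | n.+1%:R^-1 < d ^+ 2 / lam].
    apply: oW; have := near_infty_natSinv_lt (PosNum dl); exact.
  apply: filterS => n /= hn; rewrite -(@ltr_pXn2r _ 2) ?nnegrE ?nrm_ge0 ?ltW//.
  have [xn1 xnl] := hx n.
  rewrite nrm_sqrB innerZr nrmZ xn1 mulr1 nrm_real real_normK ?num_real//.
  rewrite ReZ (inner_conj (x n) (T (x n))) ReJ -/(qform T (x n)).
  have := positive_sqr_le Tp Tlam (x n).
  have : lam * (lam - qform T (x n)) < d ^+ 2.
    rewrite mulrC -ltr_pdivlMr//; apply: lt_trans hn.
    by rewrite ltrBlDr addrC -ltrBlDr.
  by lra.
(* This keeps the limit away from [0], so that it can be normalized. *)
have wlam : lam <= nrm w.
  apply/ler_addgt0Pr => d d0; have d2 : 0 < d / 2 by rewrite divr_gt0.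
  have [n [/= h1 h2]] := filter_ex (filterI (hw _ d2) (hd _ d2)).
  have xn1 : nrm (lam%:C *: x n) = lam by rewrite nrmZ nrm_real (hx n).1 mulr1 gtr0_norm.
  have := nrmD (lam%:C *: x n - T (x n)) (T (x n)); rewrite subrK xn1.
  have := nrmD (T (x n) - w) w; rewrite subrK.
  have := nrmC w (T (x n)); have := nrmC (T (x n)) (lam%:C *: x n).
  by lra.
have Tw : T w = lam%:C *: w.
  apply/eqP; rewrite -subr_eq0; apply/eqP/nrm0_eq0/eqP.
  rewrite eq_le nrm_ge0 andbT; apply/ler_addgt0Pr => d d0; rewrite add0r.
  have [M' M'0 TM'] := bounded_pos Tp.1.
  pose d' := d / (M' + M' + lam).
  have d'0 : 0 < d' by rewrite divr_gt0// !addr_gt0.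
  have [n [/= h1 h2]] := filter_ex (filterI (hw _ d'0) (hd _ d'0)).
  have -> : T w - lam%:C *: w = T (w - T (x n)) + (T (T (x n) - lam%:C *: x n))
     + lam%:C *: (T (x n) - w).
    have tele (u v p q : H) : u - q = (u - v) + (v - p) + (p - q).
      by rewrite (addrA _ v) subrK (addrA _ p) subrK.
    by rewrite !(linB _ _ lT) (linZ _ _ lT) scalerBr; exact: tele.
  apply: (le_trans (nrmD _ _)); rewrite nrmZ nrm_real gtr0_norm// (nrmC (T (x n)) w).
  have h3 := nrmD (T (w - T (x n))) (T (T (x n) - lam%:C *: x n)).
  have h4 := TM' (w - T (x n)); have h5 := TM' (T (x n) - lam%:C *: x n).
  have h6 : M' * nrm (w - T (x n)) <= M' * d' by rewrite ler_pM2l// ltW.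
  have h7 : M' * nrm (T (x n) - lam%:C *: x n) <= M' * d' by rewrite ler_pM2l// ltW.
  have h8 : lam * nrm (w - T (x n)) <= lam * d' by rewrite ler_pM2l// ltW.
  have : M' * d' + M' * d' + lam * d' = d.
    by rewrite -!mulrDl /d' mulrC divfK// gt_eqF// !addr_gt0.
  by move: h3 h4 h5 h6 h7 h8; lra.
have w0 : w <> 0 by move=> h; move: (lt_le_trans lam0 wlam); rewrite h nrm0 ltxx.
exists lam, (normalize w); split => //; first exact: nz1.
by rewrite (linZ _ _ lT) Tw !scalerA mulrC.
Qed.

End max_eigenvector.

Section spectral_theorem.
Context {R : realType} {H : hilbertType R} {J : choiceType}.
Context (E : set J) (e : J -> H) (be : orthonormal_basis E e).
Implicit Types (T : H -> H).

(** The eigenvalue [0] may come with the zero vector, so that a pair also exists for the zero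
    operator and deflation can be iterated forever. *)
Definition top_eigenpair T (lp : R * H) :=
  [/\ 0 <= lp.1, T lp.2 = lp.1%:C *: lp.2, 0 < lp.1 -> nrm lp.2 = 1
    & forall x, qform T x <= lp.1 * nrm x ^+ 2].

Definition top_pair T : R * H := xget (0, 0) (top_eigenpair T).

Definition finite_trace T :=
  positive_op T /\ (\esum_(j in E) (qform T (e j))%:E < +oo)%E.

Lemma top_pairP T : finite_trace T -> top_eigenpair T (top_pair T).
Proof.
move=> [Tp trT]; apply: xgetPex.
have [Tx|T0] := pselect (exists x, T x <> 0).
  have [lam [phi [l0 p1 Tphi Tle]]] := max_eigenvector be Tp trT Tx.
  by exists (lam, phi); split => //=; exact: ltW.
exists (0, 0); split => //=.
- by rewrite (lin0 (positive_lin Tp)) scaler0.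
- by rewrite ltxx.
- move=> x; rewrite mul0r /qform; suff -> : T x = 0 by rewrite inner0r.
  by apply: contrapT => Tx; apply: T0; exists x.
Qed.

Definition deflate T : H -> H :=
  fun x => T x - (top_pair T).1%:C *: ketbra (top_pair T).2 x.

Lemma qform_deflate T x :
  qform (deflate T) x = qform T x - (top_pair T).1 * nrm '[(top_pair T).2, x] ^+ 2.
Proof.
rewrite /qform /deflate innerBr ReB; congr (_ - _).
rewrite /ketbra !innerZr ReZ (inner_conj _ x) ['[_, x] * _]mulrC mul_conj.
by [].
Qed.

(** Deflation amounts to restricting [T] to the complement of its top eigenvector, which will show
    that positivity is preserved. The boolean factor switches the projection off for the eigenvalue
    [0], where the vector is not known to be a unit vector. *)
Lemma deflateE T x : finite_trace T ->
  deflate T x = T (x - ((top_pair T).1 != 0)%:R *: ketbra (top_pair T).2 x).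
Proof.
move=> Tf; have [l0 Tphi p1 _] := top_pairP Tf; have lT := positive_lin Tf.1.
rewrite (linB _ _ lT) /deflate /ketbra !(linZ _ _ lT) Tphi.
case: eqP => [->|_] /=; first by rewrite !scale0r.
by rewrite scale1r !scalerA [_ * '[_, _]]mulrC.
Qed.

Lemma deflate_finite_trace T : finite_trace T -> finite_trace (deflate T).
Proof.
move=> Tf; have [l0 Tphi p1 _] := top_pairP Tf; have [Tp trT] := Tf.
have lT := positive_lin Tp.
have dE x : '[x, deflate T x] = '[x - ((top_pair T).1 != 0)%:R *: ketbra (top_pair T).2 x,
    T (x - ((top_pair T).1 != 0)%:R *: ketbra (top_pair T).2 x)].
  rewrite (deflateE x Tf); set k := ketbra _ x; set y := x - _.
  rewrite innerBl innerZl; case: eqP => [l00|/eqP l00] /=; first by rewrite conjC0 mul0r subr0.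
  have lp : 0 < (top_pair T).1 by rewrite lt_def l00.
  rewrite /k /ketbra innerZl (positive_selfadjoint Tp (top_pair T).2) Tphi innerZl /y.
  rewrite l00 scale1r innerBr /k /ketbra innerZr inner_nrm (p1 lp) expr1n mulr1.
  by rewrite subrr !mulr0 subr0.
split; last first.
  apply: le_lt_trans trT; apply: le_esum => j _; rewrite lee_fin qform_deflate.
  by rewrite lerBlDr lerDl mulr_ge0// exprn_ge0// nrm_ge0.
split; last by move=> x; rewrite dE; case: Tp => _; apply.
have [M M0 TM] := bounded_pos Tp.1.
apply/bounded_opE; split.
  move=> c x y; rewrite /deflate lT /ketbra innerDr innerZr scalerDl scalerDr scalerBr.
  by rewrite opprD addrACA !scalerA mulrCA mulrA.
exists (M + (top_pair T).1 * nrm (top_pair T).2 ^+ 2) => x.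
rewrite /deflate (le_trans (nrmB _ _))// mulrDl lerD//.
rewrite !nrmZ nrm_real ger0_norm// -mulrA ler_wpM2l//.
by rewrite mulrC expr2 -mulrA ler_wpM2l ?nrm_ge0// inner_CS.
Qed.

Variable T : H -> H.
Hypothesis Tf : finite_trace T.

Let Tn n := iter n deflate T.
Let lam n := (top_pair (Tn n)).1.
Let phi n := (top_pair (Tn n)).2.
Let D : set nat := [set n | 0 < lam n].

Let Tnf n : finite_trace (Tn n).
Proof. by elim: n => [//|n IH]; exact: deflate_finite_trace. Qed.

Let Tnp n : positive_op (Tn n).
Proof. by have [] := Tnf n. Qed.

Let lamP n := top_pairP (Tnf n).

Let lam_ge0 n : 0 <= lam n.
Proof. by have [] := lamP n. Qed.

Let lam0 n : ~ D n -> lam n = 0.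
Proof.
by move=> /negP; rewrite -leNgt => h; apply/eqP; rewrite eq_le h lam_ge0.
Qed.

(** A removed eigenvector stays in the kernel: if [Tn m] kills [phi n], self-adjointness gives [lam
    m * '[phi m, phi n] = 0], so the next deflation does not affect [phi n]. *)
Let Tn_phi n m : (n < m)%N -> D n -> Tn m (phi n) = 0.
Proof.
move=> nm Dn; have [_ Tphi p1 _] := lamP n.
elim: m nm => [//|m IH]; rewrite ltnS leq_eqVlt => /orP[/eqP <-|nm].
  rewrite /Tn /= -/(Tn n) /deflate -/(phi n) -/(lam n) Tphi /ketbra inner_nrm p1//.
  by rewrite expr1n scale1r subrr.
rewrite /Tn /= -/(Tn m) /deflate -/(phi m) -/(lam m) IH// sub0r.
have [Dm|/lam0 ->] := pselect (D m); last by rewrite scale0r oppr0.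
have [_ Tphim _ _] := lamP m.
have : (lam m)%:C * '[phi m, phi n] = 0.
  rewrite -[(lam m)%:C]conjC_real -innerZl -Tphim -(positive_selfadjoint (Tnp m)).
  by rewrite IH// inner0r.
by rewrite /ketbra scalerA => ->; rewrite scale0r oppr0.
Qed.

Let ophi : Defs.orthonormal D phi.
Proof.
have lt_orth n m : D n -> D m -> (n < m)%N -> '[phi m, phi n] = 0.
  move=> Dn Dm nm; have [_ Tphim _ _] := lamP m.
  have : (lam m)%:C * '[phi m, phi n] = 0.
    rewrite -[(lam m)%:C]conjC_real -innerZl -Tphim -(positive_selfadjoint (Tnp m)).
    by rewrite Tn_phi// inner0r.
  move=> /eqP; rewrite mulf_eq0 => /orP[/eqP/complexI l0|/eqP//].
  by move: Dm; rewrite /D /= l0 ltxx.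
move=> i j Di Dj; have [<-|ij] := eqVneq i j.
  by have [_ _ p1 _] := lamP i; rewrite inner_nrm p1// expr1n.
have [ij'|ji|/eqP] := ltngtP i j; last by rewrite (negbTE ij).
  by rewrite inner_conj lt_orth// conjC0.
exact: lt_orth.
Qed.

Let lam_dec n : lam n.+1 <= lam n.
Proof.
have [Dn|/lam0 ->] := pselect (D n.+1); last exact: lam_ge0.
have [_ Tphi p1 _] := lamP n.+1; have [_ _ _ Tle] := lamP n.
apply: (@le_trans _ _ (qform (Tn n) (phi n.+1))); last first.
  by have := Tle (phi n.+1); rewrite -/(lam n) p1// expr1n mulr1.
apply: (@le_trans _ _ (qform (Tn n.+1) (phi n.+1))).
  by rewrite /qform Tphi innerZr inner_nrm p1// expr1n mulr1.
rewrite [leLHS]qform_deflate lerBlDr lerDl mulr_ge0 ?exprn_ge0 ?nrm_ge0//.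
exact: lam_ge0.
Qed.

Let lam_mono n m : (n <= m)%N -> lam m <= lam n.
Proof.
elim: m => [|m IH]; first by rewrite leqn0 => /eqP ->.
by rewrite leq_eqVlt => /orP[/eqP -> //|/IH]; apply: le_trans (lam_dec m).
Qed.

Let TnE n x : Tn n x = T x - \sum_(i < n) (lam i)%:C *: ketbra (phi i) x.
Proof.
elim: n => [|n IH]; first by rewrite big_ord0 subr0.
by rewrite big_ord_recr /= opprD addrA -IH.
Qed.

Let qTn n x : qform T x = qform (Tn n) x + \sum_(i < n) lam i * nrm '[phi i, x] ^+ 2.
Proof.
elim: n => [|n ->]; first by rewrite big_ord0 addr0.
rewrite big_ord_recr /= [qform (deflate _) _]qform_deflate.
by rewrite -/(lam n) -/(phi n) -/(Tn n); ring.
Qed.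

Let lam_sum n : ((\sum_(i < n) lam i)%:E <= \esum_(j in E) (qform T (e j))%:E)%E.
Proof.
apply: (@le_trans _ _ (\esum_(j in E) \sum_(i < n) (lam i * nrm '[phi i, e j] ^+ 2)%:E)%E); last first.
  apply: le_esum => j _; rewrite sumEFin lee_fin (qTn n) lerDr.
  exact: qform_ge0.
rewrite esum_sum; last by move=> *; rewrite lee_fin mulr_ge0 ?exprn_ge0 ?nrm_ge0 ?lam_ge0.
rewrite -sumEFin; apply: lee_sum => i _.
have [Di|/lam0 ->] := pselect (D i); last first.
  by apply: esum_ge0 => *; rewrite lee_fin mul0r.
under eq_esum do rewrite EFinM nrm_inner_sym.
rewrite esumZ ?lam_ge0//; last by move=> j _; rewrite lee_fin exprn_ge0// nrm_ge0.
by rewrite (basis_Parseval be) (onb_nrm1 ophi)// expr1n mule1.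
Qed.

(** The eigenvalues decrease and their partial sums are bounded by the trace [B], so
    [N%:R * lam N <= B]. *)
Let lam_small (d : R) : 0 < d -> exists N, lam N < d.
Proof.
move=> d0; pose B := fine (\esum_(j in E) (qform T (e j))%:E)%E.
have lB n : \sum_(i < n) lam i <= B.
  rewrite -lee_fin fineK ?lam_sum// ge0_fin_numE; first by case: Tf.
  by apply: esum_ge0 => j _; rewrite lee_fin qform_ge0//; case: Tf.
have [N hN] : exists N : nat, B / d < N%:R.
  by exists (Num.truncn (B / d)).+1; rewrite truncnS_gt.
exists N; rewrite ltNge; apply/negP => dl.
have := lB N; rewrite leNgt => /negP; apply.
rewrite ltr_pdivrMr// in hN; apply: (lt_le_trans hN).
rewrite -[N in N%:R]card_ord mulr_natl -sumr_const.
by apply: ler_sum => i _; apply: (le_trans dl); apply: lam_mono; apply: ltnW.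
Qed.

Lemma spectral_theorem : exists lam phi,
  [/\ forall n, 0 <= lam n, forall n m, (n <= m)%N -> lam m <= lam n
    & spectral_rep T ([set n | 0 < lam n], lam, phi)].
Proof.
exists lam, phi; split => //; split; first exact: ophi.
move=> x; apply/sums_toP => d d0.
(* The error splits into [Tn N x] and the terms of index at least [N], each of norm at most
   [lam N * nrm x]; the [1] keeps the divisor positive. *)
have x0 : 0 < 2 * nrm x + 1 by rewrite ltr_wpDl ?mulr_ge0 ?nrm_ge0.
have [N hN] := lam_small (divr_gt0 d0 x0).
exists (seq_fset tt (iota 0 N)) => F NF.
rewrite /psums (big_fset_split _ _ NF).
have -> : \sum_(i <- seq_fset tt (iota 0 N) | i \in [set n | 0 < lam n])
   (lam i)%:C *: ketbra (phi i) x = \sum_(i < N) (lam i)%:C *: ketbra (phi i) x.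
  rewrite -(big_mkord xpredT (fun i => (lam i)%:C *: ketbra (phi i) x)) big_mkcond.
  rewrite (perm_big (index_iota 0 N)); last first.
    by apply: uniq_perm => [||i]; rewrite ?seq_fset_uniq ?iota_uniq// seq_fsetE /index_iota subn0.
  apply: eq_bigr => i _; case: ifPn => //; rewrite notin_setE => /lam0 ->.
  by rewrite scale0r.
rewrite opprD addrA -TnE.
have h1 : nrm (Tn N x) <= lam N * nrm x.
  by apply: positive_nrm_le; [exact: lam_ge0 | exact: Tnp | case: (lamP N)].
have h2 : nrm (\sum_(i <- (F `\` seq_fset tt (iota 0 N))%fset | i \in [set n | 0 < lam n])
    (lam i)%:C *: ketbra (phi i) x) <= lam N * nrm x.
  rewrite -(@ler_pXn2r _ 2) ?nnegrE ?mulr_ge0 ?nrm_ge0 ?lam_ge0//.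
  under eq_bigr do rewrite /ketbra scalerA.
  rewrite (nrm_psums ophi); last by move=> i; rewrite inE.
  apply: (@le_trans _ _ (\sum_(i <- (F `\` seq_fset tt (iota 0 N))%fset | i \in [set n | 0 < lam n])
     lam N ^+ 2 * nrm '[phi i, x] ^+ 2)).
    rewrite big_seq_cond [leRHS]big_seq_cond; apply: ler_sum => i /andP[].
    rewrite in_fsetD seq_fsetE mem_iota add0n /= -leqNgt => /andP[Ni _] _.
    rewrite nrmM exprMn nrm_real ler_wpM2r ?exprn_ge0 ?nrm_ge0//.
    by rewrite real_normK ?num_real// lerXn2r ?nnegrE ?lam_ge0// lam_mono.
  rewrite -mulr_sumr exprMn ler_wpM2l ?sqr_ge0//.
  exact: (Bessel_fset ophi).
rewrite (le_lt_trans (nrmB _ _))//.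
apply: (@le_lt_trans _ _ (lam N * (2 * nrm x + 1))).
  by have := lam_ge0 N; move: h1 h2; lra.
by rewrite -ltr_pdivlMr.
Qed.

End spectral_theorem.

(** * Trace, functional calculus and absolute value *)

Section trace_theory.
Context {R : realType} {H : hilbertType R}.
Hypothesis hb : has_basis H.
Implicit Types (T S P : H -> H) (D : set nat) (a : nat -> R) (phi : nat -> H).

Lemma traceE : exists E (e : nat -> H), orthonormal_basis E e /\
  forall T, (trace T = \esum_(i in E) (qform T (e i))%:E)%E.
Proof.
pose De := xget (set0, fun=> 0)
    [set De : set nat * (nat -> H) | orthonormal_basis De.1 De.2].
exists De.1, De.2; split => //.
exact: (xgetPex (set0, fun=> 0) hb).
Qed.

Lemma trace_spectral T D a phi : spectral_rep T (D, a, phi) ->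
  (forall i, D i -> 0 <= a i) -> (trace T = \esum_(i in D) (a i)%:E)%E.
Proof.
move=> h a0; have [E [e [be ->]]] := traceE.
exact: spectral_rep_trace be h a0.
Qed.

(** If either sum is finite, the spectral theorem in the corresponding basis applies, and both sums
    equal that of the eigenvalues; otherwise both are [+oo]. *)
Lemma basis_trace (J : choiceType) (E : set J) (e : J -> H) T :
  orthonormal_basis E e -> positive_op T ->
  (trace T = \esum_(i in E) (qform T (e i))%:E)%E.
Proof.
move=> be Tp; have [E' [e' [be' trE]]] := traceE.
have [fin|inf] := boolP (\esum_(i in E) (qform T (e i))%:E < +oo)%E.
  have [lam [phi [l0 _ h]]] := spectral_theorem be (conj Tp fin).
  rewrite (trace_spectral h); last by move=> i _.
  by rewrite (spectral_rep_trace be h).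
have [fin'|inf'] := boolP (trace T < +oo)%E.
  rewrite trE in fin'.
  have [lam [phi [l0 _ h]]] := spectral_theorem be' (conj Tp fin').
  rewrite (trace_spectral h); last by move=> i _.
  by rewrite (spectral_rep_trace be h).
by move: inf inf'; rewrite -!leNgt !leye_eq => /eqP -> /eqP ->.
Qed.

Lemma spectral_positive T : positive_op T -> (trace T < +oo)%E ->
  exists lam phi, [/\ forall n, 0 <= lam n, forall n m, (n <= m)%N -> lam m <= lam n
    & spectral_rep T ([set n | 0 < lam n], lam, phi)].
Proof.
have [E [e [be ->]]] := traceE; move=> Tp fin.
exact: (spectral_theorem be (conj Tp fin)).
Qed.

Lemma trace_ge0 T : positive_op T -> (0 <= trace T)%E.
Proof.
have [E [e [be ->]]] := traceE; move=> Tp.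
by apply: esum_ge0 => i _; rewrite lee_fin qform_ge0.
Qed.

(** Each eigenvalue is a single term of the sum of eigenvalues, which is the trace. *)
Lemma qform_le_trace T m x : positive_op T -> (trace T <= m%:E)%E ->
  qform T x <= m * nrm x ^+ 2.
Proof.
move=> Tp tm; have fin := le_lt_trans tm (ltry m).
have [lam [phi [l0 _ h]]] := spectral_positive Tp fin.
have m0 : 0 <= m by rewrite -lee_fin (le_trans _ tm)// trace_ge0.
have lm i : 0 < lam i -> lam i <= m.
  move=> li; rewrite -lee_fin (le_trans _ tm)// (trace_spectral h)//.
  apply: le_trans (psum_le_esum _ _ [fset i]%fset).
  by rewrite big_mkcond big_seq_fset1 mem_set.
rewrite -lee_fin -(spectral_rep_qform x h); last by move=> i _.
apply: (@le_trans _ _ (\esum_(i in [set n | (0 < lam n)%R]) (m%:E * (nrm '[phi i, x] ^+ 2)%:E))%E).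
  apply: le_esum => i /= li; rewrite -EFinM lee_fin ler_wpM2r ?exprn_ge0 ?nrm_ge0//.
  exact: lm.
rewrite esumZ//; last by move=> i _; rewrite lee_fin exprn_ge0// nrm_ge0.
by rewrite EFinM lee_wpmul2l ?lee_fin// Bessel//; case: h.
Qed.

(** Comparing coefficients in [T v = l%:C *: v] shows that [v] is orthogonal to each [phi j] whose
    eigenvalue differs from [l]. *)
Lemma spectral_rep_fun_eigen T G D a phi (f : R -> R) v l :
  spectral_rep T (D, a, phi) -> spectral_rep G (D, f \o a, phi) ->
  f 0 = 0 -> T v = l%:C *: v -> G v = (f l)%:C *: v.
Proof.
move=> h hG f0 Tv.
have co j : D j -> a j = l \/ '[phi j, v] = 0.
  move=> Dj; have := spectral_rep_coord v h Dj; rewrite Tv innerZr => /eqP.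
  rewrite -subr_eq0 -mulrBl mulf_eq0 => /orP[|/eqP ->]; last by right.
  by rewrite subr_eq0 => /eqP/complexI ->; left.
have hs := hG.2 v; apply: (sums_to_uniq hs) => {hs}.
(* The vectors [phi] need not span the space. For [l = 0], [v] may leave their closed span, but both
   sides vanish as [f 0 = 0]; for other [l], [v = l^-1 T v] lies in it. *)
have [l0|l0] := eqVneq l 0.
  rewrite l0 f0 scale0r; apply: sums_to0 => i Di /=.
  have [->|v0] := co i Di; first by rewrite l0 f0 scale0r.
  by rewrite /ketbra v0 scale0r scaler0.
have -> : (f l)%:C *: v = (f l / l)%:C *: T v + 0.
  by rewrite addr0 Tv scalerA -rmorphM divfK.
apply: (eq_sums_to _ (sums_to_lin (h.2 v) (sums_to0 (f := fun=> 0) _))) => // i Di /=.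
rewrite addr0; have [->|v0] := co i Di; last by rewrite /ketbra v0 scale0r !scaler0.
by rewrite scalerA -rmorphM divfK.
Qed.

Lemma spectral_rep_values T D a phi m : positive_op T ->
  (forall x, qform T x <= m * nrm x ^+ 2) ->
  spectral_rep T (D, a, phi) -> forall i, D i -> 0 <= a i <= m.
Proof.
move=> Tp Tm h i Di; have p1 := onb_nrm1 h.1 Di.
have : qform T (phi i) = a i.
  by rewrite /qform (spectral_rep_eigen h Di) innerZr inner_nrm p1 expr1n mulr1.
by move=> <-; rewrite qform_ge0//=; have := Tm (phi i); rewrite p1 expr1n mulr1.
Qed.

(** [fcalc] works with one chosen representation; the lemma transfers its result to any other one,
    since eigenvectors of [T] are eigenvectors of [fcalc f T] with the expected eigenvalues. *)
Lemma fcalc_spectral T D a phi m M (f : R -> R) : positive_op T ->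
  (forall x, qform T x <= m * nrm x ^+ 2) ->
  (forall t, 0 <= t <= m -> `|f t| <= M) -> f 0 = 0 ->
  spectral_rep T (D, a, phi) -> spectral_rep (fcalc f T) (D, f \o a, phi).
Proof.
move=> Tp Tm fM f0 h; rewrite /fcalc.
have := @xgetPex _ (set0, fun=> 0, fun=> 0) (spectral_rep T) (ex_intro _ _ h).
case: (xget _ _) => -[D' b] psi h'.
have [G hG] : exists G, spectral_rep G (D', f \o b, psi).
  apply: (@spectral_rep_ex _ _ _ _ _ M h'.1) => i Di.
  by apply: fM; exact: (spectral_rep_values Tp Tm h').
rewrite [X in spectral_rep X _](_ : _ = G); last first.
  by apply/funext => x; apply: hsumE; exact: hG.2.
split; first exact: h.1.
move=> x; have [s hs] := proj_sums_to h.1 x.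
have bG : bounded_lin G.
  apply/bounded_opE; apply: (@spectral_rep_bounded _ _ _ _ _ _ (Num.max M 0) hG).
    by rewrite le_max lexx orbT.
  move=> i Di; rewrite le_max fM//.
  exact: (spectral_rep_values Tp Tm h').
(* The component of [x] orthogonal to all [phi i] is killed by [T], hence by [G], because
   [f 0 = 0]. *)
have -> : G x = G s.
  apply/eqP; rewrite -subr_eq0 -(linB _ _ bG.1); apply/eqP.
  rewrite (@spectral_rep_fun_eigen T G D' b psi f _ 0 h' hG f0) ?f0 ?scale0r//.
  apply: (sums_to_uniq (h.2 _)); apply: sums_to0 => i Di.
  by rewrite /ketbra innerBr (proj_coord h.1 hs Di) subrr scale0r scaler0.
apply: (eq_sums_to _ (bounded_lin_sums_to bG hs)) => i Di.
rewrite /ketbra (linZ _ _ bG.1).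
rewrite (spectral_rep_fun_eigen h' hG f0 (spectral_rep_eigen h Di)).
by rewrite !scalerA mulrC.
Qed.

(* An approximate minimizer [x] of the form of [N = P - T] nearly satisfies
   [T x = P x + nu *: x] with [nu > 0], so that [T x] is longer than [P x]. *)
Lemma Loewner P T : positive_op P -> bounded_op T -> selfadjoint T ->
  (forall x, '[x, P (P x)] = '[T x, T x]) ->
  forall x, complex.Re '[x, T x] <= qform P x.
Proof.
move=> Pp Tb Ts PT x0; rewrite leNgt; apply/negP => lt0.
have lT := Tb.1; have lP := positive_lin Pp.
have PTn x : nrm (P x) ^+ 2 = nrm (T x) ^+ 2.
  have := PT x; rewrite (positive_selfadjoint Pp) !inner_nrm.
  by move=> /complexI.
have [MT MT0 hMT] := bounded_pos Tb; have [MP MP0 hMP] := bounded_pos Pp.1.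
have Tim x : complex.Im '[x, T x] = 0.
  have : '[x, T x] = '[x, T x]^* by rewrite -inner_conj -Ts.
  by case: '[x, T x] => u v /= [] h; lra.
pose q x := qform T x - qform P x.
have qM x : q x <= MT * nrm x ^+ 2.
  by rewrite lerBlDr (le_trans (qform_le _ hMT))// lerDl qform_ge0.
have q0 : 0 < q x0 by rewrite subr_gt0.
have x0n : 0 < nrm x0.
  rewrite lt_def nrm_ge0 andbT; apply: contraTneq q0 => /nrm0_eq0 ->.
  by rewrite /q /qform !inner0l subrr ltxx.
have qZ c x : q (c *: x) = nrm c ^+ 2 * q x.
  rewrite /q mulrBr -(qformZ c x Pp); congr (_ - _).
  by rewrite /qform (linZ _ _ lT) innerZr innerZl mulrA [c * _]mulrC mul_conj ReZ.
pose S := [set q x | x in [set x | nrm x = 1]].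
have Ssup : has_sup S.
  split.
    exists (q (normalize x0)); exists (normalize x0) => //=.
    by rewrite nrmZ nrm_real ger0_norm ?invr_ge0 ?nrm_ge0// mulVf// gt_eqF.
  by exists MT => _ [x /= x1 <-]; have := qM x; rewrite x1 expr1n mulr1.
pose nu := sup S.
have qnu x : q x <= nu * nrm x ^+ 2.
  have [->|/eqP xn0] := eqVneq x 0.
    by rewrite /q /qform !inner0l subrr nrm0 expr0n mulr0.
  have xn : 0 < nrm x by rewrite lt_def nrm_ge0 andbT; apply/eqP => /nrm0_eq0.
  have : q (normalize x) <= nu.
    apply: ub_le_sup; [by case: Ssup | exists (normalize x) => //=].
    by rewrite nrmZ nrm_real ger0_norm ?invr_ge0 ?nrm_ge0// mulVf// gt_eqF.
  rewrite /normalize qZ nrm_real ger0_norm ?invr_ge0 ?nrm_ge0// exprVn.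
  by rewrite mulrC ler_pdivrMr// exprn_gt0.
have nu0 : 0 < nu.
  have := lt_le_trans q0 (qnu x0); rewrite pmulr_lgt0// exprn_gt0//.
pose N x := (P x - T x) + nu%:C *: x.
have qN x : qform N x = nu * nrm x ^+ 2 - q x.
  rewrite /qform /N innerDr innerBr innerZr inner_nrm !ReD ReN -rmorphM /= /q /qform.
  ring.
have N_le x : nrm (N x) <= (MP + MT + nu) * nrm x.
  rewrite /N (le_trans (nrmD _ _))// mulrDl lerD//; last first.
    by rewrite nrmZ nrm_real gtr0_norm.
  by rewrite (le_trans (nrmB _ _))// mulrDl lerD.
have Np : positive_op N.
  split.
    apply/bounded_opE; split; last by exists (MP + MT + nu).
    move=> c x y; rewrite /N lP lT !scalerDr scalerN opprD.
    rewrite [nu%:C *: (c *: x)]scalerA [nu%:C * c]mulrC -scalerA.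
    by rewrite (addrACA (c *: P x) (P y)) (addrACA (c *: P x - c *: T x)).
  move=> x; have Nre : 0 <= qform N x by rewrite qN subr_ge0.
  rewrite lecE /= Nre andbT /N innerDr innerBr innerZr inner_nrm -rmorphM.
  have := Tim x; rewrite (qformE x Pp).
  by case: '[x, T x] => u v /= ->; rewrite oppr0 !addr0.
(* [K] bounds [N], and [L] is the factor in [nu ^+ 2 <= L * nrm (N x)], which follows from the
   equality of the norms of [T x] and [P x]. As [nrm (N x) ^+ 2 <= K * d], squaring would give
   [nu ^+ 4 <= L ^+ 2 * (K * d)], and [d] makes the right-hand side [nu ^+ 4 / 2]. *)
pose K := MP + MT + nu; have K0 : 0 < K by rewrite !addr_gt0.
pose L := 2 * (MP + nu); have L0 : 0 < L by rewrite mulr_gt0// addr_gt0.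
pose d := nu ^+ 4 / (2 * (L ^+ 2 * K)).
have d0 : 0 < d by rewrite /d divr_gt0 ?exprn_gt0// mulr_gt0// mulr_gt0// exprn_gt0.
have [_ [x x1 <-] hx] := sup_adherent d0 Ssup.
have x1' : nrm x = 1 := x1.
have Nx : nrm (N x) ^+ 2 <= K * d.
  have NK y : qform N y <= K * nrm y ^+ 2 by exact: qform_le.
  apply: (le_trans (positive_sqr_le Np NK x)).
  by rewrite ler_pM2l// qN x1' expr1n mulr1; move: hx; rewrite -/nu; lra.
pose y := P x + nu%:C *: x.
have Tx : T x = y - N x.
  by rewrite /y /N opprD opprB addrACA subrr addr0 addrC subrK.
have yn : nrm (P x) ^+ 2 + nu ^+ 2 <= nrm y ^+ 2.
  rewrite /y nrm_sqrD nrmZ nrm_real x1' mulr1 real_normK ?num_real// lerD2r lerDl.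
  rewrite innerZr ReZ (inner_conj x (P x)) ReJ.
  by rewrite mulr_ge0// mulr_ge0 ?(ltW nu0)//; exact: (qform_ge0 x Pp).
have yle : nrm y <= MP + nu.
  rewrite (le_trans (nrmD _ _))// nrmZ nrm_real x1' mulr1 gtr0_norm// lerD2r.
  by have := hMP x; rewrite x1' mulr1.
have : nu ^+ 2 <= L * nrm (N x).
  have := PTn x; rewrite Tx nrm_sqrB => E.
  have h1 : complex.Re '[y, N x] <= (MP + nu) * nrm (N x).
    rewrite (le_trans (ler_norm _))// (le_trans (Re_le_nrm _))//.
    by rewrite (le_trans (inner_CS _ _))// ler_wpM2r ?nrm_ge0.
  have := sqr_ge0 (nrm (N x)); rewrite /L; move: E yn h1; lra.
rewrite -(@ler_pXn2r _ 2) ?nnegrE ?exprn_ge0 ?mulr_ge0 ?nrm_ge0 ?addr_ge0 ?(ltW nu0) ?(ltW MP0)//.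
rewrite [in leRHS]exprMn -exprM leNgt => /negP; apply.
apply: (@le_lt_trans _ _ (L ^+ 2 * (K * d))); first by rewrite ler_pM2l// exprn_gt0.
rewrite /d (_ : L ^+ 2 * _ = nu ^+ 4 / 2); last first.
  by field; rewrite !gt_eqF.
by rewrite ltr_pdivrMr// ltr_pMr ?exprn_gt0// ltrDl.
Qed.

End trace_theory.

Lemma ker_row (F : fieldType) m n (A : 'M[F]_(m, n)) : (n < m)%N ->
  exists2 v : 'rV_m, v != 0 & v *m A = 0.
Proof.
move=> nm; have : kermx A != 0.
  rewrite -mxrank_eq0 mxrank_ker -lt0n subn_gt0.
  exact: leq_ltn_trans (rank_leq_col A) nm.
by move=> /rowV0Pn[v /sub_kermxP vA v0]; exists v.
Qed.

Section Weyl.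
Context {R : realType} {H : hilbertType R}.

(* Some nonzero vector of the span of the first [n.+1] eigenvectors of [B] is
   orthogonal to the first [n] eigenvectors of [C]. *)
Lemma Weyl (B C : H -> H) (b c : nat -> R) (psi chi : nat -> H) n :
  (forall n, 0 <= b n) -> (forall n m, (n <= m)%N -> b m <= b n) ->
  (forall n, 0 <= c n) -> (forall n m, (n <= m)%N -> c m <= c n) ->
  spectral_rep B ([set n | 0 < b n], b, psi) ->
  spectral_rep C ([set n | 0 < c n], c, chi) ->
  (forall x, qform B x <= qform C x) -> b n <= c n.
Proof.
move=> b0 bm c0 cm hB hC BC.
have [bn0|/eqP bn0] := eqVneq (b n) 0; first by rewrite bn0.
have bn : 0 < b n by rewrite lt_def b0 andbT; apply/eqP.
have Db (i : 'I_n.+1) : [set n | 0 < b n] i.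
  by apply: lt_le_trans bn _; apply: bm; rewrite -ltnS.
have [a a0 aM] := ker_row (\matrix_(i < n.+1, j < n) '[chi j, psi i]) (ltnSn n).
pose v := \sum_(i < n.+1) a 0 i *: psi i.
have psiE (k i : 'I_n.+1) : '[psi i, psi k] = (i == k)%:R.
  by rewrite (proj1 hB (nat_of_ord i) (nat_of_ord k) (Db i) (Db k)).
have lB := spectral_rep_linear hB.
have Bv : B v = \sum_(i < n.+1) (a 0 i * (b i)%:C) *: psi i.
  rewrite /v (lin_sum _ _ _ lB); apply: eq_bigr => i _.
  by rewrite (linZ _ _ lB) (spectral_rep_eigen hB (Db i)) scalerA.
have inv (w : 'I_n.+1 -> R[i]) : '[v, \sum_(i < n.+1) w i *: psi i] =
    \sum_(i < n.+1) (a 0 i)^* * w i.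
  rewrite inner_sumr; apply: eq_bigr => k _; rewrite innerZr inner_suml.
  rewrite (bigD1 k) //= big1 ?addr0; last first.
    by move=> i ik; rewrite innerZl psiE (negbTE ik) mulr0.
  by rewrite innerZl psiE eqxx mulr1 mulrC.
have vn : nrm v ^+ 2 = \sum_(i < n.+1) nrm (a 0 i) ^+ 2.
  apply: complexI; rewrite -inner_nrm {2}/v inv rmorph_sum.
  by apply: eq_bigr => i _; rewrite mul_conj.
have v0 : 0 < nrm v ^+ 2.
  rewrite lt_def sqr_ge0 andbT vn; apply: contra_neq a0 => /eqP.
  rewrite psumr_eq0; last by move=> *; exact: sqr_ge0.
  move=> /allP h; apply/rowP => i; rewrite mxE; apply: nrm0_eq0; apply/eqP.
  by rewrite -sqrf_eq0; apply: h; rewrite mem_index_enum.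
have qB : b n * nrm v ^+ 2 <= qform B v.
  rewrite /qform Bv inv Re_sum vn mulr_sumr; apply: ler_sum => i _.
  rewrite [X in complex.Re X]mulrA mul_conj ReZ /= mulrC ler_wpM2l ?sqr_ge0//.
  by rewrite bm// -ltnS.
have qC : qform C v <= c n * nrm v ^+ 2.
  rewrite -lee_fin -(spectral_rep_qform v hC); last by move=> i _.
  apply: (@le_trans _ _ (\esum_(i in [set n | (0 < c n)%R])
      ((c n)%:E * (nrm '[chi i, v] ^+ 2)%:E))%E).
    apply: le_esum => i /= ci; rewrite -EFinM lee_fin.
    have [ni|ni] := leqP n i; first by rewrite ler_wpM2r ?sqr_ge0// cm.
    suff -> : '[chi i, v] = 0 by rewrite nrm0 expr0n !mulr0.
    have /rowP/(_ (Ordinal ni)) := aM; rewrite !mxE => <-.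
    by rewrite inner_sumr; apply: eq_bigr => k _; rewrite !mxE innerZr.
  rewrite esumZ//; last by move=> i _; rewrite lee_fin sqr_ge0.
  by rewrite EFinM lee_wpmul2l ?lee_fin// Bessel//; case: hC.
by rewrite -(ler_pM2r v0) (le_trans qB)// (le_trans (BC v)).
Qed.

End Weyl.

Section absolute_value.
Context {R : realType} {H : hilbertType R}.
Hypothesis hb : has_basis H.
Implicit Types S T P : H -> H.

Lemma subfunE S T x : (S - T) x = S x - T x.
Proof. by []. Qed.

Lemma bounded_opB S T : bounded_op S -> bounded_op T -> bounded_op (S - T).
Proof.
move=> Sb Tb; have [M M0 SM] := bounded_pos Sb; have [M' M'0 TM] := bounded_pos Tb.
apply/bounded_opE; split.
  move=> c x y; rewrite !subfunE Sb.1 Tb.1 scalerBr.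
  by rewrite opprD (addrACA (c *: S x) (S y)).
exists (M + M') => x; rewrite subfunE (le_trans (nrmB _ _))// mulrDl.
exact: lerD.
Qed.

Lemma selfadjointB S T : selfadjoint S -> selfadjoint T -> selfadjoint (S - T).
Proof.
move=> Ss Ts x y.
by rewrite !subfunE innerBr innerBl Ss Ts.
Qed.

Lemma sqrt_op_ex T : positive_op T -> (trace T < +oo)%E ->
  exists2 P, positive_op P & forall x, P (P x) = T x.
Proof.
move=> Tp fin; have [lam [phi [l0 lm h]]] := spectral_positive hb Tp fin.
have sl i : 0 <= Num.sqrt (lam i) <= Num.sqrt (lam 0%N).
  by rewrite sqrtr_ge0/= ler_sqrt// lm.
have [P hP] : exists P, spectral_rep P ([set n | 0 < lam n], fun i => Num.sqrt (lam i), phi).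
  apply: (@spectral_rep_ex _ _ _ _ _ (Num.sqrt (lam 0%N)) h.1) => i _.
  by have /andP[s0 s1] := sl i; rewrite ger0_norm.
exists P; first by apply: (spectral_rep_positive hP) => i _; exact: sl.
move=> x; apply: (sums_to_uniq (hP.2 _)).
apply: (eq_sums_to _ (h.2 x)) => i Di.
rewrite /ketbra (spectral_rep_coord x hP Di) !scalerA mulrA -rmorphM.
by rewrite -expr2 sqr_sqrtr.
Qed.

(** The witness is the square root of [X2]. The spectral theorem provides it because [X2] has finite
    trace: [nrm (X a) ^+ 2] is at most twice the sum of the squared norms of [S a] and [T a], and
    these are controlled by the forms of [S] and [T]. *)
Lemma abs_op_diff S T : positive_op S -> positive_op T ->
  (trace S < +oo)%E -> (trace T < +oo)%E ->
  positive_op (abs_op (S - T)) /\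
  forall x y, '[x, abs_op (S - T) (abs_op (S - T) y)] = '[(S - T) x, (S - T) y].
Proof.
move=> Sp Tp finS finT; set X := S - T.
have Xs : selfadjoint X by apply: selfadjointB; exact: positive_selfadjoint.
have Xb : bounded_op X := bounded_opB Sp.1 Tp.1.
have lX := Xb.1.
pose X2 x := X (X x).
have qX2 x : '[x, X2 x] = (nrm (X x) ^+ 2)%:C by rewrite /X2 Xs inner_nrm.
have X2p : positive_op X2.
  split; last by move=> x; rewrite qX2 ler0c sqr_ge0.
  have [M M0 XM] := bounded_pos Xb.
  apply/bounded_opE; split; first by move=> c x y; rewrite /X2 !lX.
  exists (M * M) => x; rewrite (le_trans (XM _))// -mulrA ler_wpM2l ?(ltW M0)//.
have finX2 : (trace X2 < +oo)%E.
  have [E [e [be trE]]] := traceE hb; rewrite trE in finS; rewrite trE in finT; rewrite trE.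
  have [M M0 SM] := positive_bound Sp; have [M' M'0 TM'] := positive_bound Tp.
  apply: (@le_lt_trans _ _ (\esum_(i in E) ((2 * M)%:E * (qform S (e i))%:E +
      (2 * M')%:E * (qform T (e i))%:E))%E).
    apply: le_esum => i _; rewrite -!EFinM -EFinD lee_fin {1}/qform qX2 /=.
    have := positive_sqr_le Sp SM (e i); have := positive_sqr_le Tp TM' (e i).
    have : nrm (X (e i)) ^+ 2 <= (nrm (S (e i)) + nrm (T (e i))) ^+ 2.
      by rewrite lerXn2r ?nnegrE ?addr_ge0 ?nrm_ge0// nrmB.
    have := sqr_ge0 (nrm (S (e i)) - nrm (T (e i))).
    by rewrite sqrrB sqrrD; lra.
  rewrite esumD; [|by move=> i _; rewrite -EFinM lee_fin !mulr_ge0 ?qform_ge0// ltW..].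
  rewrite !esumZ ?mulr_ge0 ?(ltW M0) ?(ltW M'0)//;
    [|by move=> i _; rewrite lee_fin qform_ge0..].
  by apply: lte_add_pinfty; apply: lte_mul_pinfty; rewrite ?lee_fin ?mulr_ge0 ?(ltW M0) ?(ltW M'0).
have [P Pp PP] := sqrt_op_ex X2p finX2.
have : positive_op P /\ forall x y, '[x, P (P y)] = '[X x, X y].
  by split => // x y; rewrite PP /X2 Xs.
by move=> hP; apply: (@xgetPex _ (fun=> 0) [set P | positive_op P /\ _]); exists P.
Qed.

(** Instead of uniqueness of positive square roots, [Loewner] is applied in both directions: [T] and
    [abs_op T] have the same square, hence the same form. *)
Lemma trace_norm_positive T : positive_op T -> trace_norm T = trace T.
Proof.
move=> Tp; rewrite /trace_norm; have Ts := positive_selfadjoint Tp.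
have [Pp PT] : positive_op (abs_op T) /\
    forall x y, '[x, abs_op T (abs_op T y)] = '[T x, T y].
  apply: (@xgetPex _ (fun=> 0) [set P | positive_op P /\ _]); exists T.
  by split => // x y; rewrite Ts.
have [E [e [be trE]]] := traceE hb; rewrite !trE.
apply: eq_esum => i _; congr (_%:E); apply/eqP; rewrite eq_le; apply/andP; split.
  apply: (Loewner Tp Pp.1 (positive_selfadjoint Pp)) => x.
  by rewrite Ts -PT (positive_selfadjoint Pp).
by apply: (Loewner Pp Tp.1 Ts) => x; rewrite PT.
Qed.

End absolute_value.

(** * Block-diagonal operators on a tensor product *)

Lemma countable_basis {R : realType} {H : hilbertType R} {I : countType}
    (D : set I) (e : I -> H) : orthonormal_basis D e ->
  has_basis H.
Proof.
move=> be; pose e' n := if choice.unpickle n is Some i then e i else 0.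
have e'E i : e' (choice.pickle i) = e i by rewrite /e' choice.pickleK.
exists (choice.pickle @` D, e'); apply: total_basis => /=.
  move=> _ _ [i Di <-] [j Dj <-]; rewrite !e'E be.1//.
  by rewrite (inj_eq (pcan_inj (@choice.pickleK I))).
move=> x xe; apply: (basis_total be) => i Di.
by rewrite -e'E; apply: xe; exists i.
Qed.

Section tensor_product.
Context {R : realType} {HA HB HAB : hilbertType R} {K : countType}.
Context (t : HA -> HB -> HAB) (tP : hilbert_tensor t).
Context (ket : K -> HB) (ketP : orthonormal_basis [set: K] ket).
Context (E : set nat) (e : nat -> HA) (be : orthonormal_basis E e).

Let okey := ketP.1.

Definition iso k (a : HA) : HAB := t a (ket k).

Lemma tensor_linl b : linear (t^~ b).
Proof. by case: tP. Qed.

Lemma tensor_linr a : linear (t a).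
Proof. by case: tP. Qed.

Lemma tensor_inner a b a' b' : '[t a b, t a' b'] = '[a, a'] * '[b, b'].
Proof. by case: tP. Qed.

Lemma tensor_nrm a b : nrm (t a b) = nrm a * nrm b.
Proof.
apply/eqP; rewrite -(@eqrXn2 _ 2) ?mulr_ge0 ?nrm_ge0//; apply/eqP/complexI.
by rewrite -inner_nrm tensor_inner !inner_nrm -rmorphM exprMn.
Qed.

Lemma tensor_bounded_linr a : bounded_lin (t a).
Proof.
by split; [exact: tensor_linr | exists (nrm a) => b; rewrite tensor_nrm].
Qed.

Lemma ket_inner k j : '[ket k, ket j] = (k == j)%:R.
Proof. exact: okey. Qed.

Lemma iso_lin k : linear (iso k).
Proof. exact: tensor_linl. Qed.

Lemma iso_inner k j a b : '[iso k a, iso j b] = (k == j)%:R * '[a, b].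
Proof. by rewrite tensor_inner ket_inner mulrC. Qed.

Lemma iso_nrm k a : nrm (iso k a) = nrm a.
Proof.
by rewrite tensor_nrm (onb_nrm1 okey) ?mulr1.
Qed.

Lemma iso_bounded k : bounded_lin (iso k).
Proof. by split; [exact: iso_lin | exists 1 => a; rewrite iso_nrm mul1r]. Qed.

Lemma iso_orthonormal k : Defs.orthonormal E (iso k \o e).
Proof. by move=> i j Di Dj /=; rewrite iso_inner eqxx mul1r be.1. Qed.

(** The adjoint of [iso k], that is, the partial inner product with [ket k]; [coiso_inner]
    characterizes it without reference to the basis [e]. *)
Definition coiso k (z : HAB) : HA := hsum E (fun i => '[iso k (e i), z] *: e i).

Lemma coiso_sums_to k z : sums_to E (fun i => '[iso k (e i), z] *: e i) (coiso k z).
Proof.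
have [s hs] := orth_sums_to be.1 (Bessel_fset (@iso_orthonormal k) z).
by rewrite /coiso (hsumE hs).
Qed.

Arguments coiso_sums_to : clear implicits.

Lemma coiso_inner k a z : '[a, coiso k z] = '[iso k a, z].
Proof.
rewrite inner_conj [RHS]inner_conj; congr (_^*).
apply: (eq_sums_to_inner (basis_sums_to be a)
  (bounded_lin_sums_to (iso_bounded k) (basis_sums_to be a))) => i Ei.
rewrite /ketbra (linZ _ _ (iso_lin k)) !innerZr; congr (_ * _).
rewrite inner_conj [RHS]inner_conj; congr (_^*).
exact: (sums_to_coord be.1 (coiso_sums_to k z)).
Qed.

Lemma coiso_innerl k a z : '[coiso k z, a] = '[z, iso k a].
Proof. by rewrite inner_conj coiso_inner -inner_conj. Qed.

Lemma coiso_lin k : linear (coiso k).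
Proof.
move=> c x y; apply: inner_ext => a.
by rewrite innerDr innerZr !coiso_inner innerDr innerZr.
Qed.

Lemma coiso_iso k j a : coiso k (iso j a) = (k == j)%:R *: a.
Proof. by apply: inner_ext => b; rewrite coiso_inner iso_inner innerZr. Qed.

Lemma coiso_isoK k : cancel (iso k) (coiso k).
Proof. by move=> a; rewrite coiso_iso eqxx scale1r. Qed.

Lemma coiso_tensor k a b : coiso k (t a b) = '[ket k, b] *: a.
Proof.
by apply: inner_ext => a'; rewrite coiso_inner tensor_inner innerZr mulrC.
Qed.

Lemma coiso_nrm_le k z : nrm (coiso k z) <= nrm z.
Proof.
have [->|z0] := eqVneq (nrm (coiso k z)) 0; first exact: nrm_ge0.
have z1 : 0 < nrm (coiso k z) by rewrite lt_def z0 nrm_ge0.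
rewrite -(ler_pM2l z1) -expr2.
have := Re_le_nrm '[coiso k z, coiso k z].
rewrite {1}inner_nrm /= ger0_norm ?sqr_ge0// coiso_inner => /le_trans; apply.
by rewrite (le_trans (inner_CS _ _))// iso_nrm.
Qed.

Lemma coiso_Bessel z (F : {fset K}) :
  \sum_(k <- F | k \in [set: K]) nrm (coiso k z) ^+ 2 <= nrm z ^+ 2.
Proof.
pose y := \sum_(k <- F | k \in [set: K]) iso k (coiso k z).
have := sqr_ge0 (nrm (z - y)); rewrite nrm_sqrB.
have -> : nrm y ^+ 2 = \sum_(k <- F | k \in [set: K]) nrm (coiso k z) ^+ 2.
  rewrite nrm_sum_orth ?fset_uniq//; first by apply: eq_bigr => k _; rewrite iso_nrm.
  by move=> i j _ _ ij; rewrite iso_inner (negbTE ij) mul0r.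
rewrite /y inner_sumr Re_sum (eq_bigr (fun k => nrm (coiso k z) ^+ 2)); last first.
  by move=> k _; rewrite inner_conj -coiso_inner inner_nrm ReJ.
by lra.
Qed.

Definition tensor_basis (ik : nat * K) : HAB := iso ik.2 (e ik.1).

(** A vector orthogonal to the family is annihilated by every [coiso k]; expanding [b] in the basis
    [ket] then shows that it is orthogonal to every [t a b]. *)
Lemma tensor_basisP : orthonormal_basis (E `*` [set: K]) tensor_basis.
Proof.
apply: total_basis.
  move=> [i k] [j l] [/= Ei _] [/= Ej _].
  rewrite /tensor_basis iso_inner be.1//= -natrM mulnb.
  by rewrite xpair_eqE andbC.
move=> x xf.
have cx k : coiso k x = 0.
  apply: (basis_total be) => i Ei; rewrite coiso_inner.
  by apply: (xf (i, k)).
case: tP => _ _ _ td; apply: (dense_span_total td) => _ [a _ [b _ <-]].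
rewrite inner_conj; apply/eqP; rewrite conjC_eq0; apply/eqP.
apply: (sums_to_inner0 (bounded_lin_sums_to (tensor_bounded_linr a) (basis_sums_to ketP b))).
move=> k _; rewrite /ketbra (linZ _ _ (tensor_linr a)) innerZr.
by rewrite (inner_conj (iso k a) x) -coiso_inner cx inner0r conjC0 mulr0.
Qed.

Lemma tensor_has_basis : has_basis HAB.
Proof. exact: countable_basis tensor_basisP. Qed.

Lemma tensor_ext (S T : HAB -> HAB) : bounded_op S -> bounded_op T ->
  (forall a b, S (t a b) = T (t a b)) -> S = T.
Proof.
move=> Sb Tb ST; apply/funext => z; apply/eqP; rewrite -subr_eq0.
apply/eqP/nrm0_eq0/eqP; rewrite eq_le nrm_ge0 andbT.
apply/ler_addgt0Pr => d d0; rewrite add0r.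
have STb := bounded_opB Sb Tb; have [M M0 hM] := bounded_pos STb.
case: tP => _ _ _ td; have [y yl zy] := dense_approx z td (divr_gt0 d0 M0).
have STy : (S - T) y = 0.
  case: yl => n [c [v [Av ->]]]; rewrite (lin_sum _ _ _ STb.1) big1// => i _.
  case: (Av i) => a _ [b _ <-].
  by rewrite (linZ _ _ STb.1) subfunE ST subrr scaler0.
rewrite -subfunE -[z](subrK y) (linD _ _ STb.1) STy addr0 (le_trans (hM _))//.
by rewrite mulrC -ler_pdivlMr// ltW.
Qed.

(** The right-hand side meets the specification from which [tensor_op] is chosen, and a bounded
    operator is determined by its values on elementary tensors. *)
Lemma tensor_opE (A : HA -> HA) k z : bounded_op A ->
  tensor_op t A (ketbra (ket k)) z = iso k (A (coiso k z)).
Proof.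
move=> Ab; pose G z := iso k (A (coiso k z)).
have Gb : bounded_op G.
  have [M M0 AM] := bounded_pos Ab.
  apply/bounded_opE; split.
    by move=> c x y; rewrite /G coiso_lin Ab.1 iso_lin.
  exists M => x; rewrite iso_nrm (le_trans (AM _))// ler_pM2l//.
  exact: coiso_nrm_le.
have Gt a b : G (t a b) = t (A a) (ketbra (ket k) b).
  rewrite /G coiso_tensor (linZ _ _ Ab.1) (linZ _ _ (iso_lin k)).
  by rewrite /ketbra (linZ _ _ (tensor_linr _)).
have [Tb Tt] : bounded_op (tensor_op t A (ketbra (ket k))) /\
    forall a b, tensor_op t A (ketbra (ket k)) (t a b) = t (A a) (ketbra (ket k) b).
  by apply: (@xgetPex _ (fun=> 0) [set T | bounded_op T /\ _]); exists G.
by rewrite (tensor_ext Tb Gb)// => a b; rewrite Tt Gt.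
Qed.

Section block_diagonal.
Variables (X : K -> HA -> HA) (M : R).
Hypotheses (M0 : 0 <= M) (Xp : forall k, positive_op (X k)).
Hypothesis XM : forall k x, qform (X k) x <= M * nrm x ^+ 2.

Let XMn k x : nrm (X k x) <= M * nrm x.
Proof. exact: positive_nrm_le. Qed.

Lemma qc_op_sums_to z :
  sums_to [set: K] (fun k => iso k (X k (coiso k z))) (qc_op t ket X z).
Proof.
have [s hs] : exists s, sums_to [set: K] (fun k => iso k (X k (coiso k z))) s.
  apply: sums_to_ex; first by move=> i j _ _ ij; rewrite iso_inner (negbTE ij) mul0r.
  exists (M ^+ 2 * nrm z ^+ 2) => F.
  apply: (@le_trans _ _ (\sum_(k <- F | k \in [set: K]) M ^+ 2 * nrm (coiso k z) ^+ 2)).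
    apply: ler_sum => k _; rewrite iso_nrm -exprMn.
    by rewrite lerXn2r ?nnegrE ?mulr_ge0 ?nrm_ge0.
  by rewrite -mulr_sumr ler_wpM2l ?sqr_ge0// coiso_Bessel.
rewrite [X in sums_to _ _ X](_ : _ = s)//; apply: hsumE.
by apply: (eq_sums_to _ hs) => k _; rewrite tensor_opE//; case: (Xp k).
Qed.

Arguments qc_op_sums_to : clear implicits.

Lemma coiso_qc_op k z : coiso k (qc_op t ket X z) = X k (coiso k z).
Proof.
apply: inner_ext => a; rewrite coiso_inner.
rewrite (@sums_to_inner1 _ _ _ _ _ _ _ k (qc_op_sums_to z))//.
  by rewrite iso_inner eqxx mul1r.
by move=> j _ jk; rewrite iso_inner eq_sym; case: eqP => // _; rewrite mul0r.
Qed.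

Lemma qc_op_nrm_le z : nrm (qc_op t ket X z) <= M * nrm z.
Proof.
rewrite -(@ler_pXn2r _ 2) ?nnegrE ?mulr_ge0 ?nrm_ge0//.
have := sums_to_inner_esum (qc_op_sums_to z) (x := qc_op t ket X z)
  (a := fun k => nrm (X k (coiso k z)) ^+ 2).
rewrite inner_nrm /= -lee_fin => <-.
  apply: esum_le_psum => F; rewrite sumEFin lee_fin exprMn.
  apply: (@le_trans _ _ (\sum_(k <- F | k \in [set: K]) M ^+ 2 * nrm (coiso k z) ^+ 2)).
    apply: ler_sum => k _; rewrite -exprMn.
    by rewrite lerXn2r ?nnegrE ?mulr_ge0 ?nrm_ge0.
  by rewrite -mulr_sumr ler_wpM2l ?sqr_ge0// coiso_Bessel.
move=> k _; split; last exact: sqr_ge0.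
rewrite inner_conj -coiso_inner coiso_qc_op ReJ inner_nrm.
by [].
Qed.

Lemma qc_op_positive : positive_op (qc_op t ket X).
Proof.
have lX k : linear (X k) by exact: positive_lin.
split; last first.
  move=> z; apply: (sums_to_inner_ge0 (qc_op_sums_to z)) => k _.
  by rewrite -coiso_innerl; case: (Xp k) => _; apply.
apply/bounded_opE; split; last by exists M; exact: qc_op_nrm_le.
move=> c x y; apply: (sums_to_uniq (qc_op_sums_to _)).
apply: (eq_sums_to _ (sums_to_lin (qc_op_sums_to x) (qc_op_sums_to y))) => k _.
by rewrite coiso_lin lX iso_lin.
Qed.

Lemma qc_op_trace (hb : has_basis HA) :
  (trace (qc_op t ket X) = \esum_(k in [set: K]) trace (X k))%E.
Proof.
rewrite (basis_trace tensor_has_basis tensor_basisP qc_op_positive).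
have -> : E `*` [set: K] = E `*`` (fun=> [set: K]).
  by apply/seteqP; split=> -[].
rewrite -(esum_esum (a := fun i k => (qform (qc_op t ket X) (iso k (e i)))%:E)); last first.
  by move=> i k _ _; rewrite lee_fin qform_ge0//; exact: qc_op_positive.
rewrite esum_exchange; last first.
  by move=> i k _ _; rewrite lee_fin qform_ge0//; exact: qc_op_positive.
apply: eq_esum => k _; rewrite (basis_trace hb be (Xp k)).
apply: eq_esum => i _; congr (_%:E).
by rewrite /qform -coiso_inner coiso_qc_op coiso_isoK.
Qed.

End block_diagonal.

End tensor_product.

Arguments qc_op_sums_to {R HA HB HAB K t} tP {ket} ketP {E e} be {X M} M0 Xp XM z.

(* The factor [x] makes the term vanish at [x = 0], where [P / x] is [0]. *)
Definition ent_term {R : realType} (P x : R) : R := x * ln (P / x).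

Section entropy_terms.
Context {R : realType}.
Implicit Types P x c : R.

Lemma ent_term0 P : ent_term P 0 = 0.
Proof. by rewrite /ent_term mul0r. Qed.

Lemma ent_term_ge0 P x : 0 <= x <= P -> 0 <= ent_term P x.
Proof.
move=> /andP[]; rewrite le_eqVlt => /orP[/eqP <- _|x0 xP]; first by rewrite ent_term0.
by rewrite /ent_term mulr_ge0 ?(ltW x0)// ln_ge0// ler_pdivlMr// mul1r.
Qed.

Lemma ent_termZ c P x : 0 < c -> ent_term (c * P) (c * x) = c * ent_term P x.
Proof.
move=> c0; rewrite /ent_term -mulrA; congr (_ * (_ * ln _)).
by rewrite -mulf_div divff ?gt_eqF// mul1r.
Qed.

Lemma eta0 : Defs.eta 0 = 0 :> R.
Proof. by rewrite /Defs.eta oppr0 mul0r. Qed.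

(** The upper bound is [ln u <= u - 1] at [u = x^-1]; it supplies the boundedness that
    [fcalc_spectral] asks for. *)
Lemma eta_bound x : 0 <= x <= 1 -> 0 <= Defs.eta x <= 1.
Proof.
move=> /andP[]; rewrite le_eqVlt => /orP[/eqP <- _|x0 x1].
  by rewrite eta0 lexx ler01.
rewrite /Defs.eta mulNr -mulrN -lnV// mulr_ge0/= ?ln_ge0 ?(ltW x0)//; last first.
  by rewrite invf_ge1.
have := @le_ln1Dx R (x^-1 - 1).
rewrite addrCA subrr addr0 ltrBDr addNr invr_gt0 => /(_ x0) h.
have : x * ln x^-1 <= x * (x^-1 - 1) by rewrite ler_pM2l.
rewrite mulrBr divff ?gt_eqF// mulr1; lra.
Qed.

(** This absorbs the weight of a block: the contribution of an eigenvalue of the state is expressed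
    by the eigenvalue [x] of the weighted operator. *)
Lemma eta_ent_term P x : 0 < P -> 0 <= x -> P * Defs.eta (x / P) = ent_term P x.
Proof.
move=> P0; rewrite le_eqVlt => /orP[/eqP <-|x0].
  by rewrite mul0r eta0 mulr0 ent_term0.
rewrite /Defs.eta /ent_term -[P / x]invf_div lnV ?posrE ?divr_gt0//.
by field; rewrite gt_eqF.
Qed.

End entropy_terms.

(** * Conditional entropy in terms of the eigenvalues of the blocks *)

Section scaled_operators.
Context {R : realType} {H : hilbertType R}.
Implicit Types (T : H -> H) (c : R).

Lemma scalefunE (c : R[i]) T x : (c *: T) x = c *: T x.
Proof. by []. Qed.

Lemma qform_scale c T x : qform (c%:C *: T) x = c * qform T x.
Proof. by rewrite /qform scalefunE innerZr ReZ. Qed.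

Lemma positive_scale c T : 0 <= c -> positive_op T -> positive_op (c%:C *: T).
Proof.
move=> c0 Tp; have [M M0 TM] := bounded_pos Tp.1; split; last first.
  by move=> x; rewrite scalefunE innerZr (qformE x Tp) -rmorphM ler0c mulr_ge0 ?qform_ge0.
apply/bounded_opE; split.
  by move=> a x y; rewrite !scalefunE (positive_lin Tp) scalerDr !scalerA mulrC.
exists (c * M) => x; rewrite scalefunE nrmZ nrm_real ger0_norm// -mulrA.
by rewrite ler_wpM2l.
Qed.

Lemma trace_scale (hb : has_basis H) c T :
  0 <= c -> positive_op T -> (trace (c%:C *: T) = c%:E * trace T)%E.
Proof.
move=> c0 Tp; have [E [e [be trE]]] := traceE hb; rewrite !trE.
under eq_esum do rewrite qform_scale EFinM.
by rewrite esumZ// => i _; rewrite lee_fin qform_ge0.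
Qed.

Lemma spectral_rep_scale c T D a phi : spectral_rep T (D, a, phi) ->
  spectral_rep (c%:C *: T) (D, fun i => c * a i, phi).
Proof.
move=> h; split; first exact: h.1.
move=> x; rewrite scalefunE -[c%:C *: T x]addr0.
apply: (eq_sums_to _ (sums_to_lin (h.2 x) (sums_to0 (f := fun=> 0) _))) => // i _.
by rewrite addr0 scalerA -rmorphM.
Qed.

Lemma spectral_rep_le_trace (hb : has_basis H)
    T D a phi m : positive_op T -> (trace T = m%:E) -> spectral_rep T (D, a, phi) ->
  forall i, D i -> 0 <= a i <= m.
Proof.
move=> Tp tm h; apply: (spectral_rep_values Tp _ h) => x.
by apply: (qform_le_trace hb) => //; rewrite tm.
Qed.

Lemma spectral_rep0 T D a phi : (forall x, T x = 0) -> spectral_rep T (D, a, phi) ->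
  forall i, D i -> a i = 0.
Proof.
move=> T0 h i Di; have := spectral_rep_eigen h Di; rewrite T0 => /(congr1 nrm).
by rewrite nrm0 nrmZ (onb_nrm1 h.1 Di) mulr1 nrm_real => /esym/normr0P/eqP.
Qed.

Lemma trace0 (hb : has_basis H) T :
  positive_op T -> (trace T <= 0)%E -> forall x, T x = 0.
Proof.
move=> Tp T0 x; apply: nrm0_eq0; apply/eqP; rewrite eq_le nrm_ge0 andbT.
have := @positive_nrm_le _ _ T 0 (lexx _) Tp _ x; rewrite mul0r; apply.
by move=> y; exact: (qform_le_trace hb).
Qed.

End scaled_operators.

Section state_entropy.
Context {R : realType} {H : hilbertType R}.
Hypothesis hb : has_basis H.

Lemma state_entropy (p : R) (r : H -> H) D x phi : 0 <= p -> state r ->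
  spectral_rep (p%:C *: r) (D, x, phi) ->
  (p%:E * vN_entropy r = \esum_(i in D) (ent_term p (x i))%:E)%E.
Proof.
move=> + [_ rp tr1] h; rewrite le_eqVlt => /orP[/eqP p0|p0].
  (* For [p = 0] the left-hand side is [0] even when the entropy is infinite, and all spectral
     values of the zero operator vanish. *)
  rewrite -p0 mul0e esum1// => i Di; rewrite (spectral_rep0 _ h Di) ?ent_term0//.
  by move=> y; rewrite scalefunE -p0 scale0r.
have hr : spectral_rep r (D, fun i => p^-1 * x i, phi).
  rewrite [r](_ : _ = p^-1%:C *: (p%:C *: r)); first exact: spectral_rep_scale.
  by rewrite scalerA -rmorphM mulVf ?gt_eqF// scale1r.
have val := spectral_rep_le_trace hb rp tr1 hr.
have rm y : qform r y <= 1 * nrm y ^+ 2 by apply: (qform_le_trace hb) => //; rewrite tr1.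
have eb (s : R) : 0 <= s <= 1 -> `|Defs.eta s| <= 1.
  by move=> /eta_bound/andP[s0 s1]; rewrite ger0_norm.
have he := fcalc_spectral rp rm eb eta0 hr.
have vge i : D i -> 0 <= (Defs.eta \o (fun i => p^-1 * x i)) i.
  by move=> /val/eta_bound/andP[].
rewrite /vN_entropy (trace_spectral hb he vge) -esumZ ?(ltW p0)//.
apply: eq_esum => i Di; rewrite -EFinM /= [_^-1 * _]mulrC eta_ent_term//.
by have /andP[] := val i Di; rewrite pmulr_rge0// invr_gt0.
Qed.

End state_entropy.

Section qc_entropy.
Context {R : realType} {HA HB HAB : hilbertType R} {K : countType}.
Context (t : HA -> HB -> HAB) (tP : hilbert_tensor t).
Context (ket : K -> HB) (ketP : orthonormal_basis [set: K] ket).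
Hypothesis hbA : has_basis HA.

Lemma ensemble_le1 (p : K -> R) (r : K -> HA -> HA) k : ensemble p r -> p k <= 1.
Proof.
move=> [p0 p1 _]; rewrite -lee_fin -p1.
apply: le_trans (psum_le_esum _ _ [fset k]%fset).
by rewrite big_mkcond big_seq_fset1 mem_set.
Qed.

Lemma weighted_positive (p : K -> R) (r : K -> HA -> HA) k : ensemble p r ->
  positive_op (weighted p r k).
Proof. by move=> [p0 _ st]; apply: positive_scale => //; case: (st k). Qed.

Lemma weighted_trace (p : K -> R) (r : K -> HA -> HA) k : ensemble p r ->
  trace (weighted p r k) = (p k)%:E.
Proof.
move=> [p0 _ st]; have [_ rp tr1] := st k.
by rewrite (trace_scale hbA)// tr1 mule1.
Qed.

Lemma weighted_le (p : K -> R) (r : K -> HA -> HA) k x : ensemble p r ->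
  qform (weighted p r k) x <= 1 * nrm x ^+ 2.
Proof.
move=> er; apply: (qform_le_trace hbA); first exact: weighted_positive.
by rewrite weighted_trace// lee_fin; exact: ensemble_le1 er.
Qed.

Lemma qc_op_inj (X Y : K -> HA -> HA) M : 0 <= M ->
  (forall k, positive_op (X k)) -> (forall k x, qform (X k) x <= M * nrm x ^+ 2) ->
  (forall k, positive_op (Y k)) -> (forall k x, qform (Y k) x <= M * nrm x ^+ 2) ->
  qc_op t ket X = qc_op t ket Y -> X = Y.
Proof.
move=> M0 Xp XM Yp YM XY; have [[E e] /= be] := hbA.
apply/funext => k; apply/funext => a.
rewrite -[in LHS](coiso_isoK tP ketP be k a) -[in RHS](coiso_isoK tP ketP be k a).
rewrite -(coiso_qc_op tP ketP be M0 Xp XM) XY.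
by rewrite (coiso_qc_op tP ketP be M0 Yp YM).
Qed.

(** Independence of the chosen ensemble: the operator determines its blocks, and their traces
    determine the probabilities. The state [r k] is undetermined where [p k = 0], which is why the
    formula uses the weighted blocks. *)
Lemma cond_entropy_ensemble (p : K -> R) (r : K -> HA -> HA)
    (D : K -> set nat) (x : K -> nat -> R) (phi : K -> nat -> HA) :
  ensemble p r -> (forall k, spectral_rep (weighted p r k) (D k, x k, phi k)) ->
  (cond_entropy t ket (qc_op t ket (weighted p r)) =
   \esum_(k in [set: K]) \esum_(i in D k) (ent_term (p k) (x k i))%:E)%E.
Proof.
move=> er h; rewrite /cond_entropy.
have := @xgetPex _ (fun=> 0, fun=> fun=> 0)
  (qc_rep t ket (qc_op t ket (weighted p r))) (ex_intro _ (p, r) (conj er erefl)).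
case: (xget _ _) => p' r' [/= er' E].
have W : weighted p r = weighted p' r'.
  apply: qc_op_inj E => //.
  - by move=> k; exact: weighted_positive.
  - by move=> k y; exact: weighted_le.
  - by move=> k; exact: weighted_positive.
  - by move=> k y; exact: weighted_le.
have pp k : p k = p' k.
  have := weighted_trace k er; rewrite W weighted_trace//.
  by move=> [].
have [p'0 _ st'] := er'.
apply: eq_esum => k _; rewrite pp.
have hk : spectral_rep ((p' k)%:C *: r' k) (D k, x k, phi k).
  by rewrite -[_ *: _]/(weighted p' r' k) -W.
exact: (state_entropy hbA (p'0 k) (st' k) hk).
Qed.

Variables (r0 : HA -> HA) (st0 : state r0).

(** The normalization by the total trace [tau] cancels because [ent_term] is homogeneous of degree
    one in its two arguments jointly. *)
Lemma cond_entropy_cone_blocks (X : K -> HA -> HA) (tr : K -> R)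
    (D : K -> set nat) (x : K -> nat -> R) (phi : K -> nat -> HA) :
  (forall k, positive_op (X k)) -> (forall k, trace (X k) = (tr k)%:E) ->
  (forall k, spectral_rep (X k) (D k, x k, phi k)) ->
  (\esum_(k in [set: K]) (tr k)%:E < +oo)%E ->
  (cond_entropy_cone t ket (qc_op t ket X) =
   \esum_(k in [set: K]) \esum_(i in D k) (ent_term (tr k) (x k i))%:E)%E.
Proof.
move=> Xp Xtr h trfin.
have tr0 k : 0 <= tr k by rewrite -lee_fin -Xtr trace_ge0.
have trs0 : (0 <= \esum_(k in [set: K]) (tr k)%:E)%E.
  by apply: esum_ge0 => k _; rewrite lee_fin.
have [tau trE] : exists tau, (\esum_(k in [set: K]) (tr k)%:E = tau%:E)%E.
  by exists (fine (\esum_(k in [set: K]) (tr k)%:E)); rewrite fineK// ge0_fin_numE.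
have tau0 : 0 <= tau by rewrite -lee_fin -trE.
have tr_tau k : tr k <= tau.
  rewrite -lee_fin -trE; apply: le_trans (psum_le_esum _ _ [fset k]%fset).
  by rewrite big_mkcond big_seq_fset1 mem_set.
have XM k y : qform (X k) y <= tau * nrm y ^+ 2.
  by apply: (qform_le_trace hbA) => //; rewrite Xtr lee_fin.
have [[E e] /= be] := hbA.
have sp := qc_op_positive tP ketP be tau0 Xp XM.
have str : trace (qc_op t ket X) = tau%:E.
  by rewrite (qc_op_trace tP ketP be tau0 Xp XM hbA) -trE; apply: eq_esum => k _.
rewrite /cond_entropy_cone; case: asboolP => s0.
  rewrite esum1// => k _; rewrite esum1// => i Di.
  rewrite (spectral_rep0 _ (h k) Di) ?ent_term0// => a.
  rewrite -[a in LHS](coiso_isoK tP ketP be k a).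
  rewrite -(coiso_qc_op tP ketP be tau0 Xp XM) s0.
  by rewrite (lin0 (coiso_lin tP ketP be k)).
have tau_gt0 : 0 < tau.
  rewrite lt_def tau0 andbT; apply/eqP => t0; apply: s0; apply/funext => z.
  apply: (trace0 (tensor_has_basis tP ketP be) sp).
  by rewrite str t0.
have val k := spectral_rep_le_trace hbA (Xp k) (Xtr k) (h k).
have hge k i : D k i -> 0 <= ent_term (tr k) (x k i).
  by move=> /val; exact: ent_term_ge0.
rewrite str /=.
pose p k := tau^-1 * tr k.
(* A block of trace zero cannot be normalized; its weight is [0], so any state can stand in for
   it. *)
pose r k := if tr k == 0 then r0 else (tr k)^-1%:C *: X k.
have W : weighted p r = fun k => tau^-1%:C *: X k.
  apply/funext => k; rewrite /weighted /p /r; case: eqP => [trk0|/eqP trk0].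
    apply/funext => a; rewrite trk0 mulr0 !scalefunE scale0r.
    by rewrite (trace0 hbA (Xp k)) ?scaler0// Xtr trk0.
  by rewrite scalerA -rmorphM mulfK.
have er : ensemble p r.
  split.
  - by move=> k; rewrite mulr_ge0 ?invr_ge0.
  - under eq_esum do rewrite EFinM.
    rewrite esumZ ?invr_ge0//; last by move=> k _; rewrite lee_fin.
    by rewrite trE -EFinM mulVf// gt_eqF.
  move=> k; rewrite /r; case: eqP => // /eqP trk0.
  have rp : positive_op ((tr k)^-1%:C *: X k) by apply: positive_scale; rewrite ?invr_ge0.
  have rt : trace ((tr k)^-1%:C *: X k) = 1%E.
    by rewrite (trace_scale hbA) ?invr_ge0// Xtr -EFinM mulVf.
  split => //; split; first exact: rp.1.
  by rewrite (trace_norm_positive hbA rp) rt ltry.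
have sW : tau^-1%:C *: qc_op t ket X = qc_op t ket (weighted p r).
  apply/funext => z; rewrite scalefunE W.
  have sXp k : positive_op (tau^-1%:C *: X k) by apply: positive_scale; rewrite ?invr_ge0.
  have sXM k y : qform (tau^-1%:C *: X k) y <= 1 * nrm y ^+ 2.
    rewrite qform_scale mulrC ler_pdivrMr// mul1r mulrC.
    exact: XM.
  apply/esym; apply: (sums_to_uniq (qc_op_sums_to tP ketP be ler01 sXp sXM z)).
  rewrite -[_ *: _]addr0.
  apply: (eq_sums_to _ (sums_to_lin (qc_op_sums_to tP ketP be tau0 Xp XM z)
    (sums_to0 (f := fun=> 0) _))) => // k _.
  by rewrite addr0 scalefunE (linZ _ _ (iso_lin tP ket k)).
rewrite sW (cond_entropy_ensemble er (x := fun k i => tau^-1 * x k i) (D := D) (phi := phi)); last first.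
  by move=> k; rewrite W; exact: spectral_rep_scale.
rewrite -esumZ ?(ltW tau_gt0)//; last first.
  move=> k _; apply: esum_ge0 => i Di; rewrite lee_fin ent_termZ ?invr_gt0//.
  by rewrite mulr_ge0 ?invr_ge0// hge.
apply: eq_esum => k _.
rewrite -esumZ ?(ltW tau_gt0)//; last first.
  move=> i Di; rewrite lee_fin ent_termZ ?invr_gt0//.
  by rewrite mulr_ge0 ?invr_ge0// hge.
apply: eq_esum => i Di; rewrite ent_termZ ?invr_gt0//.
by rewrite -EFinM mulrA divff ?mul1r// gt_eqF.
Qed.

End qc_entropy.

(** * Conditional entropy of nonnegative arrays *)

Section rows.
Context {R : realType} {I : choiceType}.
Implicit Types (x y z w d m : I -> R) (X Y Z D M : R).

Definition row_total x X :=
  (forall i, 0 <= x i) /\ (\esum_(i in [set: I]) (x i)%:E = X%:E)%E.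

Lemma row_total_ge0 x X : row_total x X -> 0 <= X.
Proof. by move=> [x0 xX]; rewrite -lee_fin -xX esum_ge0// => i _; rewrite lee_fin. Qed.

Lemma row_total_le x X i : row_total x X -> x i <= X.
Proof.
move=> [x0 xX]; rewrite -lee_fin -xX.
apply: le_trans (psum_le_esum _ _ [fset i]%fset).
by rewrite big_mkcond big_seq_fset1 mem_set.
Qed.

Lemma row_ent_ge0 x X i : row_total x X -> 0 <= ent_term X (x i).
Proof. by move=> hx; rewrite ent_term_ge0// (row_total_le _ hx) hx.1. Qed.

Lemma row_totalD x y X Y : row_total x X -> row_total y Y ->
  row_total (fun i => x i + y i) (X + Y).
Proof.
move=> [x0 xX] [y0 yY]; split; first by move=> i; rewrite addr_ge0.
by under eq_esum do rewrite EFinD; rewrite esumD ?xX ?yY// => i _; rewrite lee_fin.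
Qed.

Lemma row_totalB x y X Y : row_total x X -> row_total y Y ->
  (forall i, x i <= y i) -> row_total (fun i => y i - x i) (Y - X).
Proof.
move=> [x0 xX] [y0 yY] xy; split; first by move=> i; rewrite subr_ge0.
have : (\esum_(i in [set: I]) (y i - x i)%:E + X%:E = Y%:E)%E.
  rewrite -xX -yY -esumD; last 2 first.
  - by move=> i _; rewrite lee_fin subr_ge0.
  - by move=> i _; rewrite lee_fin.
  by apply: eq_esum => i _; rewrite -EFinD subrK.
by case: (\esum_(i in _) _)%E => //= a [] <-; rewrite addrK.
Qed.

Lemma row_total_dom x y Y : (forall i, 0 <= x i <= y i) -> row_total y Y ->
  exists2 X, row_total x X & X <= Y.
Proof.
move=> xy [y0 yY]; have x0 i : 0 <= x i by case/andP: (xy i).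
have xle : (\esum_(i in [set: I]) (x i)%:E <= Y%:E)%E.
  by rewrite -yY; apply: le_esum => i _; rewrite lee_fin; case/andP: (xy i).
have xge : (0 <= \esum_(i in [set: I]) (x i)%:E)%E.
  by apply: esum_ge0 => i _; rewrite lee_fin.
exists (fine (\esum_(i in [set: I]) (x i)%:E)).
  by split=> //; rewrite fineK// ge0_fin_numE// (le_lt_trans xle)// ltry.
by rewrite -lee_fin fineK// ge0_fin_numE// (le_lt_trans xle)// ltry.
Qed.

Lemma row_total_unique x X X' : row_total x X -> row_total x X' -> X = X'.
Proof. by move=> [_ h] [_]; rewrite h => -[]. Qed.

Lemma ln_le_sub1 (u : R) : 0 < u -> ln u <= u - 1.
Proof.
move=> u0; have := @le_ln1Dx R (u - 1).
by rewrite (addrC 1) subrK ltrBDr addNr; apply.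
Qed.

(* Gibbs' inequality, in the form of a termwise comparison whose linear
   remainder [X * (m / M) - x] has total [0]. *)
Lemma ent_term_gibbs X M (x m : R) : 0 <= x <= X -> x <= m <= M -> 0 < M ->
  ent_term X x + x <= x * ln (M / m) + X * (m / M).
Proof.
move=> /andP[]; rewrite le_eqVlt => /orP[/eqP <- X0 /andP[m0 mM] M0|x0 xX /andP[xm mM] M0].
  by rewrite ent_term0 mul0r !add0r mulr_ge0// divr_ge0// ltW.
have X0 := lt_le_trans x0 xX; have m0 := lt_le_trans x0 xm.
have h := @ln_le_sub1 ((X * m) / (M * x)).
have u0 : 0 < (X * m) / (M * x) by rewrite divr_gt0 ?mulr_gt0.
have E : ln (X / x) = ln (M / m) + ln ((X * m) / (M * x)).
  rewrite -lnM ?posrE ?divr_gt0 ?mulr_gt0//; congr ln.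
  by field; rewrite !gt_eqF.
rewrite /ent_term E mulrDr -addrA lerD2l.
have : x * ln ((X * m) / (M * x)) <= x * ((X * m) / (M * x) - 1) by rewrite ler_pM2l// h.
have -> : x * ((X * m) / (M * x) - 1) = X * (m / M) - x.
  by field; rewrite !gt_eqF.
by rewrite lerBrDr.
Qed.

(** The entropy of [x] is at most its cross entropy relative to the distribution [m / M]. Domination
    by [m] forces [x i = 0] wherever [m i = 0], so that every term on the right is nonnegative. *)
Lemma row_gibbs x m X M : row_total x X -> row_total m M ->
  (forall i, x i <= m i) ->
  (\esum_(i in [set: I]) (ent_term X (x i))%:E <=
   \esum_(i in [set: I]) (x i * ln (M / m i))%:E)%E.
Proof.
move=> hx hm xm; have M_ge0 := row_total_ge0 hm.
have X_ge0 := row_total_ge0 hx.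
have l0 i : 0 <= x i * ln (M / m i).
  have := hm.1 i; rewrite le_eqVlt => /orP[/eqP mi0|mi0].
    by have := xm i; rewrite -mi0 => /(conj (hx.1 i))/andP/le_anti <-; rewrite mul0r.
  by rewrite mulr_ge0 ?hx.1// ln_ge0// ler_pdivlMr// mul1r (row_total_le _ hm).
move: M_ge0; rewrite le_eqVlt => /orP[/eqP M0|M0].
  apply: le_esum => i _; suff -> : x i = 0 by rewrite ent_term0 mul0r.
  apply/le_anti; rewrite hx.1 andbT (le_trans (xm i))//.
  by rewrite M0 (row_total_le _ hm).
(* The finite number [X] is added to both sides, written as the sum of [x] on the left and as that
   of [X / M * m] on the right; the termwise inequality then applies. *)
rewrite -(@leeD2rE _ X%:E)//; rewrite -{1}hx.2 -esumD; last 2 first.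
- by move=> i _; rewrite lee_fin row_ent_ge0.
- by move=> i _; rewrite lee_fin hx.1.
have -> : X%:E = (\esum_(i in [set: I]) (X / M * m i)%:E)%E.
  under eq_esum do rewrite EFinM.
  rewrite esumZ ?divr_ge0 ?(ltW M0)//; last by move=> i _; rewrite lee_fin hm.1.
  by rewrite hm.2 -EFinM divfK// gt_eqF.
rewrite -esumD; last 2 first.
- by move=> i _; rewrite lee_fin.
- by move=> i _; rewrite lee_fin mulr_ge0 ?divr_ge0 ?hm.1// ltW.
apply: le_esum => i _; rewrite -!EFinD lee_fin.
rewrite (_ : X / M * m i = X * (m i / M)); last by rewrite mulrAC mulrA.
apply: ent_term_gibbs => //; first by rewrite hx.1 (row_total_le _ hx).
by rewrite xm (row_total_le _ hm).
Qed.

(** Both rows are compared with the same distribution, that of [z + w]; the two cross entropies add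
    up exactly to the entropy of the sum. *)
Lemma row_superadditive z w Z W : row_total z Z -> row_total w W ->
  (\esum_(i in [set: I]) (ent_term Z (z i))%:E +
   \esum_(i in [set: I]) (ent_term W (w i))%:E <=
   \esum_(i in [set: I]) (ent_term (Z + W) (z i + w i))%:E)%E.
Proof.
move=> hz hw; have hm := row_totalD hz hw.
have l0 i : 0 <= ln ((Z + W) / (z i + w i)).
  have := hm.1 i; rewrite le_eqVlt => /orP[/eqP <-|mi0].
    by rewrite invr0 mulr0 ln0.
  by rewrite ln_ge0// ler_pdivlMr// mul1r (row_total_le _ hm).
apply: le_trans (leeD (row_gibbs hz hm _) (row_gibbs hw hm _)) _.
- by move=> i; rewrite lerDl hw.1.
- by move=> i; rewrite lerDr hz.1.
rewrite -esumD; last 2 first.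
- by move=> i _; rewrite lee_fin mulr_ge0 ?hz.1.
- by move=> i _; rewrite lee_fin mulr_ge0 ?hw.1.
by apply: le_esum => i _; rewrite -EFinD lee_fin -mulrDl.
Qed.

(** In [u * ln ((P + Q) / (u + v))], dropping [v] from the denominator increases the value, and the
    quotient then factors as [P / u] times [(P + Q) / P]. *)
Lemma ent_term_sum_le Y D (y d : R) : 0 <= y <= Y -> 0 <= d <= D ->
  ent_term (Y + D) (y + d) <=
  ent_term Y y + ent_term D d + (y * ln ((Y + D) / Y) + d * ln ((Y + D) / D)).
Proof.
have half (P Q u v : R) : 0 <= u <= P -> 0 <= v -> 0 <= Q ->
    u * ln ((P + Q) / (u + v)) <= ent_term P u + u * ln ((P + Q) / P).
  move=> /andP[]; rewrite le_eqVlt => /orP[/eqP <- *|u0 uP v0 Q0].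
    by rewrite ent_term0 !mul0r addr0.
  have P0 := lt_le_trans u0 uP.
  rewrite /ent_term -mulrDr ler_pM2l// -lnM ?posrE ?divr_gt0 ?ltr_wpDr//.
  rewrite (_ : P / u * ((P + Q) / P) = (P + Q) / u); last by field; rewrite !gt_eqF.
  rewrite ler_ln ?posrE ?divr_gt0 ?ltr_wpDr// ler_pM2l ?ltr_wpDr//.
  by rewrite lef_pV2 ?posrE ?ltr_wpDr// lerDl.
move=> hy hd; have /andP[y0 yY] := hy; have /andP[d0 dD] := hd.
rewrite [leLHS]/ent_term (mulrDl y d) addrACA.
have h1 := half Y D y d hy d0 (le_trans d0 dD).
have h2 := half D Y d y hd y0 (le_trans y0 yY).
by rewrite [D + Y]addrC [d + y]addrC in h2; exact: lerD.
Qed.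

(** Gibbs' inequality for the pair [Y], [D] against the fixed weights [1], [e]. The bound is linear
    in [Y] and [D], so it can be summed over rows. The remainders in [half] cancel since the two
    weights divided by [1 + e] add up to [1]. *)
Lemma two_point_gibbs Y D (e : R) : 0 <= Y -> 0 <= D -> 0 < e ->
  Y * ln ((Y + D) / Y) + D * ln ((Y + D) / D) <=
  Y * ln (1 + e) + D * ln ((1 + e) / e).
Proof.
move=> Y0 D0 e0; have e1 : 0 < 1 + e by rewrite addr_gt0.
have half (P Q c : R) : 0 <= P -> 0 <= Q -> 0 < c ->
    P * ln ((P + Q) / P) <= P * ln c + ((P + Q) / c - P).
  rewrite le_eqVlt => /orP[/eqP <- Q0 c0|P0 Q0 c0].
    by rewrite !mul0r !add0r subr0 divr_ge0// ltW.
  have PQ : 0 < P + Q by rewrite ltr_wpDr.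
  have -> : ln ((P + Q) / P) = ln c + ln ((P + Q) / (c * P)).
    rewrite -lnM ?posrE ?divr_gt0 ?mulr_gt0//; congr ln.
    by field; rewrite !gt_eqF.
  rewrite mulrDr lerD2l.
  have -> : (P + Q) / c - P = P * ((P + Q) / (c * P) - 1).
    by field; rewrite !gt_eqF.
  by rewrite ler_pM2l// ln_le_sub1// divr_gt0// mulr_gt0.
have h1 := half Y D (1 + e) Y0 D0 e1.
have h2 := half D Y ((1 + e) / e) D0 Y0 (divr_gt0 e1 e0).
rewrite [D + Y]addrC in h2.
have : (Y + D) / (1 + e) + (Y + D) / ((1 + e) / e) = Y + D.
  by field; rewrite !gt_eqF.
by move: h1 h2; lra.
Qed.

Lemma row_sum_le y d Y D (e : R) : row_total y Y -> row_total d D -> 0 < e ->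
  (\esum_(i in [set: I]) (ent_term (Y + D) (y i + d i))%:E <=
   \esum_(i in [set: I]) (ent_term Y (y i))%:E +
   \esum_(i in [set: I]) (ent_term D (d i))%:E +
   (Y * ln (1 + e) + D * ln ((1 + e) / e))%:E)%E.
Proof.
move=> hy hd e0; have Y0 := row_total_ge0 hy; have D0 := row_total_ge0 hd.
have lge (P Q : R) : 0 <= P -> 0 <= Q -> 0 <= ln ((P + Q) / P).
  rewrite le_eqVlt => /orP[/eqP <- _|P0 Q0]; first by rewrite invr0 mulr0 ln0.
  by rewrite ln_ge0// ler_pdivlMr// mul1r lerDl.
have lY := lge _ _ Y0 D0; have lD := lge _ _ D0 Y0; rewrite [D + Y]addrC in lD.
apply: (@le_trans _ _ (\esum_(i in [set: I]) ((ent_term Y (y i))%:E +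
   (ent_term D (d i))%:E + (ln ((Y + D) / Y))%:E * (y i)%:E +
   (ln ((Y + D) / D))%:E * (d i)%:E))%E).
  apply: le_esum => i _; rewrite -!EFinM -!EFinD lee_fin.
  have := @ent_term_sum_le Y D (y i) (d i).
  rewrite hy.1 hd.1 (row_total_le _ hy) (row_total_le _ hd) => /(_ isT isT).
  by rewrite -!addrA ![ln _ * _]mulrC.
have eY i : (0 <= (ent_term Y (y i))%:E)%E by rewrite lee_fin row_ent_ge0.
have eD i : (0 <= (ent_term D (d i))%:E)%E by rewrite lee_fin row_ent_ge0.
have y0 i : (0 <= (y i)%:E)%E by rewrite lee_fin hy.1.
have d0 i : (0 <= (d i)%:E)%E by rewrite lee_fin hd.1.
rewrite esumD; last 2 first.
- by move=> i _; rewrite !adde_ge0// mule_ge0.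
- by move=> i _; rewrite mule_ge0.
rewrite esumD; last 2 first.
- by move=> i _; rewrite !adde_ge0.
- by move=> i _; rewrite mule_ge0.
rewrite esumD// !esumZ// hy.2 hd.2 -addeA leeD2l// -!EFinM -EFinD lee_fin.
by rewrite ![ln ((Y + D) / _) * _]mulrC; exact: two_point_gibbs.
Qed.

End rows.

Section arrays.
Context {R : realType} {K I : choiceType}.
Implicit Types (x y z w d m : K -> I -> R) (X Y Z D M : K -> R).

Definition array_ent X x : \bar R :=
  (\esum_(k in [set: K]) \esum_(i in [set: I]) (ent_term (X k) (x k i))%:E)%E.

Definition array_total x X := forall k, row_total (x k) (X k).

Lemma array_ent_ge0 x X : array_total x X -> (0 <= array_ent X x)%E.
Proof.
move=> hx; apply: esum_ge0 => k _; apply: esum_ge0 => i _.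
by rewrite lee_fin (row_ent_ge0 _ (hx k)).
Qed.

Lemma array_superadditive z w Z W : array_total z Z -> array_total w W ->
  (array_ent Z z + array_ent W w <=
   array_ent (fun k => (Z k + W k)%R) (fun k i => (z k i + w k i)%R))%E.
Proof.
move=> hz hw; rewrite /array_ent -esumD; last 2 first.
- by move=> k _; apply: esum_ge0 => i _; rewrite lee_fin (row_ent_ge0 _ (hz k)).
- by move=> k _; apply: esum_ge0 => i _; rewrite lee_fin (row_ent_ge0 _ (hw k)).
by apply: le_esum => k _; exact: row_superadditive.
Qed.

Lemma array_ent_split x y X Y : array_total x X -> array_total y Y ->
  (forall k i, x k i <= y k i) ->
  (array_ent X x + array_ent (fun k => (Y k - X k)%R) (fun k i => (y k i - x k i)%R) <=
   array_ent Y y)%E.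
Proof.
move=> hx hy xy.
have hd : array_total (fun k i => y k i - x k i) (fun k => Y k - X k).
  by move=> k; exact: row_totalB.
apply: (le_trans (array_superadditive hx hd)); rewrite le_eqVlt; apply/orP; left.
apply/eqP; apply: eq_esum => k _; apply: eq_esum => i _.
by rewrite (addrC (X k)) subrK (addrC (x k i)) subrK.
Qed.

(** This is not termwise, because [ent_term X] is not monotone; it follows from superadditivity, the
    difference array having nonnegative entropy. *)
Lemma array_ent_mono x y X Y : array_total x X -> array_total y Y ->
  (forall k i, x k i <= y k i) -> (array_ent X x <= array_ent Y y)%E.
Proof.
move=> hx hy xy; apply: le_trans (array_ent_split hx hy xy).
rewrite leeDl// array_ent_ge0// => k; exact: row_totalB.
Qed.

(** The linear bounds of the rows add up to at most [ln (1 + e) + e * ln ((1 + e) / e)], which is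
    [g e]. *)
Lemma array_sum_le y d Y D (e : R) : array_total y Y -> array_total d D -> 0 < e ->
  (\esum_(k in [set: K]) (Y k)%:E = 1)%E ->
  (\esum_(k in [set: K]) (D k)%:E <= e%:E)%E ->
  (array_ent (fun k => (Y k + D k)%R) (fun k i => (y k i + d k i)%R) <=
   array_ent Y y + array_ent D d + (g e)%:E)%E.
Proof.
move=> hy hd e0 Y1 De; have Y0 k := row_total_ge0 (hy k); have D0 k := row_total_ge0 (hd k).
have l1 : 0 <= ln (1 + e) by rewrite ln_ge0// lerDl ltW.
have l2 : 0 <= ln ((1 + e) / e) by rewrite ln_ge0// ler_pdivlMr// mul1r lerDr.
have gE : g e = ln (1 + e) + ln ((1 + e) / e) * e.
  rewrite /g gt_eqF// ln_div ?posrE ?addr_gt0// [e + 1]addrC; ring.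
have sy k : (0 <= \esum_(i in [set: I]) (ent_term (Y k) (y k i))%:E)%E.
  by apply: esum_ge0 => i _; rewrite lee_fin (row_ent_ge0 _ (hy k)).
have sd k : (0 <= \esum_(i in [set: I]) (ent_term (D k) (d k i))%:E)%E.
  by apply: esum_ge0 => i _; rewrite lee_fin (row_ent_ge0 _ (hd k)).
apply: (@le_trans _ _ (\esum_(k in [set: K])
   (\esum_(i in [set: I]) (ent_term (Y k) (y k i))%:E +
    \esum_(i in [set: I]) (ent_term (D k) (d k i))%:E +
    ((ln (1 + e))%:E * (Y k)%:E + (ln ((1 + e) / e))%:E * (D k)%:E)))%E).
  apply: le_esum => k _; rewrite -!EFinM -EFinD ![ln _ * _]mulrC.
  exact: row_sum_le.
have lY k : (0 <= (ln (1 + e))%:E * (Y k)%:E)%E by rewrite -EFinM lee_fin mulr_ge0.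
have lD k : (0 <= (ln ((1 + e) / e))%:E * (D k)%:E)%E by rewrite -EFinM lee_fin mulr_ge0.
rewrite esumD; last 2 first.
- by move=> k _; rewrite adde_ge0.
- by move=> k _; rewrite adde_ge0.
rewrite esumD// leeD2l// esumD// !esumZ//; last 2 first.
- by move=> k _; rewrite lee_fin.
- by move=> k _; rewrite lee_fin.
rewrite Y1 mule1 gE EFinD leeD2l// EFinM.
exact: lee_wpmul2l.
Qed.

End arrays.

(** * Limits as the parameter tends to zero *)

Section limits.
Context {R : realType}.

Lemma cvg_sum_seq (T : Type) (s : seq T) (f : T -> R -> R) (l : T -> R) (F : set_system R)
    {FF : Filter F} : (forall i, f i e @[e --> F] --> l i) ->
  (\sum_(i <- s) f i e) @[e --> F] --> \sum_(i <- s) l i.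
Proof.
move=> h; elim: s => [|i s IH].
  by rewrite big_nil; under eq_fun do rewrite big_nil; exact: cvg_cst.
by rewrite big_cons; under eq_fun do rewrite big_cons; exact: cvgD.
Qed.

(** A criterion that treats a finite limit and the limit [+oo] alike. *)
Lemma lower_cvg (f : R -> \bar R) (l : \bar R) (F : set_system R) {FF : Filter F} :
  (-oo < l)%E -> (\forall e \near F, (f e <= l)%E) ->
  (forall a : R, (a%:E < l)%E -> \forall e \near F, (a%:E < f e)%E) ->
  f e @[e --> F] --> l.
Proof.
case: l => [l _|_|//] fl af; last first.
  by apply/cvgeyPgt => a; apply: af; exact: ltry.
apply/fine_cvgP; split.
  have := af (l - 1); rewrite lte_fin ltrBlDr ltrDl ltr01 => /(_ isT).
  apply: filterS2 fl => e h1 h2.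
  by rewrite fin_numElt (lt_trans _ h2) ?ltNyr// (le_lt_trans h1)// ltry.
apply/cvgrPdist_lt => eta eta0.
have := af (l - eta); rewrite lte_fin ltrBlDr ltrDl => /(_ eta0).
apply: filterS2 fl => e h1 h2 /=.
have ff : f e \is a fin_num.
  by rewrite fin_numElt (lt_trans _ h2) ?ltNyr// (le_lt_trans h1)// ltry.
rewrite -(fineK ff) lee_fin lte_fin in h1 h2.
by rewrite ger0_norm ?subr_ge0//; move: h2; lra.
Qed.

Lemma g_ge0 (e : R) : 0 < e -> 0 <= g e.
Proof.
move=> e0; rewrite /g gt_eqF//.
have l1 : 0 <= ln (e + 1) by rewrite ln_ge0// lerDr ltW.
have : e * ln e <= e * ln (e + 1).
  by rewrite ler_pM2l// ler_ln ?posrE ?addr_gt0// lerDl.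
by lra.
Qed.

(** With [e = s * s], the bound [ln s^-1 <= s^-1 - 1] gives [- (e * ln e) <= 2 * s]; the other term
    is at most [2 * e], hence at most [2 * s]. *)
Lemma g_le (e : R) : 0 < e -> e < 1 -> g e <= 4 * Num.sqrt e.
Proof.
move=> e0 e1; rewrite /g gt_eqF//; set s := Num.sqrt e.
have s0 : 0 < s by rewrite sqrtr_gt0.
have se : e = s * s by rewrite -expr2 sqr_sqrtr// ltW.
have s1 : s < 1 by rewrite -sqrtr1 ltr_sqrt.
have ss : s * s <= s by rewrite ger_pMl// ltW.
have h1 : (e + 1) * ln (e + 1) <= 2 * e.
  apply: (@le_trans _ _ ((e + 1) * e)); last by rewrite ler_pM2r//; lra.
  by rewrite ler_pM2l ?addr_gt0// [e + 1]addrC le_ln1Dx//; lra.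
have h2 : - ln s <= s^-1 - 1 by rewrite -lnV// ln_le_sub1// invr_gt0.
have h3 : - (e * ln e) <= 2 * s.
  rewrite {2}se lnM// {1}se.
  have : s * s * - ln s <= s * s * (s^-1 - 1) by rewrite ler_pM2l// mulr_gt0.
  have -> : s * s * (s^-1 - 1) = s - s * s by field; rewrite gt_eqF.
  have : 0 < s * s by rewrite mulr_gt0.
  by lra.
by move: h1 h3; rewrite se; lra.
Qed.

Lemma g_cvg0 : (g e) @[e --> (0 : R)^'+] --> (0 : R).
Proof.
apply/cvgrPdist_lt => eta eta0; near=> e.
have e0 : 0 < e by near: e; exact: nbhs_right_gt.
have e1 : e < 1 by near: e; exact: nbhs_right_lt.
have e2 : e < (eta / 4) ^+ 2 by near: e; apply: nbhs_right_lt; rewrite exprn_gt0// divr_gt0.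
rewrite sub0r normrN ger0_norm ?g_ge0// (le_lt_trans (g_le e0 e1))//.
have : Num.sqrt e < eta / 4.
  by rewrite -[ltRHS]gtr0_norm ?divr_gt0// -sqrtr_sqr ltr_sqrt// exprn_gt0// divr_gt0.
by lra.
Unshelve. all: by end_near. Qed.

End limits.

Lemma esum_gt_psum {R : realType} {I : choiceType} (D : set I) (a : I -> R) (b : R) :
  (b%:E < \esum_(i in D) (a i)%:E)%E ->
  exists F : {fset I}, b < \sum_(i <- F | i \in D) a i.
Proof.
move=> h; apply: contrapT => nF; move: h; apply/negP; rewrite -leNgt.
apply: esum_le_psum => F; rewrite sumEFin lee_fin leNgt; apply/negP => hF.
by apply: nF; exists F.
Qed.

Lemma big_in_setT {V : nmodType} {I : choiceType} (s : seq I) (a : I -> V) :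
  \sum_(i <- s | i \in [set: I]) a i = \sum_(i <- s) a i.
Proof. by apply: eq_bigl => i; rewrite in_setT. Qed.

Section truncation.
Context {R : realType} {I : choiceType}.

Definition row_sum (x : I -> R) : R := fine (\esum_(i in [set: I]) (x i)%:E)%E.

Lemma row_sum_total (x y : I -> R) Y : (forall i, 0 <= x i <= y i) -> row_total y Y ->
  row_total x (row_sum x).
Proof.
by move=> xy /(row_total_dom xy)[X hX _]; rewrite /row_sum; have := hX; rewrite hX.2.
Qed.

Definition lower_trunc (x : I -> R) e i := Num.max (x i - e) 0.
Definition upper_trunc (x : I -> R) e i := Num.min (x i) e.

Variables (x : I -> R) (X : R).
Hypothesis hx : row_total x X.

Lemma lower_trunc_bound e i : 0 < e -> 0 <= lower_trunc x e i <= x i.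
Proof.
move=> e0; rewrite /lower_trunc le_max lexx orbT /= ge_max hx.1 andbT.
by rewrite lerBlDr lerDl ltW.
Qed.

Lemma upper_trunc_bound e i : 0 < e -> 0 <= upper_trunc x e i <= x i.
Proof. by move=> e0; rewrite /upper_trunc le_min hx.1 ltW//= ge_min lexx. Qed.

Lemma truncD e i : lower_trunc x e i + upper_trunc x e i = x i.
Proof.
rewrite /lower_trunc /upper_trunc maxEle minEle subr_le0.
by case: leP => _; rewrite ?add0r ?subrK.
Qed.

Lemma lower_trunc_cvg i : lower_trunc x e i @[e --> 0^'+] --> x i.
Proof.
apply/cvgrPdist_lt => eta eta0; near=> e.
have e0 : 0 < e by near: e; exact: nbhs_right_gt.
have e1 : e < eta by near: e; exact: nbhs_right_lt.
have /andP[z0 zx] := lower_trunc_bound i e0.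
rewrite ger0_norm ?subr_ge0//.
have : x i - e <= lower_trunc x e i by rewrite /lower_trunc le_max lexx.
by lra.
Unshelve. all: by end_near. Qed.

(** A finite set [F] carries [X] up to [eta / 2], and truncation removes at most [e] from each of
    its entries. *)
Lemma lower_row_sum_cvg : row_sum (lower_trunc x e) @[e --> 0^'+] --> X.
Proof.
apply/cvgrPdist_lt => eta eta0.
have [F hF] : exists F : {fset I}, X - eta / 2 < \sum_(i <- F | i \in [set: I]) x i.
  by apply: esum_gt_psum; rewrite hx.2 lte_fin ltrBlDr ltrDl divr_gt0.
pose N : R := (size F)%:R; have N0 : 0 <= N by [].
near=> e.
have e0 : 0 < e by near: e; exact: nbhs_right_gt.
have e1 : e < eta / 2 / (N + 1).
  by near: e; apply: nbhs_right_lt; rewrite !divr_gt0// ltr_wpDl.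
have zt := row_sum_total (fun i => lower_trunc_bound i e0) hx.
have zX : row_sum (lower_trunc x e) <= X.
  have [Z hZ ZX] := row_total_dom (fun i => lower_trunc_bound i e0) hx.
  by rewrite (row_total_unique zt hZ).
rewrite ger0_norm ?subr_ge0//.
have h1 : \sum_(i <- F | i \in [set: I]) lower_trunc x e i <= row_sum (lower_trunc x e).
  by rewrite -lee_fin -zt.2 -sumEFin psum_le_esum.
have h2 : \sum_(i <- F | i \in [set: I]) x i - N * e <=
    \sum_(i <- F | i \in [set: I]) lower_trunc x e i.
  rewrite /N mulr_natl -iter_addr_0 -count_predT -big_const_seq.
  by rewrite !big_in_setT -sumrB; apply: ler_sum => i _; rewrite /lower_trunc le_max lexx.
have h3 : N * e < eta / 2.
  rewrite ltr_pdivlMr ?ltr_wpDl// in e1.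
  by apply: le_lt_trans e1; rewrite mulrC ler_pM2l// lerDl.
by move: h1 h2 h3 hF; lra.
Unshelve. all: by end_near. Qed.

Lemma ent_term_trunc_cvg i :
  ent_term (row_sum (lower_trunc x e)) (lower_trunc x e i) @[e --> 0^'+] --> ent_term X (x i).
Proof.
have := hx.1 i; rewrite le_eqVlt => /orP[/eqP xi0|xi0].
  (* [ln] is continuous only at positive arguments; for a zero entry the term is [0] for every
     [e > 0]. *)
  rewrite -xi0 ent_term0; apply: cvg_near_cst; near=> e.
  have e0 : 0 < e by near: e; exact: nbhs_right_gt.
  have := lower_trunc_bound i e0; rewrite -xi0 => /le_anti <-.
  by rewrite ent_term0.
have X0 := lt_le_trans xi0 (row_total_le i hx).
have cz := @lower_trunc_cvg i.
apply: cvgM => //.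
apply: (continuous_cvg _ (continuous_ln (divr_gt0 X0 xi0))).
apply: cvgM; first exact: lower_row_sum_cvg.
by apply: cvgV => //; rewrite gt_eqF.
Unshelve. all: by end_near. Qed.

End truncation.

Section array_truncation.
Context {R : realType} {K I : choiceType}.
Variables (x : K -> I -> R) (X : K -> R).
Hypothesis hx : array_total x X.

Lemma lower_array_total e : 0 < e ->
  array_total (fun k => lower_trunc (x k) e) (fun k => row_sum (lower_trunc (x k) e)).
Proof. by move=> e0 k; apply: row_sum_total (hx k) => i; exact: lower_trunc_bound. Qed.

Lemma upper_array_total e : 0 < e ->
  array_total (fun k => upper_trunc (x k) e) (fun k => row_sum (upper_trunc (x k) e)).
Proof. by move=> e0 k; apply: row_sum_total (hx k) => i; exact: upper_trunc_bound. Qed.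

Let SZ e := array_ent (fun k => row_sum (lower_trunc (x k) e)) (fun k => lower_trunc (x k) e).
Let SW e := array_ent (fun k => row_sum (upper_trunc (x k) e)) (fun k => upper_trunc (x k) e).

Lemma lower_array_ent_le e : 0 < e -> (SZ e <= array_ent X x)%E.
Proof.
move=> e0; apply: (array_ent_mono (lower_array_total e0) hx) => k i.
by have /andP[] := lower_trunc_bound (hx k) i e0.
Qed.

Lemma trunc_array_ent_le e : 0 < e -> (SZ e + SW e <= array_ent X x)%E.
Proof.
move=> e0; have hz := lower_array_total e0; have hw := upper_array_total e0.
apply: (le_trans (array_superadditive hz hw)); rewrite le_eqVlt; apply/orP; left.
have E k : (fun i => lower_trunc (x k) e i + upper_trunc (x k) e i) = x k.
  by apply/funext => i; exact: truncD.
apply/eqP; apply: eq_esum => k _; apply: eq_esum => i _; congr (ent_term _ _)%:E.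
  by have := row_totalD (hz k) (hw k); rewrite E => /row_total_unique; apply.
exact: truncD.
Qed.

(** Finitely many terms already add up to more than [a], each of them converges, and the others are
    nonnegative. The bound from above is monotonicity. *)
Lemma lower_array_ent_cvg : SZ e @[e --> 0^'+] --> array_ent X x.
Proof.
apply: lower_cvg.
- exact: lt_le_trans (ltNyr 0) (array_ent_ge0 hx).
- by near=> e; apply: lower_array_ent_le; near: e; exact: nbhs_right_gt.
move=> a; rewrite /array_ent esum_esum; last first.
  by move=> k i _ _; rewrite lee_fin (row_ent_ge0 _ (hx k)).
move=> /esum_gt_psum[F].
under eq_bigl do rewrite (_ : _ \in _ = true) ?mem_set//.
move=> aF.
pose term p e := ent_term (row_sum (lower_trunc (x p.1) e)) (lower_trunc (x p.1) e p.2).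
have hs := @cvg_sum_seq R _ (enum_fset F) term (fun p => ent_term (X p.1) (x p.1 p.2))
  0^'+ _ (fun p => @ent_term_trunc_cvg _ _ _ _ (hx p.1) p.2).
have h := cvgr_gt _ (hs _) _ aF; near=> e.
have e0 : 0 < e by near: e; exact: nbhs_right_gt.
rewrite /SZ /array_ent esum_esum; last first.
  by move=> k i _ _; rewrite lee_fin (row_ent_ge0 _ (lower_array_total e0 k)).
apply: (@lt_le_trans _ _ (\sum_(p <- F) term p e)%:E).
  by rewrite lte_fin; near: e; exact: h.
apply: le_trans (psum_le_esum _ _ F).
under [leRHS]eq_bigl do rewrite (_ : _ \in _ = true) ?mem_set//.
by rewrite sumEFin.
Unshelve. all: by end_near. Qed.

(** The quantity is squeezed between [0] and [array_ent X x - SZ e], a difference that tends to [0]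
    because the total is finite. *)
Lemma upper_array_ent_cvg : (array_ent X x < +oo)%E -> SW e @[e --> 0^'+] --> 0%E.
Proof.
move=> fin; have Sfin : array_ent X x \is a fin_num.
  by rewrite ge0_fin_numE// array_ent_ge0.
apply: (@squeeze_cvge _ _ _ _ (fun=> 0%E) _ (fun e => array_ent X x - SZ e)%E).
- near=> e; have e0 : 0 < e by near: e; exact: nbhs_right_gt.
  rewrite (array_ent_ge0 (upper_array_total e0))/=.
  rewrite leeBrDr; first by rewrite addeC trunc_array_ent_le.
  rewrite ge0_fin_numE ?(array_ent_ge0 (lower_array_total e0))//.
  by rewrite (le_lt_trans (lower_array_ent_le e0)).
- exact: cvg_cst.
- rewrite -[X in _ --> X](subee Sfin); apply: cvgeB; last exact: lower_array_ent_cvg.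
    by apply: fin_num_adde_defl; rewrite fin_numN.
  exact: cvg_cst.
Unshelve. all: by end_near. Qed.

End array_truncation.

(** * Quantum-classical states *)

Section operator_sums.
Context {R : realType} {H : hilbertType R}.
Hypothesis hb : has_basis H.
Implicit Types S T : H -> H.

Lemma addfunE S T x : (S + T) x = S x + T x.
Proof. by []. Qed.

Lemma qform_add S T x : qform (S + T) x = qform S x + qform T x.
Proof. by rewrite /qform addfunE innerDr ReD. Qed.

Lemma positive_add S T : positive_op S -> positive_op T -> positive_op (S + T).
Proof.
move=> Sp Tp; have [M M0 SM] := bounded_pos Sp.1; have [M' M'0 TM] := bounded_pos Tp.1.
split; last by move=> x; rewrite addfunE innerDr addr_ge0//; [case: Sp|case: Tp] => _; apply.
apply/bounded_opE; split.
  move=> c x y; rewrite !addfunE (positive_lin Sp) (positive_lin Tp) scalerDr.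
  by rewrite (addrACA (c *: S x) (S y)).
exists (M + M') => x; rewrite addfunE (le_trans (nrmD _ _))// mulrDl.
exact: lerD.
Qed.

Lemma trace_add S T : positive_op S -> positive_op T ->
  (trace (S + T)%R = trace S + trace T)%E.
Proof.
move=> Sp Tp; have [E [e [be trE]]] := traceE hb; rewrite !trE.
under eq_esum do rewrite qform_add EFinD.
by rewrite esumD// => i _; rewrite lee_fin qform_ge0.
Qed.

Lemma sorted_row_total T lam phi m : (forall n, 0 <= lam n) ->
  spectral_rep T ([set n | 0 < lam n], lam, phi) -> trace T = m%:E ->
  row_total lam m.
Proof.
move=> l0 h tm; split => //; rewrite -tm (trace_spectral hb h)//.
apply/esym/esum_setT_support => i /negP; rewrite -leNgt => li.
by congr (_%:E); apply/le_anti; rewrite li l0.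
Qed.

End operator_sums.

Section trace_distance.
Context {R : realType} {HA HB HAB : hilbertType R} {K : countType}.
Context (t : HA -> HB -> HAB) (tP : hilbert_tensor t).
Context (ket : K -> HB) (ketP : orthonormal_basis [set: K] ket).
Hypothesis hbA : has_basis HA.
Context (p q : K -> R) (r s : K -> HA -> HA).
Hypotheses (er : ensemble p r) (es : ensemble q s).
Context (x y : K -> nat -> R) (phi psi : K -> nat -> HA).
Hypothesis hx : forall k, [/\ forall n, 0 <= x k n,
  forall n m, (n <= m)%N -> x k m <= x k n
  & spectral_rep (weighted p r k) ([set n | 0 < x k n], x k, phi k)].
Hypothesis hy : forall k, [/\ forall n, 0 <= y k n,
  forall n m, (n <= m)%N -> y k m <= y k n
  & spectral_rep (weighted q s k) ([set n | 0 < y k n], y k, psi k)].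

(* Mirsky's inequality, one-sided.  With [P = |rho - sigma|] and its diagonal
   blocks [P_k], the operator [C_k = (A_k + B_k + P_k) / 2] dominates the blocks
   [A_k] and [B_k] of [rho] and [sigma], hence so do its sorted eigenvalues, and
   [\sum_k tr (C_k - B_k) = tr P / 2]. *)
Lemma trace_distance_eigenvalues (eps : R) :
  ((2^-1)%:E * trace_norm (qc_op t ket (weighted p r) - qc_op t ket (weighted q s))%R
     <= eps%:E)%E ->
  (\esum_(k in [set: K]) \esum_(i in [set: nat]) (Num.max (x k i - y k i) 0)%:E
     <= eps%:E)%E.
Proof.
set rho := qc_op _ _ _; set sigma := qc_op _ _ _ => dist.
have [[E e] /= be] := hbA.
have Ap k := weighted_positive k er; have Bp k := weighted_positive k es.
have AM k a := weighted_le hbA k a er; have BM k a := weighted_le hbA k a es.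
have rp : positive_op rho := qc_op_positive tP ketP be ler01 Ap AM.
have sp : positive_op sigma := qc_op_positive tP ketP be ler01 Bp BM.
have hbAB := tensor_has_basis tP ketP be.
have trr : trace rho = 1%E.
  rewrite (qc_op_trace tP ketP be ler01 Ap AM hbA); case: er => _ <- _.
  by apply: eq_esum => k _; rewrite (weighted_trace hbA).
have trs : trace sigma = 1%E.
  rewrite (qc_op_trace tP ketP be ler01 Bp BM hbA); case: es => _ <- _.
  by apply: eq_esum => k _; rewrite (weighted_trace hbA).
have [Pp P2] : positive_op (abs_op (rho - sigma)) /\
  forall z w, '[z, abs_op (rho - sigma) (abs_op (rho - sigma) w)] = '[(rho - sigma) z, (rho - sigma) w].
  by apply: (abs_op_diff hbAB) => //; rewrite ?trr ?trs ltry.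
move: dist Pp P2; rewrite /trace_norm; set P := abs_op _ => dist Pp P2.
have rs_le z : qform rho z - qform sigma z <= qform P z.
  rewrite /qform -ReB -innerBr; apply: (Loewner Pp (bounded_opB rp.1 sp.1)) => //.
  by apply: selfadjointB; exact: positive_selfadjoint.
have sr_le z : qform sigma z - qform rho z <= qform P z.
  rewrite /qform -ReB -innerBr; apply: (Loewner Pp (bounded_opB sp.1 rp.1)).
    by apply: selfadjointB; exact: positive_selfadjoint.
  move=> w; rewrite P2.
  by rewrite !subfunE -(opprB (sigma w)) innerNl innerNr opprK.
(* [P] is not shown to be block diagonal; compression to its diagonal blocks preserves positivity
   and the total trace. *)
pose Pk k a := coiso t ket E e k (P (iso t ket k a)).
have qPk k a : '[a, Pk k a] = '[iso t ket k a, P (iso t ket k a)].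
  by rewrite (coiso_inner tP ketP be).
have Pkp k : positive_op (Pk k).
  split; last by move=> a; rewrite qPk; case: Pp => _; apply.
  have [M M0 PM] := bounded_pos Pp.1; apply/bounded_opE; split.
    move=> c a b; rewrite /Pk (iso_lin tP ket k) (positive_lin Pp).
    by rewrite (coiso_lin tP ketP be).
  exists M => a; rewrite (le_trans (coiso_nrm_le tP ketP be _ _))//.
  by rewrite (le_trans (PM _))// (iso_nrm tP ketP).
have trP : (\esum_(k in [set: K]) trace (Pk k) = trace P)%E.
  rewrite (basis_trace hbAB (tensor_basisP tP ketP be) Pp).
  have -> : E `*` [set: K] = E `*`` (fun=> [set: K]) by apply/seteqP; split=> -[].
  rewrite -(esum_esum (a := fun i k => (qform P (iso t ket k (e i)))%:E)); last first.
    by move=> i k _ _; rewrite lee_fin qform_ge0.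
  rewrite esum_exchange; last by move=> i k _ _; rewrite lee_fin qform_ge0.
  apply: eq_esum => k _; rewrite (basis_trace hbA be (Pkp k)).
  by apply: eq_esum => i _; rewrite {1}/qform qPk.
have trP_le : (trace P <= (2 * eps)%:E)%E.
  by rewrite EFinM -lee_pdivrMl.
have Pk0 k : (0 <= trace (Pk k))%E by exact: trace_ge0.
have /choice[pi piE] : forall k, exists v : R, trace (Pk k) = v%:E.
  move=> k.
  exists (fine (trace (Pk k))); rewrite fineK// ge0_fin_numE//.
  apply: (@le_lt_trans _ _ (2 * eps)%:E); last exact: ltry.
  apply: le_trans trP_le; rewrite -trP.
  apply: le_trans (psum_le_esum _ _ [fset k]%fset).
  by rewrite big_mkcond big_seq_fset1 mem_set.
have half0 : (0 : R) <= 2^-1 by rewrite invr_ge0.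
pose C k := (2^-1)%:C *: ((weighted p r k + weighted q s k) + Pk k) : HA -> HA.
have ABp k : positive_op (weighted p r k + weighted q s k) by exact: positive_add.
have Cp k : positive_op (C k) by apply: positive_scale => //; exact: positive_add.
have qC k a : qform (C k) a =
    2^-1 * (qform (weighted p r k) a + qform (weighted q s k) a + qform (Pk k) a).
  by rewrite /C qform_scale !qform_add.
have trC k : trace (C k) = (2^-1 * (p k + q k + pi k))%:E.
  rewrite /C (trace_scale hbA)//; last exact: positive_add.
  by rewrite !(trace_add hbA)// !(weighted_trace hbA)// piE.
have qiso (X : K -> HA -> HA) k a (Xp : forall k, positive_op (X k))
    (XM : forall k a, qform (X k) a <= 1 * nrm a ^+ 2) :
    qform (qc_op t ket X) (iso t ket k a) = qform (X k) a.
  rewrite /qform -(coiso_inner tP ketP be) (coiso_qc_op tP ketP be ler01 Xp XM).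
  by rewrite (coiso_isoK tP ketP be).
have AC k a : qform (weighted p r k) a <= qform (C k) a.
  have := rs_le (iso t ket k a); rewrite !qiso// qC.
  by rewrite [qform P _]/qform -qPk -/(qform (Pk k) a); lra.
have BC k a : qform (weighted q s k) a <= qform (C k) a.
  have := sr_le (iso t ket k a); rewrite !qiso// qC.
  by rewrite [qform P _]/qform -qPk -/(qform (Pk k) a); lra.
(* Both [x k] and [y k] lie below the sorted eigenvalues [c] of [C k], so each positive part is at
   most [c - y k], and these differences add up to the difference of the traces. *)
have row k : (\esum_(i in [set: nat]) (Num.max (x k i - y k i) 0)%:E <=
    (2^-1 * (p k + q k + pi k) - q k)%:E)%E.
  have [x0 xm xr] := hx k; have [y0 ym yr] := hy k.
  have [|c [chi [c0 cm cr]]] := spectral_positive hbA (Cp k); first by rewrite trC ltry.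
  have xc n := Weyl n x0 xm c0 cm xr cr (AC k).
  have yc n := Weyl n y0 ym c0 cm yr cr (BC k).
  have ct := sorted_row_total hbA c0 cr (trC k).
  have yt := sorted_row_total hbA y0 yr (weighted_trace hbA k es).
  rewrite -(row_totalB yt ct yc).2; apply: le_esum => i _.
  by rewrite lee_fin ge_max subr_ge0 yc lerB.
apply: (@le_trans _ _ (\esum_(k in [set: K]) (2^-1 * (p k + q k + pi k) - q k)%:E)%E).
  by apply: le_esum => k _; exact: row.
have u0 k : (0 <= (2^-1 * (p k + q k + pi k) - q k)%:E)%E.
  by apply: le_trans (row k); apply: esum_ge0 => i _; rewrite lee_fin le_max lexx orbT.
have p0 k : 0 <= p k by case: er.
have q0 k : 0 <= q k by case: es.
have pi0 k : 0 <= pi k by rewrite -lee_fin -piE.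
(* Adding [2^-1], half the sum of [q], turns the signed summands into half of [p k + pi k] and
   avoids subtracting infinite sums. *)
rewrite -(@leeD2rE _ (2^-1)%:E)//.
have halfE : (2^-1)%:E = (\esum_(k in [set: K]) (2^-1)%:E * (q k)%:E)%E :> \bar R.
  rewrite esumZ//; last by move=> k _; rewrite lee_fin.
  by case: es => _ -> _; rewrite mule1.
rewrite {1}halfE -esumD//; last first.
  by move=> k _; rewrite -EFinM lee_fin mulr_ge0.
apply: (@le_trans _ _ (\esum_(k in [set: K]) ((2^-1)%:E * (p k)%:E + (2^-1)%:E * (pi k)%:E))%E).
  by apply: le_esum => k _; rewrite -!EFinM -!EFinD lee_fin; lra.
rewrite esumD; last 2 first.
- by move=> k _; rewrite -EFinM lee_fin mulr_ge0.
- by move=> k _; rewrite -EFinM lee_fin mulr_ge0.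
rewrite !esumZ//; last 2 first.
- by move=> k _; rewrite lee_fin.
- by move=> k _; rewrite lee_fin.
have -> : (\esum_(k in [set: K]) (pi k)%:E = trace P)%E.
  by rewrite -trP; apply: eq_esum => k _; rewrite piE.
by case: er => _ -> _; rewrite mule1 addeC leeD2r.
Qed.

End trace_distance.

Section truncated_blocks.
Context {R : realType} {HA HB HAB : hilbertType R} {K : countType}.
Context (t : HA -> HB -> HAB) (tP : hilbert_tensor t).
Context (ket : K -> HB) (ketP : orthonormal_basis [set: K] ket).
Hypothesis hbA : has_basis HA.
Context (p : K -> R) (r : K -> HA -> HA).
Hypotheses (er : ensemble p r).
Context (x : K -> nat -> R) (phi : K -> nat -> HA).
Hypothesis hx : forall k, [/\ forall n, 0 <= x k n,
  forall n m, (n <= m)%N -> x k m <= x k n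
  & spectral_rep (weighted p r k) ([set n | 0 < x k n], x k, phi k)].

Lemma eigenvalues_total : array_total x p.
Proof.
move=> k; have [x0 _ xr] := hx k.
exact: (sorted_row_total hbA x0 xr (weighted_trace hbA k er)).
Qed.

Lemma cond_entropy_eigenvalues :
  cond_entropy t ket (qc_op t ket (weighted p r)) = array_ent p x.
Proof.
have xr k : spectral_rep (weighted p r k) ([set n | 0 < x k n], x k, phi k).
  by case: (hx k).
rewrite (cond_entropy_ensemble tP ketP hbA er xr); apply: eq_esum => k _.
apply: esum_setT_support => i /negP; rewrite -leNgt => xi.
have [x0 _ _] := hx k.
by rewrite (_ : x k i = 0) ?ent_term0//; apply/le_anti; rewrite xi x0.
Qed.

(** The condition on [f] covers both truncations at once: it gives [f 0 = 0], and it bounds the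
    traces of the new blocks by [p]. *)
Lemma cond_entropy_cone_fcalc (f : R -> R) :
  (forall u, 0 <= u -> 0 <= f u <= u) ->
  cond_entropy_cone t ket (qc_op t ket (fun k => fcalc f (weighted p r k))) =
  array_ent (fun k => row_sum (f \o x k)) (fun k => f \o x k).
Proof.
move=> fb.
have f0 : f 0 = 0 by have /le_anti := fb 0 (lexx 0).
have x0 k i : 0 <= x k i by case: (hx k).
have xt := eigenvalues_total.
have x1 k i : x k i <= 1 by rewrite (le_trans (row_total_le i (xt k)))// (ensemble_le1 k er).
have f01 u : 0 <= u <= 1 -> `|f u| <= 1.
  by move=> /andP[u0 u1]; have /andP[fu0 fu] := fb u u0; rewrite ger0_norm// (le_trans fu).
have hf k : spectral_rep (fcalc f (weighted p r k)) ([set n | 0 < x k n], f \o x k, phi k).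
  have [_ _ xr] := hx k.
  apply: (fcalc_spectral (weighted_positive k er) _ f01 f0 xr) => a.
  exact: (weighted_le hbA).
have fp k : positive_op (fcalc f (weighted p r k)).
  apply: (@spectral_rep_positive _ _ _ _ _ _ 1 (hf k)) => i _ /=.
  by have /andP[-> /le_trans ->] := fb _ (x0 k i).
have ft k : row_total (f \o x k) (row_sum (f \o x k)).
  by apply: row_sum_total (xt k) => i; exact: fb.
have nD k i : ~ [set n | 0 < x k n] i -> x k i = 0.
  by move=> /negP; rewrite -leNgt => xi; apply/le_anti; rewrite xi x0.
have ftr k : trace (fcalc f (weighted p r k)) = (row_sum (f \o x k))%:E.
  rewrite (trace_spectral hbA (hf k)); last by move=> i _ /=; have /andP[] := fb _ (x0 k i).
  by rewrite -(ft k).2; apply: esum_setT_support => i /nD /= ->; rewrite f0.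
(* The probabilities sum to [1], so [K] is inhabited; [r k0] then fills the blocks of trace zero in
   the normalization. *)
have [k0 _] : exists k0 : K, True.
  apply: contrapT => nK; have [_ p1 _] := er; move: p1.
  rewrite esum1; first by move=> [] /esym/eqP; rewrite oner_eq0.
  by move=> k _; case: nK; exists k.
have [_ _ st] := er.
rewrite (cond_entropy_cone_blocks tP ketP hbA (st k0) fp ftr hf); last first.
  apply: (@le_lt_trans _ _ (\esum_(k in [set: K]) (p k)%:E)%E).
    apply: le_esum => k _; rewrite lee_fin.
    have [Z hZ Zp] := row_total_dom (fun i => fb _ (x0 k i)) (xt k).
    by rewrite (row_total_unique (ft k) hZ).
  by case: er => _ -> _; rewrite ltry.
apply: eq_esum => k _; apply: esum_setT_support => i /nD /= ->.
by rewrite f0 ent_term0.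
Qed.

End truncated_blocks.


Theorem proposition5 (R : realType) (HA HB HAB : hilbertType R)
    (sepA : separable HA) (sepB : separable HB)
    (t : HA -> HB -> HAB) (tP : hilbert_tensor t)
    (K : countType) (ket : K -> HB) (ketP : orthonormal_basis [set: K] ket)
    (p : K -> R) (r : K -> HA -> HA) (prP : ensemble p r) :
  let rho := qc_op t ket (weighted p r) in
  let S := cond_entropy t ket in
  let Scone := cond_entropy_cone t ket in
  let L := Lqc t ket rho in
  let rho_minus := fun eps : R =>
    qc_op t ket (fun k => op_posB (weighted p r k) eps) in
  let rho_min := fun eps : R =>
    qc_op t ket (fun k => op_min (weighted p r k) eps) in
  [/\ forall eps : R, 0 < eps -> eps <= 1 ->
        (Scone (rho_minus eps) - (g eps)%:E <= L eps)%E,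
      (S rho < +oo)%E -> forall eps : R, 0 < eps -> eps <= 1 ->
        (S rho - Scone (rho_min eps) - (g eps)%:E <= L eps)%E,
      (Scone (rho_minus eps) - (g eps)%:E)%E @[eps --> 0^'+] --> S rho
    & (S rho < +oo)%E ->
      (S rho - Scone (rho_min eps) - (g eps)%:E)%E @[eps --> 0^'+] --> S rho].
Proof.
move=> rho S Scone L rho_minus rho_min.
have hbA := separable_basis sepA.
have eigen (q : K -> R) (s : K -> HA -> HA) : ensemble q s ->
    exists y psi, forall k, [/\ forall n, 0 <= y k n,
      forall n m, (n <= m)%N -> y k m <= y k n
    & spectral_rep (weighted q s k) ([set n | 0 < y k n], y k, psi k)].
  move=> es.
  have /choice[f hf] : forall k, exists ypsi : (nat -> R) * (nat -> HA),
      [/\ forall n, 0 <= ypsi.1 n, forall n m, (n <= m)%N -> ypsi.1 m <= ypsi.1 n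
      & spectral_rep (weighted q s k) ([set n | 0 < ypsi.1 n], ypsi.1, ypsi.2)].
    move=> k; have [|y [psi h]] := spectral_positive hbA (weighted_positive k es).
      by rewrite (weighted_trace hbA k es) ltry.
    by exists (y, psi).
  by exists (fun k => (f k).1), (fun k => (f k).2).
have [x [phi hx]] := eigen _ _ prP.
have xt := eigenvalues_total hbA prP hx.
have SE : S rho = array_ent p x := cond_entropy_eigenvalues tP ketP hbA prP hx.
pose SZ e := array_ent (fun k => row_sum (lower_trunc (x k) e)) (fun k => lower_trunc (x k) e).
pose SW e := array_ent (fun k => row_sum (upper_trunc (x k) e)) (fun k => upper_trunc (x k) e).
have SZE e : 0 < e -> Scone (rho_minus e) = SZ e.
  move=> e0; apply: (cond_entropy_cone_fcalc tP ketP hbA prP hx) => u u0.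
  by rewrite le_max lexx orbT ge_max u0 andbT lerBlDr lerDl ltW.
have SWE e : 0 < e -> Scone (rho_min e) = SW e.
  move=> e0; apply: (cond_entropy_cone_fcalc tP ketP hbA prP hx) => u u0.
  by rewrite le_min u0 ltW//= ge_min lexx.
have nearby (e : R) sigma : 0 < e -> qc_state t ket sigma ->
    ((2^-1)%:E * trace_norm (rho - sigma)%R <= e%:E)%E ->
    exists (q : K -> R) y, [/\ array_total y q, (\esum_(k in [set: K]) (q k)%:E = 1)%E,
      cond_entropy t ket sigma = array_ent q y
      & (\esum_(k in [set: K]) \esum_(i in [set: nat])
           (Num.max (x k i - y k i) 0)%:E <= e%:E)%E].
  move=> e0 [[q s] [/= es ->]] dist; have [y [psi hy]] := eigen _ _ es.
  exists q, y; split.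
  - exact (eigenvalues_total hbA es hy).
  - by case: es.
  - exact (cond_entropy_eigenvalues tP ketP hbA es hy).
  - exact: (trace_distance_eigenvalues tP ketP hbA prP es hx hy).
split.
- move=> e e0 _; apply: le_ereal_inf_tmp => _ [sigma [qs dist] <-].
  have [q [y [yt _ -> d_le]]] := nearby _ _ e0 qs dist.
  rewrite SZE// (@le_trans _ _ (SZ e))//; first by rewrite leeBlDr// leeDl// lee_fin g_ge0.
  apply: (array_ent_mono (lower_array_total xt e0) yt) => k i.
  rewrite /lower_trunc ge_max (yt k).1 andbT lerBlDr -lerBlDl.
  rewrite -lee_fin (le_trans _ d_le)//.
  apply: le_trans (psum_le_esum _ _ [fset k]%fset).
  rewrite big_in_setT big_seq_fset1.
  apply: le_trans (psum_le_esum _ _ [fset i]%fset).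
  by rewrite big_in_setT big_seq_fset1 lee_fin le_max lexx.
- move=> fin e e0 _; apply: le_ereal_inf_tmp => _ [sigma [qs dist] <-].
  have [q [y [yt q1 -> d_le]]] := nearby _ _ e0 qs dist.
  have wt := upper_array_total xt e0.
  pose d k i := Num.max (x k i - y k i) 0.
  have dx k i : 0 <= d k i <= x k i.
    by rewrite /d le_max lexx orbT /= ge_max (xt k).1 andbT lerBlDr lerDl (yt k).1.
  have dt : array_total d (fun k => row_sum (d k)) by move=> k; exact: row_sum_total (xt k).
  have dD : (\esum_(k in [set: K]) (row_sum (d k))%:E <= e%:E)%E.
    by apply: le_trans d_le; apply: le_esum => k _; rewrite -(dt k).2.
  have xyd k i : x k i <= y k i + d k i by rewrite -lerBlDl /d le_max lexx.
  have dw k i : d k i <= upper_trunc (x k) e i.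
    have /andP[_ dxk] := dx k i; rewrite /upper_trunc le_min dxk /=.
    rewrite -lee_fin (le_trans _ dD)// (le_trans _ (psum_le_esum _ _ [fset k]%fset))//.
    by rewrite big_in_setT big_seq_fset1 lee_fin (row_total_le _ (dt k)).
  have h1 := array_ent_mono xt (fun k => row_totalD (yt k) (dt k)) xyd.
  have h2 := array_sum_le yt dt e0 q1 dD.
  have h3 := array_ent_mono dt wt dw.
  (* Finiteness of [S rho] passes to [SW e], so that the latter can be moved across the
     inequality. *)
  have Wle : (SW e <= S rho)%E.
    rewrite SE; apply: le_trans (trunc_array_ent_le xt e0).
    by rewrite leeDr// array_ent_ge0//; exact: lower_array_total.
  have Wfin : SW e \is a fin_num.
    by rewrite ge0_fin_numE ?(le_lt_trans Wle)// array_ent_ge0.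
  rewrite SWE// SE leeBlDr// leeBlDr// (le_trans h1)// (le_trans h2)//.
  by rewrite addeAC leeD2l.
- rewrite SE -[X in _ --> X](sube0 (array_ent p x)).
  apply: (@cvg_trans _ ((SZ e - (g e)%:E)%E @[e --> 0^'+])).
    (* [Scone] is identified with [SZ] for positive [e] only, which is all that a right neighborhood
       of [0] contains. *)
    apply: near_eq_cvg; near=> e.
    have e0 : 0 < e by near: e; exact: nbhs_right_gt.
    by rewrite SZE.
  apply: cvgeB; first by rewrite fin_num_adde_defl.
    exact: lower_array_ent_cvg.
  by apply: cvg_EFin; [exact: nearW | exact: g_cvg0].
- rewrite SE => fin.
  have Sfin : array_ent p x \is a fin_num by rewrite ge0_fin_numE// array_ent_ge0.
  rewrite -[X in _ --> X](sube0 (array_ent p x)) -[X in (X - _)%E](sube0 (array_ent p x)).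
  apply: (@cvg_trans _ ((array_ent p x - SW e - (g e)%:E)%E @[e --> 0^'+])).
    apply: near_eq_cvg; near=> e.
    have e0 : 0 < e by near: e; exact: nbhs_right_gt.
    by rewrite SWE.
  apply: cvgeB; first by rewrite fin_num_adde_defl.
    apply: cvgeB; first by rewrite fin_num_adde_defl.
      exact: cvg_cst.
    exact: upper_array_ent_cvg.
  by apply: cvg_EFin; [exact: nearW | exact: g_cvg0].
Unshelve. all: by end_near. Qed.
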